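(* Assume $N\ge1$ and let $f\in C^1([0,+\infty))$ be a convex function. Let $\rho\in O(N)$ and let $\Omega\subset\mathbb{R}^N$ be a $\rho$-invariant bounded domain, i.e. a bounded domain such that $\rho(\Omega)=\Omega$. Let $c\ge0$ be a constant and assume that $u\in H^1(\Omega)$ satisfies $u-c\in H^1_0(\Omega)$, that $f(u)\in L^1_{loc}(\Omega)$, and that $u$ is a stable solution to $$-\Delta u=f(u)\ \text{ in }\mathcal D'(\Omega),\qquad u\ge0\ \text{ a.e. on }\Omega.$$ If $\rho$ has a fixed point in $\Omega$, then $u$ is $\rho$-invariant, namely $u(x)=u(\rho x)$ for almost every $x\in\Omega$.
   Context: A solution $u\in H^1_{loc}(\Omega)$, $u\ge0$ a.e., with $f(u)\in L^1_{loc}(\Omega)$ of $-\Delta u=f(u)$ in $\mathcal D'(\Omega)$ is called stable in $\Omega$ if $f'(u)\in L^1_{loc}(\Omega)$ and $\int_\Omega f'(u)\varphi^2\le\int_\Omega|\nabla\varphi|^2$ for every $\varphi\in C^1_c(\Omega)$. $O(N)$ is the orthogonal group of $\mathbb{R}^N$. *)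

(* Defs.v *)
(* MathComp-Analysis, over an abstract R : realType. *)
From HB Require Import structures.
From mathcomp Require Import all_boot all_order all_algebra.
From mathcomp Require Import all_classical all_reals all_analysis.

Set Implicit Arguments.
Unset Strict Implicit.
Unset Printing Implicit Defensive.

Import Order.TTheory GRing.Theory Num.Theory.
Import numFieldNormedType.Exports.

Local Open Scope classical_set_scope.
Local Open Scope ring_scope.

(* The sigma-algebra on R^n is the one generated by the coordinates, which is
   the Borel sigma-algebra (R^n is second countable). Working with Borel rather
   than Lebesgue measurable functions is harmless: all the notions below only
   depend on functions up to null sets. *)
Fact rv_display : measure_display.
Proof. exact: default_measure_display. Qed.

Section measurable_rv.
Context {R : realType} (n : nat).

Definition rv_coord (i : 'I_n) (x : 'rV[R]_n) : R := x ord0 i.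

Let rv_set0 : g_sigma_preimage rv_coord set0.
Proof. exact: sigma_algebra0. Qed.

Let rv_setC A : g_sigma_preimage rv_coord A -> g_sigma_preimage rv_coord (~` A).
Proof. exact: sigma_algebraC. Qed.

Let rv_bigcup (F : (set 'rV[R]_n)^nat) :
  (forall i, g_sigma_preimage rv_coord (F i)) ->
  g_sigma_preimage rv_coord (\bigcup_i (F i)).
Proof. exact: sigma_algebra_bigcup. Qed.

HB.instance Definition _ := @isMeasurable.Build rv_display 'rV[R]_n
  (g_sigma_preimage rv_coord) rv_set0 rv_setC rv_bigcup.

End measurable_rv.

Section measurable_rv_fun.
Context {R : realType}.

Lemma measurable_rv_coord n (i : 'I_n) :
  measurable_fun [set: 'rV[R]_n] (rv_coord i).
Proof.
move=> _ Y mY; rewrite setTI; apply: sub_sigma_algebra => /=.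
rewrite -bigcup_seq/=; exists i => /=; first by rewrite mem_index_enum.
by exists Y => //; rewrite setTI.
Qed.

Lemma measurable_rvP d (T : measurableType d) n (f : T -> 'rV[R]_n) :
  (forall i, measurable_fun [set: T] (rv_coord i \o f)) ->
  measurable_fun [set: T] f.
Proof.
move=> mf _ A mA; rewrite setTI.
move: A mA; apply: (@smallest_sub _ (sigma_algebra setT) _
  [set A | measurable (f @^-1` A)]) => /=.
  split => /=.
  - by rewrite preimage_set0.
  - by move=> A mA; rewrite setTD preimage_setC; exact: measurableC.
  - by move=> F mF; rewrite preimage_bigcup; exact: bigcupT_measurable.
rewrite -bigcup_seq/=; apply: bigcup_sub => i _.
by move=> A [B mB <-]/=; rewrite setTI -comp_preimage -[_ @^-1` _]setTI; exact: mf.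
Qed.

(* The identification of R x R^n with R^(n+1). *)
Definition rv_cons n (p : measurableTypeR R * 'rV[R]_n) : 'rV[R]_n.+1 :=
  row_mx (p.1)%:M p.2.

Definition rv_uncons n (x : 'rV[R]_n.+1) : measurableTypeR R * 'rV[R]_n :=
  (x ord0 ord0, \row_j x ord0 (lift ord0 j)).

Lemma rv_cons0 n (p : measurableTypeR R * 'rV[R]_n) : rv_cons p ord0 ord0 = p.1.
Proof. by rewrite mxE; case: splitP => [k _|k //]; rewrite mxE (ord1 k). Qed.

Lemma rv_consS n (p : measurableTypeR R * 'rV[R]_n) j :
  rv_cons p ord0 (lift ord0 j) = p.2 ord0 j.
Proof.
rewrite mxE; case: splitP => [k|k]; first by rewrite ord1 lift0.
by rewrite lift0 => -[jk]; congr (p.2 _ _); exact/val_inj.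
Qed.

Lemma rv_unconsK n : cancel (@rv_uncons n) (@rv_cons n).
Proof.
move=> x; apply/rowP => i.
have [j ->|->] := unliftP ord0 i; first by rewrite rv_consS mxE.
by rewrite rv_cons0.
Qed.

Lemma rv_consK n : cancel (@rv_cons n) (@rv_uncons n).
Proof.
move=> p; rewrite /rv_uncons rv_cons0 [RHS]surjective_pairing; congr pair.
by apply/rowP => j; rewrite mxE rv_consS.
Qed.

Lemma measurable_rv_cons n :
  measurable_fun [set: measurableTypeR R * 'rV[R]_n] (@rv_cons n).
Proof.
apply: measurable_rvP => i; have [j ->|->] := unliftP ord0 i.
- rewrite (_ : _ \o _ = rv_coord j \o snd); last first.
    by apply/funext => p /=; rewrite /rv_coord rv_consS.
  by apply: measurableT_comp => //; exact: measurable_rv_coord.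
- by rewrite (_ : _ \o _ = fst)//; apply/funext => p /=; exact: rv_cons0.
Qed.

Lemma measurable_rv_uncons n :
  measurable_fun [set: 'rV[R]_n.+1] (@rv_uncons n).
Proof.
apply/measurable_fun_pairP; split; first exact: (measurable_rv_coord ord0).
apply: measurable_rvP => j.
rewrite (_ : _ \o _ = rv_coord (lift ord0 j)); first exact: measurable_rv_coord.
by apply/funext => x; rewrite /rv_coord /= mxE.
Qed.

End measurable_rv_fun.

(* n-dimensional Lebesgue measure, as the n-fold product of the Lebesgue measure
   on R: the image of lebesgue_measure \x lebesgue_rv n under rv_cons. *)
Fixpoint lebesgue_rv {R : realType} (n : nat) : set 'rV[R]_n -> \bar R :=
  match n return set 'rV[R]_n -> \bar R with
  | 0 => \d_(0 : 'rV[R]_0)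
  | n'.+1 => pushforward ((@lebesgue_measure R) \x @lebesgue_rv R n')%E
               (@rv_cons R n')
  end.

Section lebesgue_rv_measure.
Context {R : realType}.

Lemma lebesgue_rv_sigma_finite_measure n :
  exists m : {sigma_finite_measure set 'rV[R]_n -> \bar R},
    @lebesgue_rv R n = m.
Proof.
elim: n => [|n [m mE]]; first by exists (\d_(0 : 'rV[R]_0)).
pose p : {measure set (measurableTypeR R * 'rV[R]_n)%type -> \bar R} :=
  (@lebesgue_measure R \x m)%E.
pose q : {measure set 'rV[R]_n.+1 -> \bar R} :=
  measure_function_pushforward__canonical__measure_function_Measure
    p (@measurable_rv_cons R n).
have qsf : sigma_finite setT q.
  have [F FT Foo] : sigma_finite setT p.
    have /sigma_finiteP[F [TF ndF Foo]] := sigma_finiteT (@lebesgue_measure R).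
    have /sigma_finiteP[G [TG ndG Goo]] := sigma_finiteT m.
    exists (fun k => F k `*` G k).
      apply/esym; rewrite -subTset => -[x y] _.
      have [i _ Fx] : (\bigcup_i F i) x by rewrite -TF.
      have [j _ Gy] : (\bigcup_j G j) y by rewrite -TG.
      exists (maxn i j) => //; split => /=.
      - by move: x Fx; exact/subsetPset/ndF/leq_maxl.
      - by move: y Gy; exact/subsetPset/ndG/leq_maxr.
    move=> k; have [mF Fk] := Foo k; have [mG Gk] := Goo k.
    split; first exact: measurableX.
    by rewrite /p /= product_measure1E// lte_mul_pinfty// ge0_fin_numE.
  exists (fun i => @rv_uncons R n @^-1` F i).
    by rewrite -preimage_bigcup -FT preimage_setT.
  move=> i; have [mF pF] := Foo i; split.
    by rewrite -[X in measurable X]setTI; exact: measurable_rv_uncons.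
  rewrite /= /pushforward -comp_preimage.
  by rewrite (_ : _ \o _ = id) ?preimage_id//; apply/funext; exact: rv_consK.
pose qs := Measure_isSigmaFinite.Build _ _ _ q qsf.
pose q' : {sigma_finite_measure set 'rV[R]_n.+1 -> \bar R} :=
  HB.pack_for (SigmaFiniteMeasure.type 'rV[R]_n.+1 R) (Measure.sort q) qs.
by exists q'; rewrite /= mE.
Qed.

Let lebesgue_rv0 n : @lebesgue_rv R n set0 = 0%E.
Proof.
by have [m ->] := lebesgue_rv_sigma_finite_measure n; rewrite measure0.
Qed.

Let lebesgue_rv_ge0 n A : (0 <= @lebesgue_rv R n A)%E.
Proof.
by have [m ->] := lebesgue_rv_sigma_finite_measure n; exact: measure_ge0.
Qed.

Let lebesgue_rv_sigma_additive n : semi_sigma_additive (@lebesgue_rv R n).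
Proof.
have [m ->] := lebesgue_rv_sigma_finite_measure n.
exact: measure_semi_sigma_additive.
Qed.

HB.instance Definition _ n := isMeasure.Build _ _ _ (@lebesgue_rv R n)
  (@lebesgue_rv0 n) (@lebesgue_rv_ge0 n) (@lebesgue_rv_sigma_additive n).

Let lebesgue_rv_sigma_finite n : sigma_finite setT (@lebesgue_rv R n).
Proof.
by have [m ->] := lebesgue_rv_sigma_finite_measure n; exact: sigma_finiteT.
Qed.

HB.instance Definition _ n := Measure_isSigmaFinite.Build _ _ _
  (@lebesgue_rv R n) (@lebesgue_rv_sigma_finite n).

End lebesgue_rv_measure.

Section function_spaces.
Context {R : realType} {N : nat}.
Implicit Types (O K : set 'rV[R]_N) (phi u w g h : 'rV[R]_N -> R).

Local Notation leb := (@lebesgue_rv R N).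

Definition partial_deriv (i : 'I_N) phi : 'rV[R]_N -> R :=
  'D_(delta_mx ord0 i) phi.

Definition laplacian phi (x : 'rV[R]_N) : R :=
  \sum_(i < N) partial_deriv i (partial_deriv i phi) x.

Fixpoint of_class_C (k : nat) phi : Prop :=
  continuous phi /\
  match k with
  | 0 => True
  | k'.+1 => forall i : 'I_N,
      (forall x, derivable phi x (delta_mx ord0 i)) /\
      of_class_C k' (partial_deriv i phi)
  end.

Definition compactly_supported_in O phi : Prop :=
  compact (closure [set x | phi x != 0]) /\
  closure [set x | phi x != 0] `<=` O.

(* Elements of C^k_c(O) and C^oo_c(O), extended by 0 outside of O. *)
Definition Ck_c (k : nat) O phi : Prop :=
  of_class_C k phi /\ compactly_supported_in O phi.

Definition Coo_c O phi : Prop :=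
  (forall k, of_class_C k phi) /\ compactly_supported_in O phi.

Definition L1_loc O g : Prop :=
  measurable_fun O g /\
  forall K, compact K -> K `<=` O -> leb.-integrable K (EFin \o g).

Definition L2 O g : Prop :=
  measurable_fun O g /\ leb.-integrable O (fun x => (g x ^+ 2)%:E).

Definition weak_partial_deriv O (i : 'I_N) u g : Prop :=
  forall phi, Coo_c O phi ->
    (\int[leb]_(x in O) (u x * partial_deriv i phi x) =
     - (\int[leb]_(x in O) (g x * phi x)))%R.

(* u is in H^1(O), with weak gradient G. *)
Definition H1_grad O u (G : 'I_N -> 'rV[R]_N -> R) : Prop :=
  L2 O u /\ forall i, L2 O (G i) /\ weak_partial_deriv O i u (G i).

Definition H1 O u : Prop := exists G, H1_grad O u G.

Definition H1_loc O u : Prop :=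
  forall O', open O' -> compact (closure O') -> closure O' `<=` O -> H1 O' u.

(* H^1_0(O) is the closure of C^oo_c(O) in H^1(O). *)
Definition H1_0 O w : Prop :=
  exists2 G, H1_grad O w G &
    forall e : R, 0 < e -> exists2 phi, Coo_c O phi &
      ((\int[leb]_(x in O) ((w x - phi x) ^+ 2))
       + (\sum_(i < N)
           \int[leb]_(x in O) ((G i x - partial_deriv i phi x) ^+ 2)) < e)%R.

Definition bounded_domain O : Prop :=
  [/\ open O, connected O, O !=set0 & bounded_set O].

End function_spaces.

Section nonlinearity.
Context {R : realType}.

(* f is of class C^1 on [0, +oo[ with derivative f'; the difference quotients
   are restricted to [0, +oo[, so that f' 0 is the right derivative at 0. The
   values of f and f' on ]-oo, 0[ are irrelevant. *)
Definition C1_nonneg (f f' : R -> R) : Prop :=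
  (forall t, 0 <= t ->
     (f s - f t) / (s - t) @[s --> within `[0, +oo[ t^'] --> f' t) /\
  {within `[0, +oo[, continuous f'}.

End nonlinearity.

Section stable_solutions.
Context {R : realType} {N : nat}.
Implicit Types (O : set 'rV[R]_N) (u : 'rV[R]_N -> R).

Local Notation leb := (@lebesgue_rv R N).

(* g(u), for g only given on [0, +oo[. It is used for functions u that are
   nonnegative almost everywhere, hence almost everywhere equal to max 0 u. *)
Definition comp_nonneg (g : R -> R) u (x : 'rV[R]_N) : R :=
  g (Num.max 0 (u x)).

(* u is a nonnegative solution of - laplacian u = f(u) in D'(O). *)
Definition nonneg_solution O (f : R -> R) u : Prop :=
  [/\ H1_loc O u,
      {ae leb, forall x, O x -> 0 <= u x},
      L1_loc O (comp_nonneg f u) &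
      forall phi, Coo_c O phi ->
        (- (\int[leb]_(x in O) (u x * laplacian phi x)) =
         \int[leb]_(x in O) (comp_nonneg f u x * phi x))%R].

Definition stable_solution O (f f' : R -> R) u : Prop :=
  [/\ nonneg_solution O f u,
      L1_loc O (comp_nonneg f' u) &
      forall phi, Ck_c 1 O phi ->
        (\int[leb]_(x in O) (comp_nonneg f' u x * phi x ^+ 2) <=
         \int[leb]_(x in O) (\sum_(i < N) partial_deriv i phi x ^+ 2))%R].

End stable_solutions.

Section orthogonal_action.
Context {R : realType} {N : nat}.

Definition orthogonal_mx (rho : 'M[R]_N) : Prop := rho *m rho^T = 1%:M.

(* The point rho x; points of R^N are row vectors, so that rho acts on the right
   through its transpose. *)
Definition mx_act (rho : 'M[R]_N) (x : 'rV[R]_N) : 'rV[R]_N := x *m rho^T.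

End orthogonal_action.

(* Main.v *)
Require Import Defs.
From HB Require Import structures.
From mathcomp Require Import all_boot all_order all_algebra.
From mathcomp Require Import all_classical all_reals all_analysis.
From mathcomp Require Import measurable_realfun ring lra.

(** Write T for the isometry, v = u o T and w = u - v. The measure, the
    Laplacian, the domain and the boundary value c are invariant under T, so v
    is a stable solution of the same problem: w lies in H^1_0, its integral
    vanishes, and - laplacian w = f(u) - f(v). It therefore suffices to show
    that w does not change sign.

    Convexity gives f(u) - f(v) <= f'(u) w. Testing the equation with the
    positive part w^+ then gives Q(w^+) <= 0 for the quadratic form
    Q(phi) = int |grad phi|^2 - int f'(u) phi^2, which is nonnegative because u
    is stable. The textbook conclusion is that w^+ minimizes Q, hence solves the
    linearized equation, hence vanishes identically or is positive everywhere
    by a strong maximum principle. As f'(u) is merely locally integrable, the usual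
    forms of that principle do not apply, and the proof below argues with energies
    and test functions only.

    - [positive_part_energy] produces test functions q_k converging almost
      everywhere to w^+ with Q(q_k) <= b_k and b_k -> 0. The difficulty is that
      f'(u) (w^+)^2 has no reason to be integrable. Stability of both u and v
      bounds int (f'(u) + f'(v)) phi^2 by twice the Dirichlet energy of phi;
      along a sequence that approximates w fast in H^1 this gives integrability
      in the limit and the dominating function needed for testing with w^+.

    - [stable_log_gradient] bounds e^2 int |grad p|^2 / (p^2 + e^2), over a set
      where a cutoff eta equals 1, by Q(p) + e^2 Q(eta): it is what stability
      says for sqrt (p^2 + (e eta)^2 + d^2) - d in the limit d -> 0, because
      the Dirichlet energy of this function is smaller than the sum of those of
      p and e eta by the left-hand side. With p = q_k and e_k^2 slightly larger
      than b_k, the gradients of ln (q_k^2 + e_k^2) are bounded in L^1 on small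
      balls, uniformly in k.

    - [sign_dichotomy] concludes. The increments of ln (q_k^2 + e_k^2) under a
      small translation h are then bounded in L^1, but they tend to infinity at
      every x with w(x) <= 0 < w(x + h). The set of these x is thus null, for
      every h; averaging over h shows that w has a sign almost everywhere on
      small balls, and connectedness extends this to the domain.

    So w <= 0 almost everywhere or w > 0 almost everywhere, and w = 0 since its
    integral vanishes. *)

Set Implicit Arguments.
Unset Strict Implicit.
Unset Printing Implicit Defensive.

Import Order.TTheory GRing.Theory Num.Theory.
Import numFieldNormedType.Exports.

Local Open Scope classical_set_scope.
Local Open Scope ring_scope.

(** * Integration of real-valued functions *)

Lemma measurable_fun_limn_einf d (T : measurableType d) (R : realType)
    (D : set T) (f : (T -> \bar R)^nat) :
  (forall n, measurable_fun D (f n)) ->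
  measurable_fun D (fun x => limn_einf (f ^~ x)).
Proof.
move=> mf.
rewrite (_ : (fun x => _) = (fun x => - limn_esup (fun n => - f n x))%E); last first.
  apply/funext => x; rewrite -[LHS]oppeK -limn_esupN; congr (- limn_esup _)%E.
apply: measurableT_comp => //; apply: measurable_fun_limn_esup => n.
exact: measurableT_comp.
Qed.

Lemma limn_einf_ge0 (R : realType) (u : nat -> \bar R) :
  (forall n, (0 <= u n)%E) -> (0 <= limn_einf u)%E.
Proof.
move=> u0; rewrite limn_einf_lim; apply: lime_ge; first exact: is_cvg_einfs.
by apply: nearW => n; apply: le_ereal_inf_tmp => _ [k _ <-].
Qed.

Lemma limn_einf_le (R : realType) (u : nat -> \bar R) C :
  (forall n, (u n <= C)%E) -> (limn_einf u <= C)%E.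
Proof.
move=> uC; rewrite limn_einf_lim; apply: lime_le; first exact: is_cvg_einfs.
apply: nearW => n; apply: le_trans (uC n).
by apply: ereal_inf_lbound; exists n => /=.
Qed.

Section real_integrals.
Context d (T : measurableType d) (R : realType) (mu : {measure set T -> \bar R}).
Variables (D : set T) (mD : measurable D).
Implicit Types f g h : T -> R.

Lemma integrable_measurable_real f :
  mu.-integrable D (EFin \o f) -> measurable_fun D f.
Proof. by move=> /measurable_int/measurable_EFinP. Qed.

Lemma measurable_nonpositive f : measurable_fun D f ->
  measurable (D `&` [set x | f x <= 0]).
Proof.
move=> mf; rewrite (_ : [set x | f x <= 0] = f @^-1` `]-oo, 0]%classic).
  by apply: mf => //; exact: measurable_itv.
by apply/seteqP; split=> x /=; rewrite in_itv.
Qed.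

Lemma measurable_positive f : measurable_fun D f ->
  measurable (D `&` [set x | 0 < f x]).
Proof.
move=> mf; rewrite (_ : [set x | 0 < f x] = f @^-1` `]0, +oo[%classic).
  by apply: mf => //; exact: measurable_itv.
by apply/seteqP; split=> x /=; rewrite in_itv/= andbT.
Qed.

Lemma EFin_Rintegral f : mu.-integrable D (EFin \o f) ->
  (\int[mu]_(x in D) (f x)%:E)%E = (\int[mu]_(x in D) f x)%:E.
Proof. by move=> if_; rewrite fineK//; exact: integrable_fin_num. Qed.

Lemma integrable_dominated f g : measurable_fun D f ->
  mu.-integrable D (EFin \o g) -> {ae mu, forall x, D x -> `|f x| <= g x} ->
  mu.-integrable D (EFin \o f).
Proof.
move=> mf ig fg; apply/integrableP; split; first exact/measurable_EFinP.
have mg := integrable_measurable_real ig.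
have /integrableP[_] := ig; apply: le_lt_trans.
apply: ae_ge0_le_integral => //.
- by apply/measurable_EFinP; apply: measurableT_comp.
- by apply/measurable_EFinP; apply: measurableT_comp.
- apply: filterS fg => x fg Dx /=; rewrite lee_fin.
  by apply: (le_trans (fg Dx)); exact: ler_norm.
Qed.

Lemma integrable_realZ (a : R) f : mu.-integrable D (EFin \o f) ->
  mu.-integrable D (EFin \o (fun x => a * f x)).
Proof.
by move=> /(integrableZl mD a); apply: eq_integrable.
Qed.

Lemma integrable_realD f g : mu.-integrable D (EFin \o f) ->
  mu.-integrable D (EFin \o g) -> mu.-integrable D (EFin \o (fun x => f x + g x)).
Proof. by move=> if_ ig; have := integrableD mD if_ ig; apply: eq_integrable. Qed.

Lemma integrable_realB f g : mu.-integrable D (EFin \o f) ->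
  mu.-integrable D (EFin \o g) -> mu.-integrable D (EFin \o (fun x => f x - g x)).
Proof. by move=> if_ ig; have := integrableB mD if_ ig; apply: eq_integrable. Qed.

Lemma integrable_real_norm f : mu.-integrable D (EFin \o f) ->
  mu.-integrable D (EFin \o (fun x => `|f x|)).
Proof. exact: integrable_norm. Qed.

Lemma integrable_real0 : mu.-integrable D (EFin \o (fun=> 0 : R)).
Proof. exact: integrable0. Qed.

Lemma integrable_real_sum (I : Type) (s : seq I) (f : I -> T -> R) :
  (forall i, mu.-integrable D (EFin \o f i)) ->
  mu.-integrable D (EFin \o (fun x => \sum_(i <- s) f i x)).
Proof.
move=> hf; elim: s => [|i s IH].
  by under eq_fun do rewrite big_nil; exact: integrable_real0.
by under eq_fun do rewrite big_cons; exact: integrable_realD.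
Qed.

Lemma Rintegral_sum (I : Type) (s : seq I) (f : I -> T -> R) :
  (forall i, mu.-integrable D (EFin \o f i)) ->
  \int[mu]_(x in D) (\sum_(i <- s) f i x) = \sum_(i <- s) \int[mu]_(x in D) f i x.
Proof.
move=> hf; elim: s => [|i s IH].
  under eq_Rintegral do rewrite big_nil.
  by rewrite big_nil Rintegral_cst// mul0r.
under eq_Rintegral do rewrite big_cons.
by rewrite big_cons RintegralD ?IH//; exact: integrable_real_sum.
Qed.

Lemma integrable_sqrM f g : measurable_fun D f -> measurable_fun D g ->
  mu.-integrable D (EFin \o (fun x => f x ^+ 2)) ->
  mu.-integrable D (EFin \o (fun x => g x ^+ 2)) ->
  mu.-integrable D (EFin \o (fun x => f x * g x)).
Proof.
move=> mf mg if_ ig; apply: (integrable_dominated _ (integrable_realD if_ ig)).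
  exact: measurable_funM.
apply: aeW => x _; rewrite normrM -[f x ^+ 2]real_normK ?num_real//.
rewrite -[g x ^+ 2]real_normK ?num_real//.
have := normr_ge0 (f x); have := normr_ge0 (g x).
set a := `|f x|; set b := `|g x| => b0 a0; nra.
Qed.

Lemma integrable_sqrB f g : measurable_fun D f -> measurable_fun D g ->
  mu.-integrable D (EFin \o (fun x => f x ^+ 2)) ->
  mu.-integrable D (EFin \o (fun x => g x ^+ 2)) ->
  mu.-integrable D (EFin \o (fun x => (f x - g x) ^+ 2)).
Proof.
move=> mf mg if_ ig.
have ifg := integrable_sqrM mf mg if_ ig.
rewrite (_ : (fun x => _) = fun x => f x ^+ 2 + g x ^+ 2 - 2 * (f x * g x)); last first.
  by apply/funext => x; ring.
by apply: integrable_realB; [exact: integrable_realD|exact: integrable_realZ].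
Qed.

Lemma le_Rintegral_ae f g :
  mu.-integrable D (EFin \o f) -> mu.-integrable D (EFin \o g) ->
  {ae mu, forall x, D x -> f x <= g x} ->
  \int[mu]_(x in D) f x <= \int[mu]_(x in D) g x.
Proof.
move=> if_ ig fg.
have mf := integrable_measurable_real if_.
have mg := integrable_measurable_real ig.
have -> : \int[mu]_(x in D) f x = \int[mu]_(x in D) (Num.min (f x) (g x)).
  congr fine; apply: ae_eq_integral => //.
  - exact/measurable_EFinP.
  - by apply/measurable_EFinP; exact: measurable_minr.
  - by apply: filterS fg => x fg Dx /=; rewrite min_l// fg.
apply: le_Rintegral => //; last by move=> x _; rewrite ge_min lexx orbT.
apply: (@integrable_dominated _ (fun x => `|f x| + `|g x|)).
- exact: measurable_minr.
- rewrite (_ : _ \o _ = (EFin \o (Num.norm \o f)) \+ (EFin \o (Num.norm \o g)))%E//.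
  by apply: integrableD => //; exact: integrable_norm.
- apply: aeW => x _; rewrite /Num.min; case: ifP => _.
  + by rewrite lerDl.
  + by rewrite lerDr.
Qed.

Lemma eq_Rintegral_ae f g : measurable_fun D f -> measurable_fun D g ->
  {ae mu, forall x, D x -> f x = g x} ->
  \int[mu]_(x in D) f x = \int[mu]_(x in D) g x.
Proof.
move=> mf mg fg; congr fine; apply: ae_eq_integral => //.
- exact/measurable_EFinP.
- exact/measurable_EFinP.
- by apply: filterS fg => x fg Dx /=; rewrite fg.
Qed.

Lemma Rintegral_dominated_cvg (f_ : nat -> T -> R) f g :
  (forall n, measurable_fun D (f_ n)) -> measurable_fun D f ->
  mu.-integrable D (EFin \o g) ->
  {ae mu, forall x, D x -> f_ ^~ x @ \oo --> f x} ->
  {ae mu, forall x, D x -> forall n, `|f_ n x| <= g x} ->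
  (\int[mu]_(x in D) f_ n x) @[n --> \oo] --> \int[mu]_(x in D) f x.
Proof.
move=> mf_ mf ig ff fg.
have [||||i1 _ cv] := @dominated_convergence _ _ _ mu D mD
  (fun n => EFin \o f_ n) (EFin \o f) (EFin \o g) _ _ _ ig _.
- by move=> n; exact/measurable_EFinP.
- exact/measurable_EFinP.
- by apply: filterS ff => x h Dx; apply: cvg_EFin; [exact: nearW|exact: h].
- by apply: filterS fg => x h n Dx /=; rewrite lee_fin h.
by apply: fine_cvg; rewrite fineK; [exact: cv|exact: integrable_fin_num].
Qed.

Lemma fatou_bounded (F : nat -> T -> \bar R) C :
  (forall n, measurable_fun D (F n)) ->
  (forall n x, D x -> (0 <= F n x)%E) ->
  (forall n, (\int[mu]_(x in D) F n x <= C)%E) ->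
  (\int[mu]_(x in D) limn_einf (F ^~ x) <= C)%E.
Proof.
by move=> mF F0 FC; apply: le_trans (fatou _ _ _ _) (limn_einf_le FC).
Qed.

(** Fatou for real-valued functions: the limit is integrable although no
    dominating function is known. *)
Lemma Rintegral_bounded_cvg (f_ : nat -> T -> R) f (C : R) :
  (forall n, mu.-integrable D (EFin \o f_ n)) ->
  (forall n x, D x -> 0 <= f_ n x) -> measurable_fun D f ->
  {ae mu, forall x, D x -> f_ ^~ x @ \oo --> f x} ->
  (forall n, \int[mu]_(x in D) f_ n x <= C) ->
  mu.-integrable D (EFin \o f) /\ \int[mu]_(x in D) f x <= C.
Proof.
move=> if_ f0 mf ff fC.
have mf_ n : measurable_fun D (EFin \o f_ n).
  by exact/measurable_EFinP/integrable_measurable_real.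
have fE : (\int[mu]_(x in D) `|(f x)%:E| <= C%:E)%E.
  apply: (@le_trans _ _ (\int[mu]_(x in D) limn_einf (fun n => (f_ n x)%:E))%E).
    apply: ae_ge0_le_integral => //.
    - by apply/measurable_EFinP; exact: measurableT_comp.
    - by move=> x Dx; apply: limn_einf_ge0 => n; rewrite lee_fin f0.
    - exact: (measurable_fun_limn_einf mf_).
    - apply: filterS ff => x h Dx.
      have fx : (f_ n x)%:E @[n --> \oo] --> (f x)%:E.
        by apply: cvg_EFin; [exact: nearW|exact: h].
      rewrite (cvg_limn_einf_sup fx).1 abse_EFin lee_fin ger0_norm//.
      rewrite -(cvg_lim _ (h Dx))//; apply: limr_ge; first exact: cvgP (h Dx).
      by apply: nearW => n; exact: f0.
  apply: fatou_bounded => [//|n x Dx|n]; first by rewrite lee_fin f0.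
  by rewrite EFin_Rintegral// lee_fin.
have if' : mu.-integrable D (EFin \o f).
  apply/integrableP; split; first exact/measurable_EFinP.
  by apply: le_lt_trans fE _; rewrite ltry.
split=> //; rewrite -lee_fin -EFin_Rintegral//.
apply: le_trans fE; apply: le_integral => //.
  exact: integrable_abse.
by move=> x _ /=; rewrite lee_fin ler_norm.
Qed.

(** By Fatou, the integral of the constant +oo over E is finite, so E is null. *)
Lemma bounded_integral_cvgy (F : nat -> T -> \bar R) (E : set T) (C : R) :
  measurable E -> E `<=` D ->
  (forall n, measurable_fun D (F n)) ->
  (forall n x, D x -> (0 <= F n x)%E) ->
  (forall n, (\int[mu]_(x in D) F n x <= C%:E)%E) ->
  {ae mu, forall x, E x -> F ^~ x @ \oo --> +oo%E} -> mu E = 0%E.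
Proof.
move=> mE ED mF F0 FC Foo.
have : (\int[mu]_(x in E) (cst +oo x) <= C%:E)%E.
  apply: (@le_trans _ _ (\int[mu]_(x in E) limn_einf (F ^~ x))%E).
    apply: ae_ge0_le_integral => //.
    - by move=> x _; rewrite /= leey.
    - by move=> x /ED Dx; apply: limn_einf_ge0 => n; exact: F0.
    - by apply: (measurable_fun_limn_einf (f := F)) => n; exact: measurable_funS (mF n).
    - by apply: filterS Foo => x h Ex; rewrite (cvg_limn_einf_sup (h Ex)).1.
  apply: le_trans _ (fatou_bounded mF F0 FC).
  apply: ge0_subset_integral => //; first exact: (measurable_fun_limn_einf mF).
  by move=> x Dx; apply: limn_einf_ge0 => n; exact: F0.
rewrite integral_cst//; have [->//|E0] := eqVneq (mu E) 0%E.
by rewrite gt0_mulye ?mul1e ?leye_eq// lt_neqAle eq_sym E0 measure_ge0.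
Qed.

(** The integrals decay like 4^-n while the functions are only asked to decay
    like 2^-n, so that S, the sum of the 2^n h_n, is integrable. The same S serves
    for almost everywhere convergence and for domination. *)
Lemma geometric_domination (h_ : nat -> T -> R) (C : R) :
  (forall n, mu.-integrable D (EFin \o h_ n)) ->
  (forall n x, D x -> 0 <= h_ n x) ->
  (forall n, \int[mu]_(x in D) h_ n x <= C / 4 ^+ n) ->
  exists S : T -> R, mu.-integrable D (EFin \o S) /\
    {ae mu, forall x, D x -> 0 <= S x /\ forall n, h_ n x <= S x / 2 ^+ n}.
Proof.
move=> ih h0 hC.
have mh n : measurable_fun D (fun x => (2 ^+ n * h_ n x)%:E).
  apply/measurable_EFinP/measurable_funM => //.
  exact: integrable_measurable_real.
have p0 n x : D x -> (0 <= (2 ^+ n * h_ n x)%:E)%E.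
  by move=> Dx; rewrite lee_fin mulr_ge0 ?exprn_ge0 ?h0.
pose G x := (\sum_(0 <= n <oo) (2 ^+ n * h_ n x)%:E)%E.
have G0 x : D x -> (0 <= G x)%E by move=> Dx; apply: nneseries_ge0 => n _ _; exact: p0.
have mG : measurable_fun D G by apply: ge0_emeasurable_sum => [k x Dx _|k _]; [exact: p0|exact: mh].
have iG : mu.-integrable D G.
  apply/integrableP; split => //.
  rewrite (eq_integral G); last by move=> x /set_mem Dx; rewrite gee0_abs ?G0.
  rewrite integral_nneseries//.
  apply: (@le_lt_trans _ _ (2 * C)%:E); last exact: ltry.
  apply: lime_le.
    by apply: is_cvg_nneseries => n _ _; apply: integral_ge0 => x; exact: p0.
  apply: nearW => n.
  have C0 : 0 <= C.
    apply: le_trans (_ : C / 4 ^+ 0 <= _); last by rewrite expr0 divr1.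
    by apply: le_trans (hC 0%N); apply: Rintegral_ge0 => x; exact: h0.
  apply: (@le_trans _ _ (2 * C - 2 * C / 2 ^+ n)%:E); last first.
    by rewrite lee_fin gerBl divr_ge0 ?mulr_ge0 ?exprn_ge0.
  elim: n => [|n IHn]; first by rewrite big_nil expr0 divr1 subrr.
  rewrite big_nat_recr//=; apply: le_trans (leeD2r _ IHn) _.
  rewrite (_ : (fun x => (2 ^+ n * h_ n x)%:E) =
    (fun x => (2 ^+ n)%:E * (EFin \o h_ n) x)%E)//.
  rewrite integralZl//= (EFin_Rintegral (ih n)) -EFinM -EFinD lee_fin.
  have h4 : 2 ^+ n * \int[mu]_(x in D) h_ n x <= 2 ^+ n * (C / 4 ^+ n).
    by rewrite ler_pM2l ?exprn_gt0.
  apply: le_trans (lerD (lexx _) h4) _; rewrite exprS.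
  rewrite (_ : 4 = 2 * 2); last by lra.
  rewrite exprMn; set p := 2 ^+ n; have p_gt0 : 0 < p by rewrite exprn_gt0.
  rewrite le_eqVlt; apply/orP; left; apply/eqP; field; lra.
exists (fine \o G).
have Gfin := integrable_ae mD iG.
split.
  apply/integrableP; split.
    by apply/measurable_EFinP/measurableT_comp.
  have /integrableP[_] := iG; apply: le_lt_trans.
  apply: ae_ge0_le_integral => //.
  - by apply/measurable_EFinP; do 2 apply: measurableT_comp => //.
  - exact: measurableT_comp.
  - by apply: filterS Gfin => x /[apply] Gfin /=; rewrite -{2}(fineK Gfin).
apply: filterS Gfin => x h Dx /=; split; first by rewrite fine_ge0// G0.
move=> n; rewrite ler_pdivlMr ?exprn_gt0// -lee_fin fineK; last exact: h.
rewrite mulrC; apply: le_trans (nneseries_lim_ge n.+1 _); last first.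
  by move=> k _ _; exact: p0.
rewrite big_nat_recr//= leeDr//; apply: sume_ge0 => k _; exact: p0.
Qed.

Lemma finite_measure_integrable_sqr f : (mu D < +oo)%E -> measurable_fun D f ->
  mu.-integrable D (EFin \o (fun x => f x ^+ 2)) -> mu.-integrable D (EFin \o f).
Proof.
move=> Dfin mf if_.
have m1 : measurable_fun D (fun=> 1 : R) by exact: measurable_cst.
have i1 : mu.-integrable D (EFin \o (fun=> 1 ^+ 2 : R)).
  apply/integrableP; split; first exact: measurable_cst.
  by rewrite integral_cst//; apply: lte_mul_pinfty.
have := integrable_sqrM mf m1 if_ i1.
by rewrite (_ : (fun x => f x * 1) = f)//; apply/funext => x; rewrite mulr1.
Qed.

Lemma nonneg_zero_mean f : mu.-integrable D (EFin \o f) ->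
  {ae mu, forall x, D x -> 0 <= f x} -> \int[mu]_(x in D) f x = 0 ->
  {ae mu, forall x, D x -> f x = 0}.
Proof.
move=> if_ f0 I0; have mf := integrable_measurable_real if_.
have : ae_eq mu D (EFin \o f) (cst 0%E).
  apply/(ae_eq_integral_abs _ mD); first exact/measurable_EFinP.
  rewrite (_ : (fun x => `|_|)%E = EFin \o (fun x => `|f x|)); last by [].
  have E := EFin_Rintegral (integrable_real_norm if_).
  apply: etrans E _; congr EFin; rewrite -I0.
  apply: eq_Rintegral_ae => //; first exact: measurableT_comp.
  by apply: filterS f0 => x fx Dx; rewrite ger0_norm// fx.
by apply: filterS => x fx Dx; have [] := fx Dx.
Qed.

Lemma null_inter_ae (P : T -> Prop) : mu (D `&` [set x | P x]) = 0 ->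
  measurable (D `&` [set x | P x]) -> {ae mu, forall x, D x -> ~ P x}.
Proof.
move=> z mz; exists (D `&` [set x | P x]); split=> // x /= h.
by apply: contrapT => nh; apply: h => Dx Px; exact: nh.
Qed.

End real_integrals.

(** * Translations, balls and open sets *)

Section lebesgue_translation.
Context {R : realType}.

Lemma lebesgue_measure_translation (a : R) (A : set R) : measurable A ->
  lebesgue_measure ((fun x => x + a) @^-1` A) = lebesgue_measure A.
Proof.
move=> mA.
have mf : measurable_fun setT (fun x : measurableTypeR R => x + a : measurableTypeR R).
  exact: measurable_funD.
pose m := measure_function_pushforward__canonical__measure_function_Measure
  (@lebesgue_measure R) mf.
apply/esym/(@lebesgue_measure_unique _ m) => // _ [[b c] bc <-]/=.
rewrite /pushforward (_ : _ @^-1` _ = [set` `]b - a, c - a]]); last first.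
  by apply/seteqP; split => x /=; rewrite !in_itv/= ltrBlDr lerBrDr.
rewrite !lebesgue_measure_itv/= !lte_fin ltrD2r; case: ifP => // _.
by rewrite -!EFinB; congr EFin; ring.
Qed.

Lemma measurable_rv_addr n (h : 'rV[R]_n) :
  measurable_fun setT (fun x : 'rV[R]_n => x + h).
Proof.
apply: measurable_rvP => i.
rewrite (_ : _ \o _ = fun x => rv_coord i x + h ord0 i); last first.
  by apply/funext => x; rewrite /rv_coord /= mxE.
by apply: measurable_funD => //; exact: measurable_rv_coord.
Qed.

Lemma rv_consD n (p : measurableTypeR R * 'rV[R]_n) (h : 'rV[R]_n.+1) :
  rv_cons p + h =
  rv_cons (p.1 + (rv_uncons h).1 : measurableTypeR R, p.2 + (rv_uncons h).2).
Proof.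
apply/rowP => i; rewrite mxE; have [j ->|->] := unliftP ord0 i.
- by rewrite !rv_consS /= !mxE.
- by rewrite !rv_cons0.
Qed.

(** Induction on the dimension: the inner measure of a section is invariant by the
    induction hypothesis, and the outer integral by the case of the line. *)
Lemma lebesgue_rv_translation n (h : 'rV[R]_n) (A : set 'rV[R]_n) :
  measurable A -> lebesgue_rv ((fun x => x + h) @^-1` A) = lebesgue_rv A.
Proof.
elim: n h A => [h A mA /=|n IH h A mA].
  by rewrite (_ : _ @^-1` _ = A)//; apply/seteqP; split => x /=;
    rewrite (_ : x + h = x)//; apply/rowP => -[].
rewrite /= /pushforward.
have mB : measurable (@rv_cons R n @^-1` A).
  by rewrite -[X in measurable X]setTI; exact: measurable_rv_cons.
set B := @rv_cons R n @^-1` A in mB *.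
pose t (x : measurableTypeR R) : measurableTypeR R := x + (rv_uncons h).1.
have mt : measurable_fun setT t.
  exact: measurable_funD.
rewrite /product_measure1.
transitivity (\int[lebesgue_measure]_x
  ((@lebesgue_rv R n \o xsection B) \o t) x)%E.
  apply: eq_integral => x _ /=.
  rewrite -[RHS](IH (rv_uncons h).2); last exact: measurable_xsection.
  congr (lebesgue_rv _); apply/seteqP.
  by split => y; rewrite /xsection /B /= !inE /= rv_consD.
have mF : measurable_fun setT (@lebesgue_rv R n \o xsection B).
  exact: measurable_fun_xsection.
rewrite -(@ge0_integral_pushforward _ _ _ _ _ _ mt lebesgue_measure setT)//.
apply: eq_measure_integral => X mX _ /=.
exact: lebesgue_measure_translation.
Qed.

End lebesgue_translation.

Section lebesgue_balls.
Context {R : realType}.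

Lemma rv_ballP n (x y : 'rV[R]_n) (r : R) : 0 < r ->
  ball x r y <-> forall i, `|x ord0 i - y ord0 i| < r.
Proof.
move=> r0; split=> [[_ h] i|h]; first exact: (h ord0 i).
by split=> // i j; rewrite ord1; exact: h.
Qed.

Lemma measurable_rv_ball n (x : 'rV[R]_n) (r : R) : measurable (ball x r).
Proof.
have [r0|r0] := ltP 0 r; last first.
  by rewrite (_ : ball x r = set0)//; apply/seteqP; split=> y // -[]; rewrite ltNge r0.
rewrite (_ : ball x r = \big[setI/setT]_(i < n) (rv_coord i @^-1` ball (x ord0 i) r)).
  apply: bigsetI_measurable => i _; rewrite -[X in measurable X]setTI.
  by apply: measurable_rv_coord => //; exact: measurable_ball.
rewrite -bigcap_seq; apply/seteqP; split => [y /(rv_ballP _ _ r0) h i _|y h].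
  exact: h.
by apply/(rv_ballP _ _ r0) => i; apply: h; rewrite /= mem_index_enum.
Qed.

Lemma lebesgue_rv_ball n (x : 'rV[R]_n) (r : R) : 0 < r ->
  lebesgue_rv (ball x r) = ((r *+ 2) ^+ n)%:E.
Proof.
move=> r0; elim: n x => [x|n IH x].
  by rewrite /= diracE mem_set ?expr0//; apply/rv_ballP => // -[].
rewrite /= /pushforward.
rewrite (_ : _ @^-1` _ = ball (x ord0 ord0) r `*` ball (rv_uncons x).2 r).
  rewrite product_measure1E//=; last 2 first.
  - exact: measurable_ball.
  - exact: measurable_rv_ball.
  by rewrite IH lebesgue_measure_ball ?ltW// -EFinM exprS.
apply/seteqP; split=> [p /(rv_ballP _ _ r0) h|p [/= h1 /(rv_ballP _ _ r0) h2]].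
  split=> /=; first by have := h ord0; rewrite rv_cons0.
  by apply/(rv_ballP _ _ r0) => i; rewrite mxE; have := h (lift ord0 i); rewrite rv_consS.
apply/(rv_ballP _ _ r0) => i; have [j ->|->] := unliftP ord0 i.
- by have := h2 j; rewrite mxE rv_consS.
- by rewrite rv_cons0.
Qed.

Lemma lebesgue_rv_bounded n (A : set 'rV[R]_n) :
  measurable A -> bounded_set A -> (lebesgue_rv A < +oo)%E.
Proof.
move=> mA [M [_ AM]]; pose r := `|M| + 2.
have r0 : 0 < r by rewrite ltr_wpDl.
have AB : A `<=` ball 0 r.
  move=> x /(AM (`|M| + 1)) xM; rewrite mx_norm_ball /ball_/= sub0r normrN.
  apply: le_lt_trans (xM _) _; last by rewrite ltrD2l ltr1n.
  by apply: le_lt_trans (ler_norm M) _; rewrite ltrDl.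
apply: (@le_lt_trans _ _ (lebesgue_rv (ball 0 r : set 'rV[R]_n))).
  by apply: le_measure => //; rewrite inE//; exact: measurable_rv_ball.
by rewrite lebesgue_rv_ball// ltry.
Qed.

(** Balls with rational centres and radii 1 / (j + 1) form a countable family.
    The predicate P selects those that are used: contained in a given open set, or
    meeting a given set in a null set. *)
Lemma countable_ball_cover n (U : set 'rV[R]_n) (P : set 'rV[R]_n -> Prop) :
  P set0 -> (forall A B, A `<=` B -> P B -> P A) ->
  (forall x, U x -> exists2 r, 0 < r & P (ball x r)) ->
  exists B : nat -> set 'rV[R]_n,
    (forall k, measurable (B k) /\ P (B k)) /\ U `<=` \bigcup_k B k.
Proof.
move=> P0 PS UP.
pose C (qj : 'rV[rat]_n * nat) : set 'rV[R]_n :=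
  let b : set 'rV[R]_n := ball (map_mx ratr qj.1 : 'rV[R]_n) (qj.2.+1%:R^-1) in
  if `[< P b >] then b else set0.
have CP qj : measurable (C qj) /\ P (C qj).
  rewrite /C; case: asboolP => //; split=> //; exact: measurable_rv_ball.
exists (fun k => if unpickle k is Some qj then C qj else set0).
split=> [k|x /UP[r r0 Pr]]; first by case: unpickle.
have [j jr] : exists j : nat, j.+1%:R^-1 < r / 2.
  have [j _ hj] := near_infty_natSinv_lt (PosNum (divr_gt0 r0 (ltr0Sn R 1))).
  by exists j; apply: (hj j) => /=.
have qx i : exists q : rat, `|x ord0 i - ratr q| < j.+1%:R^-1.
  have [y [/= h [q _ qy]]] : (ball (x ord0 i) (j.+1%:R^-1) `&` range ratr) !=set0.
    apply: dense_rat; last exact: ball_open.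
    by exists (x ord0 i); apply: ballxx; rewrite invr_gt0.
  by exists q; rewrite qy.
have [q hq] := choice qx.
exists (pickle (\row_i q i, j)) => //=; rewrite pickleK /C /=.
have qb : ball (map_mx ratr (\row_i q i) : 'rV[R]_n) j.+1%:R^-1 x.
  by apply/rv_ballP; rewrite ?invr_gt0// => i; rewrite !mxE distrC.
case: asboolP => // -[]; apply: PS Pr => y qy.
rewrite (splitr r); apply: ball_triangle (_ : ball (map_mx ratr (\row_i q i) : 'rV[R]_n) (r / 2) y).
- by apply: le_ball (ball_sym qb); exact: ltW.
- by apply: le_ball qy; exact: ltW.
Qed.

Lemma measurable_rv_open n (U : set 'rV[R]_n) : open U -> measurable U.
Proof.
move=> oU; have [|||B [BP UB]] := @countable_ball_cover n U (fun B => B `<=` U).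
- exact: sub0set.
- by move=> A B; exact: subset_trans.
- move=> x Ux; have /nbhs_ballP[r r0 rU] : nbhs x U by exact: open_nbhs_nbhs.
  by exists r.
rewrite (_ : U = \bigcup_k B k); first by apply: bigcupT_measurable => k; case: (BP k).
by apply/seteqP; split=> // x [k _]; case: (BP k) => _; exact.
Qed.

Lemma measurable_rv_closed n (U : set 'rV[R]_n) : closed U -> measurable U.
Proof.
move=> cU; rewrite -(setCK U); apply: measurableC; apply: measurable_rv_open.
exact: closed_openC.
Qed.

Lemma lebesgue_rv_locally_null n (U : set 'rV[R]_n) : measurable U ->
  (forall x, U x -> exists2 r, 0 < r & lebesgue_rv (U `&` ball x r) = 0%E) ->
  lebesgue_rv U = 0%E.
Proof.
move=> mU Ur.
have [|||B [BP UB]] := @countable_ball_cover n U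
    (fun B => (@lebesgue_rv R n).-negligible (U `&` B)).
- by rewrite setI0; exact: negligible_set0.
- by move=> A B AB; apply: negligibleS; exact: setIS.
- move=> x /Ur[r r0 hr]; exists r => //; apply/negligibleP => //.
  by apply: measurableI => //; exact: measurable_rv_ball.
apply/negligibleP => //.
rewrite (_ : U = \bigcup_k (U `&` B k)); last first.
  by rewrite -setI_bigcupr; apply/esym/setIidPl.
by apply: negligible_bigcup => k; case: (BP k).
Qed.

Lemma continuous_measurable_rv n (f : 'rV[R]_n -> R) :
  continuous f -> measurable_fun setT f.
Proof.
move=> /continuousP cf; apply: (measurability _ (RGenOpens.measurableE R)).
move=> _ [_ [a [b ->] <-]]; rewrite setTI; apply: measurable_rv_open.
exact/cf/interval_open.
Qed.

End lebesgue_balls.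

(** * Orthogonal transformations preserve the measure *)

Lemma tonelli_set d1 d2 (T1 : measurableType d1) (T2 : measurableType d2)
    (R : realType) (m1 : {sigma_finite_measure set T1 -> \bar R})
    (m2 : {sigma_finite_measure set T2 -> \bar R}) (E : set (T1 * T2)) :
  measurable E ->
  (\int[m1]_x m2 (xsection E x) = \int[m2]_y m1 (ysection E y))%E.
Proof.
move=> mE; have := @indic_fubini_tonelli _ _ _ _ R m1 m2 E mE.
by rewrite indic_fubini_tonelli_FE// indic_fubini_tonelli_GE.
Qed.

Lemma cvg_finite_sum (T : Type) (F : set_system T) {FF : Filter F}
    (R : numFieldType) (V : normedModType R) (I : Type) (r : seq I)
    (f : I -> T -> V) (l : I -> V) :
  (forall i, f i @ F --> l i) ->
  \sum_(i <- r) f i x @[x --> F] --> \sum_(i <- r) l i.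
Proof.
move=> fl; elim: r => [|i r IH].
  by under eq_fun do rewrite big_nil; rewrite big_nil; exact: cvg_cst.
by under eq_fun do rewrite big_cons; rewrite big_cons; exact: cvgD.
Qed.

Lemma cvg_rv (T : Type) (F : set_system T) {FF : Filter F} (R : realType)
    n (f : T -> 'rV[R]_n) (l : 'rV[R]_n) :
  (forall i, f x ord0 i @[x --> F] --> l ord0 i) -> f @ F --> l.
Proof.
move=> fl; apply/cvg_ballP => e e0.
have : \forall x \near F, forall i, `|l ord0 i - f x ord0 i| < e.
  by apply: filter_forall => i; have /cvgrPdist_lt := fl i; apply.
by apply: filterS => x h; exact/rv_ballP.
Qed.

Section lebesgue_rotation.
Context {R : realType} (n : nat).
Variables (rho : 'M[R]_n) (rho_orth : orthogonal_mx rho).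
Local Notation leb := (@lebesgue_rv R n).

Lemma mx_actE x j : mx_act rho x ord0 j = \sum_i x ord0 i * rho j i.
Proof. by rewrite mxE; apply: eq_bigr => i _; rewrite mxE. Qed.

Lemma orthogonal_mx_tr : rho^T *m rho = 1%:M.
Proof. exact: mulmx1C. Qed.

Lemma mx_actK : cancel (mx_act rho) (mx_act rho^T).
Proof. by move=> x; rewrite /mx_act trmxK -mulmxA orthogonal_mx_tr mulmx1. Qed.

Lemma mx_actKV : cancel (mx_act rho^T) (mx_act rho).
Proof. by move=> x; rewrite /mx_act trmxK -mulmxA rho_orth mulmx1. Qed.

Lemma mx_actD x y : mx_act rho (x + y) = mx_act rho x + mx_act rho y.
Proof. exact: mulmxDl. Qed.

Lemma mx_actN x : mx_act rho (- x) = - mx_act rho x.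
Proof. exact: mulNmx. Qed.

Lemma mx_act_sumsq x :
  \sum_i mx_act rho x ord0 i ^+ 2 = \sum_i x ord0 i ^+ 2.
Proof.
have sq (y : 'rV[R]_n) : \sum_i y ord0 i ^+ 2 = (y *m y^T) ord0 ord0.
  by rewrite mxE; apply: eq_bigr => i _; rewrite mxE expr2.
by rewrite !sq /mx_act trmx_mul trmxK mulmxA -(mulmxA x) orthogonal_mx_tr mulmx1.
Qed.

Lemma continuous_sumsq : continuous (fun x : 'rV[R]_n => \sum_i x ord0 i ^+ 2).
Proof.
move=> x; apply: (@cvg_finite_sum _ (nbhs x)) => i.
under eq_fun do rewrite expr2.
by rewrite expr2; apply: cvgM; exact: coord_continuous.
Qed.

Lemma continuous_mx_act : continuous (mx_act rho).
Proof.
move=> x; apply: (@cvg_rv _ (nbhs x)) => j; rewrite mx_actE.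
under eq_fun do rewrite mx_actE.
apply: (@cvg_finite_sum _ (nbhs x)) => i; apply: cvgM; last exact: cvg_cst.
exact: coord_continuous.
Qed.

Lemma measurable_mx_act : measurable_fun setT (mx_act rho).
Proof.
apply: measurable_rvP => j.
rewrite (_ : _ \o _ = fun x => \sum_i rv_coord i x * rho j i); last first.
  by apply/funext => x; rewrite /rv_coord /= mx_actE.
apply: measurable_sum => i; apply: measurable_funM => //.
exact: measurable_rv_coord.
Qed.

(** No change of variables formula and no determinant is involved. For B the
    Euclidean unit ball, which the isometry T preserves, the measure of the set of
    (x, y) with x in A and x - T y in B is computed in two ways. Integrating in y
    first, the sections are translates of B, which gives |A| |B|; translating x by
    T y turns the set into x in B, x + T y in A, whose measure is |B| |T^-1 A|. *)
Lemma lebesgue_rv_rotation (A : set 'rV[R]_n) : measurable A ->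
  leb (mx_act rho @^-1` A) = leb A.
Proof.
move=> mA.
pose B : set 'rV[R]_n := [set x | \sum_i x ord0 i ^+ 2 < 1].
have mB : measurable B.
  rewrite (_ : B = (fun x : 'rV[R]_n => \sum_i x ord0 i ^+ 2) @^-1` `]-oo, 1[%classic).
    rewrite -[X in measurable X]setTI.
    by apply: continuous_measurable_rv => //; exact: continuous_sumsq.
  by apply/seteqP; split=> x /=; rewrite in_itv.
have Brho x : B (mx_act rho x) = B x by rewrite /B /= mx_act_sumsq.
have BN x : B (- x) = B x.
  rewrite /B /=; congr is_true; congr (_ < _).
  by apply: eq_bigr => i _; rewrite mxE sqrrN.
(* Both bounds on the measure of B come from sup-norm balls. *)
have B_lty : (leb B < +oo)%E.
  have B2 : B `<=` ball (0 : 'rV[R]_n) 1.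
    move=> x Bx; apply/rv_ballP => // i; rewrite mxE sub0r normrN.
    rewrite -(@expr_lt1 _ 2)// -normrX ger0_norm ?sqr_ge0//.
    apply: le_lt_trans Bx; rewrite (bigD1 i)//= lerDl.
    by apply: sumr_ge0 => j _; exact: sqr_ge0.
  apply: (@le_lt_trans _ _ (leb (ball (0 : 'rV[R]_n) 1))).
    by apply: le_measure; rewrite ?inE//; exact: measurable_rv_ball.
  by rewrite lebesgue_rv_ball// ltry.
have B_gt0 : (0 < leb B)%E.
  (* n terms, each at most 1 / (n + 1), add up to less than 1. *)
  have r0 : 0 < (n.+1%:R : R)^-1 by rewrite invr_gt0.
  apply: (@lt_le_trans _ _ (leb (ball (0 : 'rV[R]_n) n.+1%:R^-1))).
    by rewrite lebesgue_rv_ball// lte_fin exprn_gt0// mulrn_wgt0.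
  apply: le_measure; rewrite ?inE//; first exact: measurable_rv_ball.
  move=> x /(rv_ballP _ _ r0) h.
  apply: (@le_lt_trans _ _ (\sum_(i < n) n.+1%:R^-1)).
    apply: ler_sum => i _; have := h i; rewrite mxE sub0r normrN => hi.
    rewrite -real_normK ?num_real// expr2.
    apply: le_trans (_ : 1 * n.+1%:R^-1 <= _); last by rewrite mul1r.
    apply: ler_pM => //; last exact: ltW.
    by apply: le_trans (ltW hi) _; rewrite invf_le1// ler1n.
  by rewrite sumr_const card_ord -[X in X < _]mulr_natl ltr_pdivrMr// mul1r ltr_nat.
have msub : measurable_fun setT (fun p : 'rV[R]_n * 'rV[R]_n => p.1 - mx_act rho p.2).
  apply: measurable_rvP => i; rewrite (_ : _ \o _ = fun p =>
      (rv_coord i \o fst) p - (rv_coord i \o mx_act rho \o snd) p); last first.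
    by apply/funext => p; rewrite /rv_coord /= !mxE.
  apply: measurable_funB; apply: measurableT_comp => //.
    exact: measurable_rv_coord.
  apply: measurableT_comp => //; first exact: measurable_rv_coord.
  exact: measurable_mx_act.
have madd : measurable_fun setT (fun p : 'rV[R]_n * 'rV[R]_n => p.1 + mx_act rho p.2).
  apply: measurable_rvP => i; rewrite (_ : _ \o _ = fun p =>
      (rv_coord i \o fst) p + (rv_coord i \o mx_act rho \o snd) p); last first.
    by apply/funext => p; rewrite /rv_coord /= !mxE.
  apply: measurable_funD; apply: measurableT_comp => //.
    exact: measurable_rv_coord.
  apply: measurableT_comp => //; first exact: measurable_rv_coord.
  exact: measurable_mx_act.
pose E := [set p : 'rV[R]_n * 'rV[R]_n | A p.1 /\ B (p.1 - mx_act rho p.2)].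
pose E' := [set p : 'rV[R]_n * 'rV[R]_n | B p.1 /\ A (p.1 + mx_act rho p.2)].
have mE : measurable E.
  rewrite (_ : E = (fst @^-1` A) `&` ((fun p => p.1 - mx_act rho p.2) @^-1` B))//.
  apply: measurableI; rewrite -[X in measurable X]setTI; last exact: msub.
  exact: measurable_fst.
have mE' : measurable E'.
  rewrite (_ : E' = (fst @^-1` B) `&` ((fun p => p.1 + mx_act rho p.2) @^-1` A))//.
  apply: measurableI; rewrite -[X in measurable X]setTI; last exact: madd.
  exact: measurable_fst.
have mrA : measurable (mx_act rho @^-1` A).
  by rewrite -[X in measurable X]setTI; exact: measurable_mx_act.
have EA : (\int[leb]_x leb (xsection E x) = leb A * leb B)%E.
  rewrite (eq_integral (fun x => (\1_A x)%:E * leb B)%E); last first.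
    move=> x _; rewrite indicE; have [/set_mem Ax|/negP Ax] := boolP (x \in A).
      rewrite mul1e -(lebesgue_rv_translation (- mx_act rho^T x) mB).
      have BE y : B (x - mx_act rho y) = B (y - mx_act rho^T x).
        by rewrite -[RHS]Brho mx_actD mx_actN mx_actKV -[RHS]BN opprB.
      congr lebesgue_rv; apply/seteqP; split=> y; rewrite /xsection/= !inE/=.
        by rewrite /E /= BE => -[].
      by rewrite /E /= BE.
    rewrite mul0e (_ : xsection _ _ = set0) ?measure0//; apply/seteqP.
    by split=> y //; rewrite /xsection/= inE/= => -[Ax']; case: Ax; rewrite inE.
  rewrite ge0_integralZr//; last first.
    by apply/measurable_EFinP; exact: measurable_indic.
  by rewrite integral_indic// setIT.
have EB : (\int[leb]_x leb (xsection E' x) = leb B * leb (mx_act rho @^-1` A))%E.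
  rewrite (eq_integral (fun x => (\1_B x)%:E * leb (mx_act rho @^-1` A))%E); last first.
    move=> x _; rewrite indicE; have [/set_mem Bx|/negP Bx] := boolP (x \in B).
      rewrite mul1e -(lebesgue_rv_translation (mx_act rho^T x) mrA).
      congr lebesgue_rv; apply/seteqP; split=> y; rewrite /xsection/= !inE/=.
        by case=> _ /=; rewrite mx_actD mx_actKV addrC.
      by rewrite mx_actD mx_actKV addrC => ?; split.
    rewrite mul0e (_ : xsection _ _ = set0) ?measure0//; apply/seteqP.
    by split=> y //; rewrite /xsection/= inE/= => -[Bx']; case: Bx; rewrite inE.
  rewrite ge0_integralZr//; last first.
    by apply/measurable_EFinP; exact: measurable_indic.
  by rewrite integral_indic// setIT.
have : (leb A * leb B = leb (mx_act rho @^-1` A) * leb B)%E.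
  rewrite -EA [RHS]muleC -EB !tonelli_set//.
  apply: eq_integral => y _ /=.
  rewrite -(lebesgue_rv_translation (mx_act rho y) (measurable_ysection _ mE))//.
  congr lebesgue_rv; apply/seteqP.
  split=> x; rewrite /ysection/= !inE/=.
    by case=> /= Axy; rewrite addrK.
  by case=> /= Bx Axy; split; rewrite //= addrK.
have Bfin : leb B \is a fin_num by rewrite ge0_fin_numE.
have /fineK := Bfin => <-; move: B_gt0; rewrite -(fineK Bfin) lte_fin => b0.
move/(congr1 (fun z => z * (fine (leb B))^-1%:E)%E).
by rewrite -!muleA -EFinM divff ?gt_eqF// !mule1.
Qed.

End lebesgue_rotation.

(** * Change of variables for measure-preserving maps *)

Section measure_preserving.
Context d (T : measurableType d) (R : realType) (mu : {measure set T -> \bar R}).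
Variables (phi : T -> T) (mphi : measurable_fun setT phi).
Hypothesis phi_mu : forall A, measurable A -> mu (phi @^-1` A) = mu A.

Lemma ae_preserving (P : T -> Prop) :
  {ae mu, forall x, P x} -> {ae mu, forall x, P (phi x)}.
Proof.
move=> [A [mA A0 PA]]; exists (phi @^-1` A); split.
- by rewrite -[X in measurable X]setTI; exact: mphi.
- by rewrite phi_mu.
- by move=> x /=; apply: PA.
Qed.

Variables (D : set T) (mD : measurable D).

Lemma measurable_fun_preserving d' (T' : measurableType d') (f : T -> T') :
  measurable_fun D f -> measurable_fun (phi @^-1` D) (f \o phi).
Proof.
move=> mf; apply: (measurable_comp mD) => //; last exact: measurable_funTS.
exact: image_preimage_subset.
Qed.

Lemma integral_preserving (f : T -> \bar R) : measurable_fun D f ->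
  (\int[mu]_(x in phi @^-1` D) f (phi x) = \int[mu]_(x in D) f x)%E.
Proof.
have ge0 (g : T -> \bar R) : measurable_fun D g -> (forall x, (0 <= g x)%E) ->
    (\int[mu]_(x in phi @^-1` D) g (phi x) = \int[mu]_(x in D) g x)%E.
  move=> mg g0; rewrite -(ge0_integral_pushforward mphi mu mD mg)//.
  by apply: eq_measure_integral => A mA _; exact: phi_mu.
move=> mf; rewrite integralE [RHS]integralE; congr (_ - _)%E.
- rewrite -(ge0 f^\+%E) => [||x]; [|exact: measurable_funepos|exact: funepos_ge0].
  by apply: eq_integral => x _; rewrite !funeposE.
- rewrite -(ge0 f^\-%E) => [||x]; [|exact: measurable_funeneg|exact: funeneg_ge0].
  by apply: eq_integral => x _; rewrite !funenegE.
Qed.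

Lemma Rintegral_preserving (f : T -> R) : measurable_fun D f ->
  \int[mu]_(x in phi @^-1` D) f (phi x) = \int[mu]_(x in D) f x.
Proof.
by move=> mf; congr fine; apply: (integral_preserving (f := EFin \o f));
  exact/measurable_EFinP.
Qed.

Lemma integrable_preserving (f : T -> R) : mu.-integrable D (EFin \o f) ->
  mu.-integrable (phi @^-1` D) (EFin \o (f \o phi)).
Proof.
move=> if_; have mf := integrable_measurable_real if_.
apply/integrableP; split.
  exact/measurable_EFinP/measurable_fun_preserving.
have /integrableP[_] := if_; rewrite -integral_preserving//.
by apply/measurable_EFinP; exact: measurableT_comp.
Qed.

End measure_preserving.

(** * Derivatives along lines *)

Section derivatives_along_lines.
Context {R : realType} {V : normedModType R}.
Implicit Types (f g : V -> R) (x v : V).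

(** Reduces directional derivatives to derivatives of functions of one real
    variable, where the chain rule and the mean value theorem are available. *)
Lemma is_derive_lineP f (a v : V) (s : R) (df : R) :
  is_derive s 1 (fun t : R => f (t *: v + a)) df <->
  is_derive (s *: v + a) v f df.
Proof.
have E : (fun h : R => h^-1 *:
      (((fun t => f (t *: v + a)) \o shift s) (h *: 1) - f (s *: v + a))) =
    (fun h : R => h^-1 *:
      ((f \o shift (s *: v + a)) (h *: v) - f (s *: v + a))).
  by apply/funext => h /=; rewrite addrA -scalerDl [h *: 1]mulr1.
by split=> -[]; rewrite /derivable /derive ?E => d1 d2; apply: DeriveDef;
  rewrite /derivable /derive ?E.
Qed.

Lemma is_derive_chain (F : R -> R) f x v (dF df : R) :
  is_derive (f x) 1 F dF -> is_derive x v f df ->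
  is_derive x v (F \o f) (dF * df).
Proof.
move=> hF hf; have x0 : (0 : R) *: v + x = x by rewrite scale0r add0r.
rewrite -x0; apply/is_derive_lineP.
apply: (@is_derive1_comp R F (fun t => f (t *: v + x))).
  by rewrite x0.
by apply/is_derive_lineP; rewrite x0.
Qed.

Lemma cvg_is_derive f x v (df : R) :
  h^-1 * (f (h *: v + x) - f x) @[h --> 0^'] --> df -> is_derive x v f df.
Proof.
by move=> h; apply: DeriveDef; [apply/cvg_ex; exists df|exact: cvg_lim h].
Qed.

Lemma is_derive_cvg f x v (df : R) : is_derive x v f df ->
  h^-1 * (f (h *: v + x) - f x) @[h --> 0^'] --> df.
Proof. by case=> h <-. Qed.

Lemma derivable_line_continuous (g : R -> R) :
  (forall t : R, derivable g t (1 : R)) -> continuous g.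
Proof. by move=> dg t; apply: differentiable_continuous; exact/derivable1_diffP. Qed.

(** The increment b may be negative, as the directions h a in [derive_C1_seq]. *)
Lemma mean_value (g dg : R -> R) (b : R) : (forall t : R, is_derive t (1 : R) g (dg t)) ->
  exists2 c, `|c| <= `|b| & g b - g 0 = dg c * b.
Proof.
move=> h; have cg : continuous g by apply: derivable_line_continuous => t; case: (h t).
have [b0|b0] := leP 0 b.
  have [|c] := @MVT_segment _ g dg 0 b b0 (fun t _ => h t).
    exact/continuous_subspaceT.
  rewrite in_itv/= subr0 => /andP[c0 cb] ->; exists c => //.
  by rewrite !ger0_norm.
have [|c] := @MVT_segment _ g dg b 0 (ltW b0) (fun t _ => h t).
  exact/continuous_subspaceT.
rewrite in_itv/= sub0r => /andP[c0 cb] E; exists c.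
  by rewrite !ler0_norm ?lerN2// ltW.
by rewrite -opprB E mulrN opprK.
Qed.

End derivatives_along_lines.

Section continuously_differentiable.
Context {R : realType} {n : nat}.
Local Notation E i := (delta_mx ord0 i : 'rV[R]_n).
Implicit Types (f g : 'rV[R]_n -> R).

Lemma row_sum_seq (v : 'rV[R]_n) : v = \sum_(i <- enum 'I_n) v ord0 i *: E i.
Proof. by rewrite [LHS]row_sum_delta big_enum. Qed.

(** The class C^k is defined by partial derivatives only. The increment along v is
    split coordinate by coordinate; the mean value theorem expresses the part along
    a coordinate through a value of that partial derivative at a nearby point. *)
Lemma derive_C1_seq f (s : seq 'I_n) (v : 'rV[R]_n) x :
  (forall i, (forall x, derivable f x (E i)) /\ continuous (partial_deriv i f)) ->
  is_derive x (\sum_(i <- s) v ord0 i *: E i) f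
    (\sum_(i <- s) v ord0 i * partial_deriv i f x).
Proof.
move=> hf; elim: s x => [|j s IH] x; first by rewrite !big_nil; exact: is_derive0.
rewrite !big_cons; set w := \sum_(i <- s) _; set a := v ord0 j.
apply: cvg_is_derive.
have -> : (fun h => h^-1 * (f (h *: (a *: E j + w) + x) - f x)) =
   (fun h => h^-1 * (f (h *: (a *: E j + w) + x) - f (h *: w + x)) +
             h^-1 * (f (h *: w + x) - f x)).
  by apply/funext => h; rewrite -mulrDr subrKA.
apply: cvgD; last exact: is_derive_cvg (IH x).
have mv (h : R) : exists2 c, `|c| <= `|h * a| &
    f (h *: (a *: E j + w) + x) - f (h *: w + x) =
    partial_deriv j f (c *: E j + (h *: w + x)) * (h * a).
  have [t|c ch hc] := @mean_value R (fun t => f (t *: E j + (h *: w + x)))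
      (fun t => partial_deriv j f (t *: E j + (h *: w + x))) (h * a).
    by apply/is_derive_lineP/derivableP; exact: (hf j).1.
  exists c => //; rewrite -hc scale0r add0r; congr (f _ - _).
  by rewrite scalerDr scalerA addrA.
have [c cP] := choice (fun h => let: ex_intro2 c p q := mv h in ex_intro _ c (conj p q)).
apply: (@cvg_trans _ ((fun h => a * partial_deriv j f (c h *: E j + (h *: w + x))) @ 0^')).
  apply: near_eq_cvg; near=> h; have [_ ->] := cP h.
  rewrite [_ * (h * a)]mulrC !mulrA mulVf ?mul1r//.
  by near: h; exact: nbhs_dnbhs_neq.
apply: cvgMr.
have h0 : (h : R) @[h --> 0^'] --> (0 : R) by exact: nbhs_dnbhs.
have ha0 : h * a @[h --> (0 : R)^'] --> 0 by rewrite -[X in _ --> X](mul0r a); exact: cvgMl.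
have c0 : c h @[h --> (0 : R)^'] --> 0.
  apply/cvgr0Pnorm_le => e e0; have /cvgr0Pnorm_le/(_ e e0) := ha0.
  by apply: filterS => h; exact: le_trans (cP h).1.
suff hx : c h *: E j + (h *: w + x) @[h --> 0^'] --> x.
  exact: cvg_comp hx ((hf j).2 x).
have -> : x = 0 *: E j + (0 *: w + x) by rewrite !scale0r !add0r.
apply: cvgD; first exact: cvgZl.
by apply: cvgD; [exact: cvgZl|rewrite !scale0r !add0r; exact: cvg_cst].
Unshelve. all: by end_near. Qed.

Lemma derive_C1 f (v : 'rV[R]_n) x : of_class_C 1 f ->
  is_derive x v f (\sum_i v ord0 i * partial_deriv i f x).
Proof.
move=> [_ hf]; rewrite {1}(row_sum_seq v) -big_enum/=.
by apply: derive_C1_seq => i; split; [exact: (hf i).1|exact: (hf i).2.1].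
Qed.

End continuously_differentiable.

(** * The algebra of functions of class C^k *)

Section class_C_algebra.
Context {R : realType} {n : nat}.
Local Notation E i := (delta_mx ord0 i : 'rV[R]_n).
Implicit Types (f g : 'rV[R]_n -> R) (k : nat).

Lemma of_class_C_continuous k f : of_class_C k f -> continuous f.
Proof. by case: k => [|k] []. Qed.

Lemma of_class_C_pred k f : of_class_C k.+1 f -> of_class_C k f.
Proof.
elim: k f => [|k IH] f [cf hf]; first by split.
by split=> // i; have [df Cf] := hf i; split=> //; exact: IH.
Qed.

Lemma of_class_C_le k l f : (k <= l)%N -> of_class_C l f -> of_class_C k f.
Proof.
move=> /subnK <-; elim: (l - k)%N => // m IH; rewrite addSn => /of_class_C_pred.
exact: IH.
Qed.

Lemma of_class_C_is_derive k f x i : of_class_C k.+1 f ->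
  is_derive x (E i) f (partial_deriv i f x).
Proof. by case=> _ /(_ i)[df _]; exact/derivableP. Qed.

Lemma partial_deriv_val f (g : 'I_n -> 'rV[R]_n -> R) i :
  (forall x, is_derive x (E i) f (g i x)) -> partial_deriv i f = g i.
Proof. by move=> h; apply/funext => x; exact: derive_val. Qed.

(** Stated on is_derive so that one proof gives both differentiability and the
    value of the derivative. *)
Definition has_partial i f g := forall x, is_derive x (E i) f (g x).

(** The way to climb from C^k to C^(k+1): exhibit the partial derivatives. *)
Lemma of_class_CS k f (g : 'I_n -> 'rV[R]_n -> R) : continuous f ->
  (forall i, has_partial i f (g i)) -> (forall i, of_class_C k (g i)) ->
  of_class_C k.+1 f.
Proof.
move=> cf fg gC; split=> // i; rewrite (partial_deriv_val (fg i)); split=> // x.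
by case: (fg i x).
Qed.

Lemma of_class_C_cst k (a : R) : of_class_C k (fun _ : 'rV[R]_n => a).
Proof.
elim: k a => [a|k IH a]; first by split=> //; exact: cst_continuous.
apply: (@of_class_CS _ _ (fun _ _ => 0)) => [|i x|i]; last exact: (IH 0).
  exact: cst_continuous.
exact: is_derive_cst.
Qed.

Lemma of_class_C_coord k j : of_class_C k (fun x : 'rV[R]_n => x ord0 j).
Proof.
case: k => [|k]; first by split=> //; exact: coord_continuous.
apply: (@of_class_CS _ _ (fun i _ => (i == j)%:R)) => [|i x|i].
- exact: coord_continuous.
- apply: cvg_is_derive.
  apply: (@cvg_trans _ ((fun=> (i == j)%:R) @ (0:R)^')); last exact: cvg_cst.
  apply: near_eq_cvg; near=> h.
  rewrite !mxE eqxx /= addrK eq_sym mulrA mulVf ?mul1r//.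
  by near: h; exact: nbhs_dnbhs_neq.
- exact: of_class_C_cst.
Unshelve. all: by end_near. Qed.

Lemma of_class_CD k f g : of_class_C k f -> of_class_C k g ->
  of_class_C k (fun x => f x + g x).
Proof.
elim: k f g => [|k IH] f g fC gC.
  by split=> // x; exact (cvgD (fC.1 x) (gC.1 x)).
apply: (@of_class_CS _ _ (fun i x => partial_deriv i f x + partial_deriv i g x)) => [x|i x|i].
- exact (cvgD (fC.1 x) (gC.1 x)).
- exact (@is_deriveD _ _ _ f g x _ _ _ (of_class_C_is_derive x i fC)
    (of_class_C_is_derive x i gC)).
- by apply: IH; [exact: (fC.2 i).2|exact: (gC.2 i).2].
Qed.

Lemma of_class_CM k f g : of_class_C k f -> of_class_C k g ->
  of_class_C k (fun x => f x * g x).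
Proof.
elim: k f g => [|k IH] f g fC gC.
  by split=> // x; exact (cvgM (fC.1 x) (gC.1 x)).
apply: (@of_class_CS _ _
    (fun i x => f x * partial_deriv i g x + g x * partial_deriv i f x)) => [x|i x|i].
- exact (cvgM (fC.1 x) (gC.1 x)).
- exact (@is_deriveM _ _ f g x _ _ _ (of_class_C_is_derive x i fC)
    (of_class_C_is_derive x i gC)).
- apply: of_class_CD; apply: IH; [exact: of_class_C_pred|exact: (gC.2 i).2|
    exact: of_class_C_pred|exact: (fC.2 i).2].
Qed.

Lemma of_class_CZ k f (a : R) : of_class_C k f -> of_class_C k (fun x => a * f x).
Proof. by apply: of_class_CM; exact: of_class_C_cst. Qed.

Lemma of_class_CB k f g : of_class_C k f -> of_class_C k g ->
  of_class_C k (fun x => f x - g x).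
Proof.
move=> fC gC; rewrite (_ : (fun x => _) = fun x => f x + (-1) * g x).
  by apply: of_class_CD => //; exact: of_class_CZ.
by apply/funext => x; rewrite mulN1r.
Qed.

Lemma of_class_C_sum k (I : Type) (s : seq I) (f : I -> 'rV[R]_n -> R) :
  (forall i, of_class_C k (f i)) -> of_class_C k (fun x => \sum_(i <- s) f i x).
Proof.
move=> fC; elim: s => [|i s IH].
  by under eq_fun do rewrite big_nil; exact: of_class_C_cst.
by under eq_fun do rewrite big_cons; exact: of_class_CD.
Qed.

Lemma is_derive_invsqrt (t : R) : 0 < t ->
  is_derive t 1 (fun t => (Num.sqrt t)^-1) (- 2^-1 * (Num.sqrt t)^-1 ^+ 3).
Proof.
move=> t0; have s0 : 0 < Num.sqrt t by rewrite sqrtr_gt0.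
have := @is_derive1_comp R (fun s => s^-1) Num.sqrt t _ _ _ (is_derive1_sqrt t0).
move=> /(_ (- (Num.sqrt t) ^- 2)) H.
apply: is_derive_eq; first apply: H.
  apply: is_derive_eq.
    by apply: DeriveDef; [apply: derivableV; rewrite ?gt_eqF|].
  by rewrite deriveV ?gt_eqF// derive_id [_ *: 1]mulr1.
by field; rewrite gt_eqF.
Qed.

(** The class is closed under f |-> 1 / sqrt f because the derivative of this
    function is a polynomial in itself and in the first derivatives of f. *)
Lemma of_class_C_invsqrt k f : (forall x, 0 < f x) -> of_class_C k f ->
  of_class_C k (fun x => (Num.sqrt (f x))^-1).
Proof.
move=> f0; have cont : continuous f -> continuous (fun x => (Num.sqrt (f x))^-1).
  move=> cf x; have s0 : Num.sqrt (f x) != 0 by rewrite gt_eqF// sqrtr_gt0.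
  have h : Num.sqrt (f y) @[y --> x] --> Num.sqrt (f x).
    exact: cvg_comp (cf x) (@sqrt_continuous R (f x)).
  exact (cvgV s0 h).
elim: k => [|k IH] fC; first by split=> //; apply: cont; case: fC.
apply: (@of_class_CS _ _ (fun i x => - 2^-1 * (Num.sqrt (f x))^-1 ^+ 3 *
    partial_deriv i f x)) => [|i x|i].
- by apply: cont; case: fC.
- exact (is_derive_chain (is_derive_invsqrt (f0 x)) (of_class_C_is_derive x i fC)).
- apply: of_class_CM; last exact: (fC.2 i).2.
  apply: of_class_CZ; have rC := IH (of_class_C_pred fC).
  by under eq_fun do rewrite !exprS expr0 mulr1; do 2 apply: of_class_CM => //.
Qed.

Lemma of_class_C_sqrt k f : (forall x, 0 < f x) -> of_class_C k f ->
  of_class_C k (fun x => Num.sqrt (f x)).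
Proof.
move=> f0 fC; rewrite (_ : (fun x => _) = fun x => f x * (Num.sqrt (f x))^-1).
  by apply: of_class_CM => //; exact: of_class_C_invsqrt.
apply/funext => x; rewrite -{2}(sqr_sqrtr (ltW (f0 x))) expr2 mulfK//.
by rewrite gt_eqF// sqrtr_gt0.
Qed.

Lemma is_derive_mx_act (rho : 'M[R]_n) f i x : of_class_C 1 f ->
  is_derive x (E i) (f \o mx_act rho)
    (\sum_j rho j i * partial_deriv j f (mx_act rho x)).
Proof.
move=> fC; rewrite -(add0r x) -(scale0r (E i)); apply/is_derive_lineP.
rewrite (_ : (fun t => _) =
    (fun t : R => f (t *: mx_act rho (E i) + mx_act rho x))); last first.
  by apply/funext => t /=; rewrite mx_actD /mx_act scalemxAl.
apply/is_derive_lineP; rewrite !scale0r !add0r.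
apply: is_derive_eq; first exact: (derive_C1 (mx_act rho (E i))).
apply: eq_bigr => j _; congr (_ * _); rewrite mx_actE (bigD1 i)//=.
rewrite mxE !eqxx mul1r big1 ?addr0// => l li.
by rewrite mxE eqxx /= (negbTE li) mul0r.
Qed.

Lemma partial_deriv_mx_act (rho : 'M[R]_n) f i : of_class_C 1 f ->
  partial_deriv i (f \o mx_act rho) =
  fun x => \sum_j rho j i * partial_deriv j f (mx_act rho x).
Proof.
by move=> fC; apply/funext => x; apply: derive_val; exact: is_derive_mx_act.
Qed.

Lemma of_class_C_mx_act k (rho : 'M[R]_n) f :
  of_class_C k f -> of_class_C k (f \o mx_act rho).
Proof.
elim: k f => [|k IH] f fC.
  split=> // x; apply: continuous_comp; first exact: continuous_mx_act.
  exact: (of_class_C_continuous fC).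
apply: (@of_class_CS _ _
    (fun i x => \sum_j rho j i * partial_deriv j f (mx_act rho x))) => [x|i x|i].
- apply: continuous_comp; first exact: continuous_mx_act.
  exact: (of_class_C_continuous fC).
- exact/is_derive_mx_act/of_class_C_le/fC.
- apply: of_class_C_sum => j; apply: of_class_CZ.
  exact: (IH (partial_deriv j f) (fC.2 j).2).
Qed.

Lemma orthogonal_double_sum (rho : 'M[R]_n) (D : 'I_n -> 'I_n -> R) :
  orthogonal_mx rho ->
  \sum_i \sum_j \sum_l rho j i * rho l i * D l j = \sum_i D i i.
Proof.
move=> orho; have rhoE j l : \sum_i rho j i * rho l i = (j == l)%:R.
  have := congr1 (fun M : 'M[R]_n => M j l) orho; rewrite !mxE => <-.
  by apply: eq_bigr => i _; rewrite mxE.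
rewrite exchange_big; apply: eq_bigr => j _; rewrite exchange_big /= (bigD1 j)//=.
rewrite -mulr_suml rhoE eqxx mul1r big1 ?addr0// => l lj.
by rewrite -mulr_suml rhoE eq_sym (negbTE lj) mul0r.
Qed.

(** The Laplacian commutes with isometries since rho rho^T is the identity. *)
Lemma laplacian_mx_act (rho : 'M[R]_n) f x : orthogonal_mx rho ->
  of_class_C 2 f -> laplacian (f \o mx_act rho) x = laplacian f (mx_act rho x).
Proof.
move=> orho fC; have f1C := of_class_C_pred fC; rewrite /laplacian.
transitivity (\sum_i \sum_j \sum_l rho j i * rho l i *
    partial_deriv l (partial_deriv j f) (mx_act rho x)).
  apply: eq_bigr => i _; rewrite partial_deriv_mx_act//.
  apply: derive_val.
  have -> : \sum_j \sum_l rho j i * rho l i *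
      partial_deriv l (partial_deriv j f) (mx_act rho x) =
     \sum_j rho j i * (\sum_l rho l i *
       partial_deriv l (partial_deriv j f) (mx_act rho x)).
    by apply: eq_bigr => j _; rewrite mulr_sumr; apply: eq_bigr => l _; rewrite mulrA.
  rewrite (_ : (fun x => _) =
      \sum_j (fun x => rho j i * (partial_deriv j f \o mx_act rho) x)); last first.
    by apply/funext => y; rewrite fct_sumE.
  apply: is_derive_sum => j; apply: is_deriveZ.
  exact: is_derive_mx_act (fC.2 j).2.
exact: (orthogonal_double_sum
  (fun l j => partial_deriv l (partial_deriv j f) (mx_act rho x)) orho).
Qed.

End class_C_algebra.

(** * Compactly supported functions *)

Section compact_support.
Context {R : realType} {n : nat}.
Implicit Types (f g : 'rV[R]_n -> R) (O : set 'rV[R]_n).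
Local Notation leb := (@lebesgue_rv R n).

Lemma closure_sub_closed (A C : set 'rV[R]_n) :
  A `<=` C -> closed C -> closure A `<=` C.
Proof. by move=> AC cC x /(closureS AC); exact: cC. Qed.

Lemma compactly_supported_sub O f g :
  [set x | g x != 0] `<=` closure [set x | f x != 0] ->
  compactly_supported_in O f -> compactly_supported_in O g.
Proof.
move=> gf [cf fO]; have sub : closure [set x | g x != 0] `<=` closure [set x | f x != 0].
  exact: closure_sub_closed gf (@closed_closure _ _).
split; last exact: subset_trans fO.
by apply: subclosed_compact cf sub; exact: closed_closure.
Qed.

Lemma compactly_supportedU O f1 f2 g :
  (forall x, f1 x = 0 -> f2 x = 0 -> g x = 0) ->
  compactly_supported_in O f1 -> compactly_supported_in O f2 ->
  compactly_supported_in O g.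
Proof.
move=> gf [c1 O1] [c2 O2].
have sub : closure [set x | g x != 0] `<=`
    closure [set x | f1 x != 0] `|` closure [set x | f2 x != 0].
  apply: closure_sub_closed; last exact: closedU (@closed_closure _ _) (@closed_closure _ _).
  move=> x /= gx; suff: f1 x != 0 \/ f2 x != 0.
    by case=> h; [left|right]; exact: subset_closure.
  have [f1x|] := eqVneq (f1 x) 0; last by left.
  by have [f2x|] := eqVneq (f2 x) 0; [rewrite gf ?eqxx in gx|right].
split; last by apply: (subset_trans sub); rewrite subUset.
by apply: subclosed_compact (compactU c1 c2) sub; exact: closed_closure.
Qed.

Lemma compactly_supported_partial O f i :
  compactly_supported_in O f -> compactly_supported_in O (partial_deriv i f).
Proof.
apply: compactly_supported_sub => x /= dfx; apply: contrapT => fx.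
have fx0 : \forall y \near x, f y = cst 0 y.
  have oK : open (~` closure [set x | f x != 0]) by exact/closed_openC/closed_closure.
  have := open_nbhs_nbhs (conj oK fx); apply: filterS => y Ky.
  by apply/eqP/negP => /negP fy; apply/Ky/subset_closure.
by move: dfx; rewrite /partial_deriv (near_eq_derive _ fx0) derive_cst eqxx.
Qed.

Lemma compactly_supported_mx_act O (rho : 'M[R]_n) f : orthogonal_mx rho ->
  mx_act rho @^-1` O = O ->
  compactly_supported_in O f -> compactly_supported_in O (f \o mx_act rho).
Proof.
move=> orho rhoO [cf fO]; set K := closure [set x | f x != 0] in cf fO.
have sub : closure [set x | (f \o mx_act rho) x != 0] `<=` mx_act rho @^-1` K.
  apply: closure_sub_closed; first by move=> x /= h; exact: subset_closure.
  apply: closed_comp => [x _|]; first exact: continuous_mx_act.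
  exact: closed_closure.
split; last by rewrite -rhoO => x /sub; exact: fO.
apply: subclosed_compact sub; first exact: closed_closure.
rewrite (_ : _ @^-1` _ = mx_act rho^T @` K).
  apply: continuous_compact cf; apply: continuous_subspaceT => x.
  exact: continuous_mx_act.
apply/seteqP; split=> x.
  by move=> Kx; exists (mx_act rho x) => //; rewrite mx_actK.
by move=> [y Ky <-]; rewrite /= mx_actKV.
Qed.

Lemma compactly_supported_bounded O f : continuous f ->
  compactly_supported_in O f -> exists2 M : R, 0 <= M & forall x, `|f x| <= M.
Proof.
move=> cf [kf _].
have : bounded_set (f @` closure [set x | f x != 0]).
  by apply: compact_bounded; apply: continuous_compact => //; exact: continuous_subspaceT.
move=> [M [_ hM]]; exists (`|M| + 1) => // x.
have [->|fx] := eqVneq (f x) 0; first by rewrite normr0.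
apply: hM; first by rewrite ltr_pwDr// ler_norm.
by exists x => //; exact: subset_closure.
Qed.

Lemma compact_measurable_rv (K : set 'rV[R]_n) : compact K -> measurable K.
Proof. by move=> cK; apply: measurable_rv_closed; apply: compact_closed. Qed.

Lemma L1_loc_integrableM O A f : open O -> L1_loc O A -> continuous f ->
  compactly_supported_in O f -> leb.-integrable O (EFin \o (fun x => A x * f x)).
Proof.
move=> oO [mA iA] cf kf; have [M M0 fM] := compactly_supported_bounded cf kf.
have [cK KO] := kf; set K := closure [set x | f x != 0] in cK KO.
have mO := measurable_rv_open oO; have mK := compact_measurable_rv cK.
have mf : measurable_fun O f by apply: measurable_funTS; exact: continuous_measurable_rv.
have iK : leb.-integrable K (EFin \o (fun x => A x * f x)).
  apply: (@integrable_dominated _ _ _ _ _ mK _ (fun x => M * `|A x|)) => //.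
  - by apply: measurable_funM; apply: (measurable_funS mO KO).
  - by apply: integrable_realZ => //; apply: integrable_real_norm; exact: iA.
  - by apply: aeW => x _; rewrite normrM mulrC ler_wpM2r.
have E : (fun x => A x * f x) = (fun x => A x * f x) \_ K.
  apply/funext => x; rewrite patchE; case: ifPn => //= xK.
  have -> : f x = 0; last by rewrite mulr0.
  apply/eqP/negP => /negP fx; move: xK; rewrite notin_setE; apply.
  exact: subset_closure.
apply: (@integrableS _ _ _ leb setT) => //.
by have := (integrable_mkcond _ mK).1 iK; rewrite restrict_EFin -E.
Qed.

Lemma L1_loc_cst O (c : R) : L1_loc O (fun _ => c).
Proof.
split=> [|K cK _]; first exact: measurable_cst.
apply/integrableP; split; first exact: measurable_cst.
rewrite integral_cst/=; last exact: compact_measurable_rv.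
apply: lte_mul_pinfty => //.
by apply: lebesgue_rv_bounded; [exact: compact_measurable_rv|exact: compact_bounded].
Qed.

Lemma compactly_supported_integrable O f : open O -> continuous f ->
  compactly_supported_in O f -> leb.-integrable O (EFin \o f).
Proof.
move=> oO cf kf; have := L1_loc_integrableM oO (L1_loc_cst O 1) cf kf.
by rewrite (_ : (fun x => 1 * f x) = f)//; apply/funext => x; rewrite mul1r.
Qed.

End compact_support.

(** * Stable potentials and gradients of logarithms *)

Section stability.
Context {R : realType} {n : nat}.
Implicit Types (f p q A : 'rV[R]_n -> R) (O : set 'rV[R]_n).
Local Notation leb := (@lebesgue_rv R n).
Local Notation E i := (delta_mx ord0 i : 'rV[R]_n).

Definition grad_sq f (x : 'rV[R]_n) : R := \sum_(i < n) partial_deriv i f x ^+ 2.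

Definition stable_potential O A := forall phi, Ck_c 1 O phi ->
  \int[leb]_(x in O) (A x * phi x ^+ 2) <= \int[leb]_(x in O) grad_sq phi x.

Lemma grad_sq_ge0 f x : 0 <= grad_sq f x.
Proof. by apply: sumr_ge0 => i _; exact: sqr_ge0. Qed.

Lemma compactly_supportedM O f g :
  compactly_supported_in O f -> compactly_supported_in O (fun x => g x * f x).
Proof. by move=> kf; apply: (compactly_supportedU _ kf kf) => x -> _; rewrite mulr0. Qed.

Lemma integrable_potential O A f : open O -> L1_loc O A -> Ck_c 1 O f ->
  leb.-integrable O (EFin \o (fun x => A x * f x ^+ 2)).
Proof.
move=> oO iA [fC kf]; apply: L1_loc_integrableM => //.
  by under eq_fun do rewrite expr2; apply: of_class_C_continuous (of_class_CM fC fC).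
exact: compactly_supportedM.
Qed.

Lemma Ck_c_partial_integrable O f i : open O -> Ck_c 1 O f ->
  leb.-integrable O (EFin \o (fun x => partial_deriv i f x ^+ 2)).
Proof.
move=> oO [fC kf]; apply: compactly_supported_integrable => //.
  under eq_fun do rewrite expr2; have h : of_class_C 0 (partial_deriv i f) := (fC.2 i).2.
  exact: (of_class_C_continuous (of_class_CM h h)).
exact/compactly_supportedM/compactly_supported_partial.
Qed.

Lemma integrable_grad_sq O f : open O -> Ck_c 1 O f ->
  leb.-integrable O (EFin \o grad_sq f).
Proof.
move=> oO kf; apply: integrable_real_sum; first exact: measurable_rv_open.
by move=> i; exact: Ck_c_partial_integrable.
Qed.

(** A regularized Euclidean norm of (p, q). Subtracting d, as is always done below,
    makes it vanish where p and q do, hence compactly supported. *)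
Definition hypot (d : R) p q (x : 'rV[R]_n) : R :=
  Num.sqrt (p x ^+ 2 + q x ^+ 2 + d ^+ 2).

Lemma hypot_arg_gt0 (d a b : R) : 0 < d -> 0 < a ^+ 2 + b ^+ 2 + d ^+ 2.
Proof. by move=> d0; rewrite ltr_wpDl ?exprn_gt0// addr_ge0 ?sqr_ge0. Qed.

Lemma partial_deriv_hypot (d : R) p q i x : 0 < d -> of_class_C 1 p -> of_class_C 1 q ->
  partial_deriv i (fun x => hypot d p q x - d) x =
  (p x * partial_deriv i p x + q x * partial_deriv i q x) / hypot d p q x.
Proof.
move=> d0 pC qC; have := hypot_arg_gt0 (p x) (q x) d0 => s0.
have dp := of_class_C_is_derive x i pC; have dq := of_class_C_is_derive x i qC.
have dpp := @is_deriveM _ _ p p x _ _ _ dp dp.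
have dqq := @is_deriveM _ _ q q x _ _ _ dq dq.
have dpq := @is_deriveD _ _ _ _ _ x _ _ _ dpp dqq.
have darg := @is_deriveD _ _ _ _ _ x _ _ _ dpq (is_derive_cst (d ^+ 2) x (E i)).
have E1 : p * p + q * q + cst (d ^+ 2) = (fun x => p x ^+ 2 + q x ^+ 2 + d ^+ 2).
  by apply/funext => y; rewrite !expr2.
rewrite E1 in darg.
have ds := @is_derive_chain _ _ Num.sqrt (fun x => p x ^+ 2 + q x ^+ 2 + d ^+ 2) _ _ _ _
  (is_derive1_sqrt s0) darg.
have dh := @is_deriveB _ _ _ _ _ x _ _ _ ds (is_derive_cst d x (E i)).
have [_ dhE] := dh; have -> := dhE : partial_deriv i (fun x => hypot d p q x - d) x = _.
rewrite /hypot subr0 addr0; have sc (a b : R) : a *: b = a * b by [].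
have r0 : Num.sqrt (p x ^+ 2 + q x ^+ 2 + d ^+ 2) != 0 by rewrite gt_eqF ?sqrtr_gt0.
by rewrite !sc; field.
Qed.

Lemma hypot_Ck_c O (d : R) p q : 0 < d -> Ck_c 1 O p -> Ck_c 1 O q ->
  Ck_c 1 O (fun x => hypot d p q x - d).
Proof.
move=> d0 [pC kp] [qC kq]; split.
  apply: of_class_CB; last exact: of_class_C_cst.
  apply: of_class_C_sqrt => [x|]; first exact: hypot_arg_gt0.
  apply: of_class_CD; last exact: of_class_C_cst.
  by under eq_fun do rewrite !expr2; apply: of_class_CD; apply: of_class_CM.
apply: (compactly_supportedU _ kp kq) => x px qx; rewrite /hypot px qx.
by rewrite expr0n/= !add0r sqrtr_sqr gtr0_norm// subrr.
Qed.

(** The point of the test function sqrt(p^2 + q^2 + d^2) - d: its Dirichlet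
    energy is at most the sum of those of p and q, and the loss controls the
    gradient of log p where q is constant. *)
Lemma hypot_grad_sq_le (d : R) p q x : 0 < d -> of_class_C 1 p -> of_class_C 1 q ->
  grad_sq (fun x => hypot d p q x - d) x <= grad_sq p x + grad_sq q x.
Proof.
move=> d0 pC qC; rewrite /grad_sq -big_split/=; apply: ler_sum => i _.
rewrite partial_deriv_hypot// exprMn exprVn sqr_sqrtr; last exact/ltW/hypot_arg_gt0.
have s0 := hypot_arg_gt0 (p x) (q x) d0; rewrite ler_pdivrMr//.
set a := partial_deriv i p x; set b := partial_deriv i q x.
(* Lagrange's identity: the difference is a sum of squares. *)
have := sqr_ge0 (p x * b - q x * a); have := sqr_ge0 (a * d); have := sqr_ge0 (b * d).
rewrite -subr_ge0 => h1 h2 h3; rewrite -subr_ge0.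
rewrite (_ : _ - _ = (p x * b - q x * a) ^+ 2 + (a * d) ^+ 2 + (b * d) ^+ 2); last by ring.
by rewrite !addr_ge0 ?sqr_ge0.
Qed.

(** Where q is constant, equal to e, the gradient is p grad p / sqrt (p^2 + e^2 + d^2),
    whose square is at most (1 - e^2 / (p^2 + e^2)) |grad p|^2 whatever d is. *)
Lemma hypot_grad_sq_le_cst (d e : R) p q x : 0 < d -> 0 < e ->
  of_class_C 1 p -> of_class_C 1 q ->
  q x = e -> (forall i, partial_deriv i q x = 0) ->
  grad_sq (fun x => hypot d p q x - d) x <=
  grad_sq p x + grad_sq q x - e ^+ 2 * (grad_sq p x / (p x ^+ 2 + e ^+ 2)).
Proof.
move=> d0 e0 pC qC qe dq.
have -> : grad_sq q x = 0.
  by rewrite /grad_sq big1// => i _; rewrite dq expr0n.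
rewrite addr0 /grad_sq mulr_suml mulr_sumr -sumrB; apply: ler_sum => i _.
rewrite partial_deriv_hypot// dq mulr0 addr0 exprMn exprVn sqr_sqrtr; last exact/ltW/hypot_arg_gt0.
rewrite qe; set a := partial_deriv i p x; set P := p x.
have s0 := hypot_arg_gt0 P e d0.
have t0 : 0 < P ^+ 2 + e ^+ 2 by rewrite ltr_wpDl ?sqr_ge0 ?exprn_gt0.
rewrite exprMn -subr_ge0.
rewrite (_ : _ - _ = a ^+ 2 * (P ^+ 2 * d ^+ 2) /
    ((P ^+ 2 + e ^+ 2) * (P ^+ 2 + e ^+ 2 + d ^+ 2))); last by field; rewrite !gt_eqF.
apply: divr_ge0; last by apply: mulr_ge0; exact: ltW.
by apply: mulr_ge0; [exact: sqr_ge0|apply: mulr_ge0; exact: sqr_ge0].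
Qed.

(** The bounds on eta = sqrt (a^2 + b^2 + d^2) - d that control the error in
    eta^2 = a^2 + b^2 - 2 d eta. *)
Lemma hypot_sub_le (d a b : R) : 0 < d ->
  0 <= Num.sqrt (a ^+ 2 + b ^+ 2 + d ^+ 2) - d <= `|a| + `|b|.
Proof.
move=> d0; have s0 := hypot_arg_gt0 a b d0; rewrite subr_ge0 lerBlDr.
have n0 : 0 <= `|a| + `|b| + d by rewrite !addr_ge0 ?normr_ge0 ?ltW.
apply/andP; split.
  have h : d ^+ 2 <= a ^+ 2 + b ^+ 2 + d ^+ 2.
    by rewrite lerDr; apply: addr_ge0; exact: sqr_ge0.
  by have := ler_wsqrtr h; rewrite sqrtr_sqr gtr0_norm.
suff h : a ^+ 2 + b ^+ 2 + d ^+ 2 <= (`|a| + `|b| + d) ^+ 2.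
  by have := ler_wsqrtr h; rewrite sqrtr_sqr (ger0_norm n0).
rewrite -[a ^+ 2]real_normK ?num_real// -[b ^+ 2]real_normK ?num_real//.
have := normr_ge0 a; have := normr_ge0 b; set x := `|a|; set y := `|b| => y0 x0.
nra.
Qed.

Let arith (E P Q L AP AQ AE Z d : R) :
  E <= P + Q - L -> AP + AQ - d * 2 * Z <= AE -> AE <= E ->
  L <= P - AP + (Q - AQ) + d * (2 * Z).
Proof. by move=> *; lra. Qed.

(** Stability is tested with sqrt (p^2 + q^2 + d^2) - d. Its potential term differs
    from the sum of those of p and q by O(d), its Dirichlet energy is smaller than
    the sum of those of p and q by the left-hand side, and d tends to 0. *)
Theorem stable_log_gradient O A p q (D : set 'rV[R]_n) (e : R) :
  open O -> L1_loc O A -> stable_potential O A ->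
  Ck_c 1 O p -> Ck_c 1 O q -> measurable D -> D `<=` O -> 0 < e ->
  (forall x, D x -> q x = e /\ forall i, partial_deriv i q x = 0) ->
  e ^+ 2 * \int[leb]_(x in D) (grad_sq p x / (p x ^+ 2 + e ^+ 2)) <=
  (\int[leb]_(x in O) grad_sq p x - \int[leb]_(x in O) (A x * p x ^+ 2)) +
  (\int[leb]_(x in O) grad_sq q x - \int[leb]_(x in O) (A x * q x ^+ 2)).
Proof.
move=> oO LA SA kp kq mD DO e0 qD; have mO := measurable_rv_open oO.
have [pC sp] := kp; have [qC sq] := kq.
pose l x := grad_sq p x / (p x ^+ 2 + e ^+ 2).
have l0 x : 0 <= l x.
  by rewrite divr_ge0 ?grad_sq_ge0 ?addr_ge0 ?sqr_ge0.
have igp := integrable_grad_sq oO kp; have igq := integrable_grad_sq oO kq.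
have iAp := integrable_potential oO LA kp; have iAq := integrable_potential oO LA kq.
have ml : measurable_fun O l.
  apply: measurable_funM; first exact: integrable_measurable_real igp.
  apply: measurable_funTS; apply: continuous_measurable_rv.
  have p2 x : 0 < p x * p x + e ^+ 2 by rewrite -expr2 ltr_wpDl ?sqr_ge0 ?exprn_gt0.
  have rC : of_class_C 1 (fun x => (Num.sqrt (p x * p x + e ^+ 2))^-1).
    apply: of_class_C_invsqrt => //; apply: of_class_CD; first exact: of_class_CM.
    exact: of_class_C_cst.
  rewrite (_ : (fun x => _) = fun x => (Num.sqrt (p x * p x + e ^+ 2))^-1 *
      (Num.sqrt (p x * p x + e ^+ 2))^-1).
    exact: of_class_C_continuous (of_class_CM rC rC).
  by apply/funext => x; rewrite -invfM -!expr2 sqr_sqrtr// expr2 ltW.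
have il : leb.-integrable O (EFin \o l).
  apply: (integrable_dominated mO ml (integrable_realZ mO (e ^- 2) igp)).
  apply: aeW => x _; rewrite ger0_norm// /l mulrC.
  apply: ler_wpM2r; first exact: grad_sq_ge0.
  rewrite lef_pV2 ?posrE ?exprn_gt0// ?lerDr ?sqr_ge0//.
  by rewrite ltr_wpDl ?sqr_ge0 ?exprn_gt0.
have ilD : leb.-integrable O (EFin \o (l \_ D)).
  apply: (integrable_dominated mO _ il).
    by apply/measurable_restrict => //; apply: measurable_funS ml.
  apply: aeW => x _; rewrite patchE; case: ifPn => _; first by rewrite ger0_norm.
  by rewrite normr0.
have DE : \int[leb]_(x in D) l x = \int[leb]_(x in O) (l \_ D) x.
  by rewrite -Rintegral_mkcondr setIidr.
pose Z := \int[leb]_(x in O) (`|A x| * (`|p x| + `|q x|)).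
have iZ : leb.-integrable O (EFin \o (fun x => `|A x| * (`|p x| + `|q x|))).
  apply: L1_loc_integrableM => //.
  - case: LA => mA iA; split=> [|K cK KO]; first exact: measurableT_comp.
    apply: integrable_real_norm; exact: iA.
  - move=> x; have cp := of_class_C_continuous pC; have cq := of_class_C_continuous qC.
    exact (cvgD (cvg_norm (cp x)) (cvg_norm (cq x))).
  - apply: (compactly_supportedU _ sp sq) => x -> ->.
    by rewrite normr0 addr0.
(* The integral Z bounds the error of order d in the potential term. *)
have main d : 0 < d -> e ^+ 2 * \int[leb]_(x in D) l x <=
  (\int[leb]_(x in O) grad_sq p x - \int[leb]_(x in O) (A x * p x ^+ 2)) +
  (\int[leb]_(x in O) grad_sq q x - \int[leb]_(x in O) (A x * q x ^+ 2)) +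
  d * (2 * Z).
  move=> d0; have keta := hypot_Ck_c d0 kp kq.
  have ige := integrable_grad_sq oO keta.
  have iAe := integrable_potential oO LA keta.
  have h1 : \int[leb]_(x in O) grad_sq (fun x => hypot d p q x - d) x <=
      \int[leb]_(x in O) (grad_sq p x + grad_sq q x - e ^+ 2 * (l \_ D) x).
    apply: le_Rintegral => //.
      apply: integrable_realB => //; first exact: integrable_realD.
      exact: integrable_realZ.
    move=> x _; rewrite patchE; case: ifPn => [/set_mem Dx|_].
      by have [qe dq] := qD x Dx; exact: hypot_grad_sq_le_cst.
    by rewrite mulr0 subr0; exact: hypot_grad_sq_le.
  have h2 : \int[leb]_(x in O) (A x * p x ^+ 2 + A x * q x ^+ 2 -
      (d * 2) * (`|A x| * (`|p x| + `|q x|))) <=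
      \int[leb]_(x in O) (A x * (hypot d p q x - d) ^+ 2).
    apply: le_Rintegral => //.
      apply: integrable_realB => //; first exact: integrable_realD.
      exact: integrable_realZ.
    move=> x _; have /andP[] := hypot_sub_le (p x) (q x) d0; rewrite -/(hypot d p q x).
    set eta := hypot d p q x - d => eta0 eta1.
    have E : p x ^+ 2 + q x ^+ 2 = eta ^+ 2 + 2 * d * eta.
      have : (eta + d) ^+ 2 = p x ^+ 2 + q x ^+ 2 + d ^+ 2.
        by rewrite /eta subrK /hypot sqr_sqrtr// ltW// hypot_arg_gt0.
      by move=> h; apply: (addIr (d ^+ 2)); rewrite -h; ring.
    rewrite -mulrDr E lerBlDr mulrDr lerD2l.
    rewrite (_ : d * 2 * _ = 2 * d * (`|A x| * (`|p x| + `|q x|))); last by ring.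
    rewrite (_ : A x * (2 * d * eta) = 2 * d * (A x * eta)); last by ring.
    rewrite ler_pM2l ?mulr_gt0//; apply: (@le_trans _ _ (`|A x| * eta)).
      by rewrite ler_wpM2r// ler_norm.
    by rewrite ler_wpM2l.
  move: h1 h2 (SA _ keta).
  rewrite RintegralB//; [|exact: integrable_realD|exact: integrable_realZ].
  rewrite RintegralD// RintegralZl// -DE.
  rewrite RintegralB//; [|exact: integrable_realD|exact: integrable_realZ].
  rewrite RintegralD// RintegralZl// -/Z.
  exact: arith.
apply/ler_addgt0Pr => t t0; have Z0 : 0 <= Z.
  by apply: Rintegral_ge0 => x _; rewrite mulr_ge0 ?addr_ge0 ?normr_ge0.
have tZ : 0 < t / (2 * Z + 1) by rewrite divr_gt0// ltr_wpDl ?mulr_ge0.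
apply: le_trans (main _ tZ) _; rewrite lerD2l mulrAC ler_pdivrMr.
  by rewrite ler_pM2l// lerDl.
by rewrite ltr_wpDl ?mulr_ge0.
Qed.

End stability.

(** * A smooth approximation of the positive part *)

Section smooth_positive_part.
Context {R : realType} {n : nat}.
Implicit Types (f : 'rV[R]_n -> R).

(** The mean of t and of a smooth approximation of its absolute value. Unlike a
    mollified positive part it vanishes exactly at 0, so that composing with it
    preserves compact support. *)
Definition smooth_pos (d t : R) : R := (t + (Num.sqrt (t ^+ 2 + d ^+ 2) - d)) / 2.

Definition smooth_pos' (d t : R) : R := (1 + t / Num.sqrt (t ^+ 2 + d ^+ 2)) / 2.

Lemma sqrt_sqD_bounds (d t : R) : 0 < d ->
  `|t| < Num.sqrt (t ^+ 2 + d ^+ 2) /\ d <= Num.sqrt (t ^+ 2 + d ^+ 2) <= `|t| + d.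
Proof.
move=> d0; have t2 := sqr_ge0 t; have d2 : 0 < d ^+ 2 by rewrite exprn_gt0.
split; last (apply/andP; split).
- have s0 : 0 < t ^+ 2 + d ^+ 2 by rewrite ltr_wpDl.
  by rewrite -sqrtr_sqr (ltr_sqrt _ s0) ltrDl.
- have h : d ^+ 2 <= t ^+ 2 + d ^+ 2 by rewrite lerDr.
  by have := ler_wsqrtr h; rewrite sqrtr_sqr gtr0_norm.
- have n0 : 0 <= `|t| + d by rewrite addr_ge0 ?normr_ge0 ?ltW.
  have h : t ^+ 2 + d ^+ 2 <= (`|t| + d) ^+ 2.
    rewrite -[t ^+ 2]real_normK ?num_real//; have := normr_ge0 t.
    by set x := `|t| => x0; nra.
  by have := ler_wsqrtr h; rewrite sqrtr_sqr (ger0_norm n0).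
Qed.

Lemma smooth_pos'_bounds (d t : R) : 0 < d -> 0 <= smooth_pos' d t <= 1.
Proof.
move=> d0; have [h _] := sqrt_sqD_bounds t d0; rewrite /smooth_pos'.
set s := Num.sqrt _ in h *; have s0 : 0 < s by exact: le_lt_trans h.
have /andP[h1 h2] : -1 <= t / s <= 1.
  by rewrite -ler_norml normrM normfV (gtr0_norm s0) ler_pdivrMr// mul1r ltW.
by apply/andP; split; lra.
Qed.

Lemma smooth_pos_dist (d t : R) : 0 < d -> `|smooth_pos d t - Num.max 0 t| <= d.
Proof.
move=> d0; have [h /andP[_ h2]] := sqrt_sqD_bounds t d0; rewrite /smooth_pos.
set s := Num.sqrt _ in h h2 *.
have -> : Num.max 0 t = (t + `|t|) / 2.
  case: (lerP 0 t) => t0; first by rewrite ger0_norm//; lra.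
  by rewrite ltr0_norm//; lra.
by rewrite ler_norml; apply/andP; split; lra.
Qed.

Lemma smooth_pos_le (d t : R) : 0 < d -> `|smooth_pos d t| <= `|t|.
Proof.
move=> d0; have [h /andP[h1 h2]] := sqrt_sqD_bounds t d0; rewrite /smooth_pos.
set s := Num.sqrt _ in h h1 h2 *.
have := ler_norm t; have := ler_norm (- t); rewrite normrN => a1 a2.
by rewrite ler_norml; apply/andP; split; lra.
Qed.

Lemma smooth_pos0 (d : R) : 0 < d -> smooth_pos d 0 = 0.
Proof.
by move=> d0; apply/eqP; rewrite -normr_le0 -[leRHS](@normr0 R R); exact: smooth_pos_le.
Qed.

Lemma smooth_pos_of_class_C k (d : R) f : 0 < d -> of_class_C k f ->
  of_class_C k (smooth_pos d \o f).
Proof.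
move=> d0 fC; rewrite (_ : _ \o _ =
    fun x => 2^-1 * (f x + (Num.sqrt (f x * f x + d ^+ 2) - d))); last first.
  by apply/funext => x; rewrite /smooth_pos /= mulrC -expr2.
apply: of_class_CZ; apply: of_class_CD => //; apply: of_class_CB; last exact: of_class_C_cst.
apply: of_class_C_sqrt => [x|].
  by rewrite -expr2 ltr_wpDl ?sqr_ge0 ?exprn_gt0.
by apply: of_class_CD; [exact: of_class_CM|exact: of_class_C_cst].
Qed.

(** The square root is a [hypot] with q = 0. *)
Lemma partial_deriv_smooth_pos (d : R) f i x : 0 < d -> of_class_C 1 f ->
  partial_deriv i (smooth_pos d \o f) x = smooth_pos' d (f x) * partial_deriv i f x.
Proof.
move=> d0 fC; have df := of_class_C_is_derive x i fC.
have zC : of_class_C 1 (fun _ : 'rV[R]_n => 0 : R) by exact: of_class_C_cst.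
have hE y : hypot d f (fun=> 0) y = Num.sqrt (f y ^+ 2 + d ^+ 2).
  by rewrite /hypot expr0n/= addr0.
have hC : of_class_C 1 (fun x => hypot d f (fun=> 0) x - d).
  apply: of_class_CB; last exact: of_class_C_cst.
  apply: of_class_C_sqrt => [y|]; first exact: hypot_arg_gt0.
  apply: of_class_CD; last exact: of_class_C_cst.
  by under eq_fun do rewrite !expr2; apply: of_class_CD; apply: of_class_CM.
have dh := of_class_C_is_derive x i hC.
rewrite partial_deriv_hypot// mul0r addr0 hE in dh.
have [_ ds] := @is_deriveZ _ _ _ _ 2^-1 x _ _ (@is_deriveD _ _ _ _ _ x _ _ _ df dh).
rewrite /partial_deriv (_ : smooth_pos d \o f =
    2^-1 *: (f + (fun x => hypot d f (fun=> 0) x - d))).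
  rewrite ds /GRing.scale/= /smooth_pos' -/(partial_deriv i f x); ring.
by apply/funext => y; rewrite /smooth_pos /= -hE mulrC.
Qed.

Lemma smooth_pos_Coo_c O (d : R) f : 0 < d -> Coo_c O f -> Coo_c O (smooth_pos d \o f).
Proof.
move=> d0 [fC kf]; split=> [k|]; first exact: smooth_pos_of_class_C.
by apply: (compactly_supportedU _ kf kf) => x fx _; rewrite /= fx smooth_pos0.
Qed.

Lemma Coo_c_Ck_c k O f : Coo_c O f -> Ck_c k O f.
Proof. by case=> fC kf; split. Qed.

End smooth_positive_part.

(** * Energy of the positive part *)

Lemma geometric_sqr_cvg (R : realType) (a : nat -> R) (l s : R) :
  (forall k, (a k - l) ^+ 2 <= s / 2 ^+ k) -> a @ \oo --> l.
Proof.
move=> h; have s0 : s / 2 ^+ k @[k --> \oo] --> 0.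
  rewrite -[X in _ --> X](mulr0 s); apply: cvgMr.
  under eq_fun do rewrite -exprVn.
  by apply: cvg_expr; rewrite ger0_norm ?invr_ge0// invf_lt1 ?ltr1n.
apply/cvgrPdist_le => e e0.
have /cvgrPdist_le/(_ (e ^+ 2)) := s0; rewrite exprn_gt0// => /(_ isT).
apply: filterS => k; rewrite sub0r normrN => hk.
have e0' := ltW e0.
rewrite distrC -(@ler_pXn2r _ 2) ?nnegrE// real_normK ?num_real//.
exact: le_trans (h k) (le_trans (ler_norm _) hk).
Qed.

Lemma diff_sqr_le (R : realDomainType) (c a b : R) :
  (a - b) ^+ 2 <= 2 * ((c - a) ^+ 2 + (c - b) ^+ 2).
Proof.
rewrite -subr_ge0 (_ : _ - _ = ((c - a) + (c - b)) ^+ 2); last by ring.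
exact: sqr_ge0.
Qed.

(** The constants in the last step of [weighted_difference]. *)
Lemma weight_constants (R : realDomainType) (c : R) : 0 <= c ->
  2 <= 4 * c + 3 /\ 4 * c + 1 <= 4 * c + 3.
Proof. by move=> c0; split; lra. Qed.

(** In the application w = u - v, d = f(u) - f(v), A = f'(u), B = f'(v), g is the
    weak gradient of w, and - C0 is a lower bound of f' on the half-line. The
    approximations phi k of w converge fast enough in H^1 for the series of errors
    to be summable. *)
Section energy.
Context {R : realType} {n : nat}.
Local Notation leb := (@lebesgue_rv R n).
Variables (O : set 'rV[R]_n) (oO : open O).
Variables (w d A B : 'rV[R]_n -> R) (g : 'I_n -> 'rV[R]_n -> R).
Variables (phi : nat -> 'rV[R]_n -> R) (C0 : R).
Hypothesis C0_ge0 : 0 <= C0.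
Hypothesis mw : measurable_fun O w.
Hypothesis iw : leb.-integrable O (EFin \o (fun x => w x ^+ 2)).
Hypothesis mg : forall i, measurable_fun O (g i).
Hypothesis ig : forall i, leb.-integrable O (EFin \o (fun x => g i x ^+ 2)).
Hypothesis phiC : forall k, Coo_c O (phi k).

Let h k x := (w x - phi k x) ^+ 2 + \sum_i (g i x - partial_deriv i (phi k) x) ^+ 2.

Hypothesis phi_cv : forall k, \int[leb]_(x in O) h k x <= 1 / 4 ^+ k.
Hypothesis LA : L1_loc O A.
Hypothesis LB : L1_loc O B.
Hypothesis SA : stable_potential O A.
Hypothesis SB : stable_potential O B.
Hypothesis A_ge : forall x, - C0 <= A x.
Hypothesis B_ge : forall x, - C0 <= B x.

(** The constant makes the weight M at least 1 and at least |A|. *)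
Let M x := A x + B x + (4 * C0 + 1).

Hypothesis md : measurable_fun O d.
Hypothesis dM : {ae leb, forall x, O x -> `|d x| <= M x * `|w x| }.
Hypothesis dA : {ae leb, forall x, O x -> 0 < w x -> d x <= A x * w x}.
Hypothesis weak_eq : forall psi, Coo_c O psi ->
  \int[leb]_(x in O) (\sum_i g i x * partial_deriv i psi x) =
  \int[leb]_(x in O) (d x * psi x).

Let mO : measurable O := measurable_rv_open oO.

Let M_ge1 x : 1 <= M x.
Proof. by rewrite /M; have := A_ge x; have := B_ge x; have := C0_ge0; lra. Qed.

Let A_leM x : `|A x| <= M x.
Proof.
rewrite ler_norml /M; have := A_ge x; have := B_ge x; have := C0_ge0.
by move=> *; apply/andP; split; lra.
Qed.

Let mA : measurable_fun O A. Proof. by case: LA. Qed.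
Let mM : measurable_fun O M.
Proof.
by apply: measurable_funD => //; apply: measurable_funD => //; case: LB.
Qed.

Let phi_C k : Ck_c 1 O (phi k). Proof. exact: Coo_c_Ck_c. Qed.

Let mphi k : measurable_fun O (phi k).
Proof.
apply: measurable_funTS; apply: continuous_measurable_rv.
by have [h1 _] := phi_C k; exact: of_class_C_continuous h1.
Qed.

Let mdphi k i : measurable_fun O (partial_deriv i (phi k)).
Proof.
apply: measurable_funTS; apply: continuous_measurable_rv.
by have [[_ h1] _] := phi_C k; exact: (h1 i).2.1.
Qed.

Let idphi k i : leb.-integrable O (EFin \o (fun x => partial_deriv i (phi k) x ^+ 2)).
Proof. exact: Ck_c_partial_integrable. Qed.

Let iphi k : leb.-integrable O (EFin \o (fun x => phi k x ^+ 2)).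
Proof.
have [h1 h2] := phi_C k; apply: compactly_supported_integrable => //.
  under eq_fun do rewrite expr2; exact: of_class_C_continuous (of_class_CM h1 h1).
exact: compactly_supportedM.
Qed.

Let ie k i : leb.-integrable O (EFin \o (fun x => (g i x - partial_deriv i (phi k) x) ^+ 2)).
Proof. exact: integrable_sqrB. Qed.

Let ih k : leb.-integrable O (EFin \o h k).
Proof.
apply: integrable_realD => //; first exact: integrable_sqrB.
exact: integrable_real_sum.
Qed.

Let h_ge0 k x : 0 <= h k x.
Proof. by apply: addr_ge0; [exact: sqr_ge0|apply: sumr_ge0 => i _; exact: sqr_ge0]. Qed.

Let phi_ae : {ae leb, forall x, O x -> phi ^~ x @ \oo --> w x}.
Proof.
have [S [_ hS]] := geometric_domination mO ih (fun k x _ => h_ge0 k x) phi_cv.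
apply: filterS hS => x hS Ox; have [S0 hk] := hS Ox.
apply: (@geometric_sqr_cvg R _ _ (S x)) => k; apply: le_trans (hk k).
rewrite /h -sqrrN opprB lerDl; apply: sumr_ge0 => i _; exact: sqr_ge0.
Qed.

Let C2 := 4 * (4 * C0 + 3).

(** Stability for A and for B, tested with phi k - phi l, controls the weighted
    norm by the H^1 norm. *)
Let weighted_difference k l : (k <= l)%N ->
  \int[leb]_(x in O) (M x * (phi k x - phi l x) ^+ 2) <= C2 / 4 ^+ k.
Proof.
move=> kl; pose q x := phi k x - phi l x.
have [kC kk] := phi_C k; have [lC kl'] := phi_C l.
have qC : Ck_c 1 O q.
  split; first exact: of_class_CB.
  by apply: (compactly_supportedU _ kk kl') => x; rewrite /q => -> ->; rewrite subrr.
have iq : leb.-integrable O (EFin \o (fun x => q x ^+ 2)).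
  exact: integrable_sqrB.
have dq i x : partial_deriv i q x = partial_deriv i (phi k) x - partial_deriv i (phi l) x.
  have [_ E] := @is_deriveB _ _ _ _ _ x _ _ _ (of_class_C_is_derive x i kC)
    (of_class_C_is_derive x i lC).
  exact: E.
have igq := integrable_grad_sq oO qC.
have iAq := integrable_potential oO LA qC; have iBq := integrable_potential oO LB qC.
have -> : \int[leb]_(x in O) (M x * (phi k x - phi l x) ^+ 2) =
    \int[leb]_(x in O) (A x * q x ^+ 2) + \int[leb]_(x in O) (B x * q x ^+ 2)
    + (4 * C0 + 1) * \int[leb]_(x in O) (q x ^+ 2).
  rewrite -RintegralZl// -RintegralD// -RintegralD//; last 2 first.
  - exact: integrable_realD.
  - exact: integrable_realZ.
  by apply: eq_Rintegral => x _; rewrite /M /q; ring.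
apply: (@le_trans _ _ (2 * \int[leb]_(x in O) grad_sq q x +
    (4 * C0 + 1) * \int[leb]_(x in O) (q x ^+ 2))).
  by rewrite lerD2r mulr_natl mulr2n lerD//; [exact: SA|exact: SB].
have -> : C2 / 4 ^+ k = (4 * C0 + 3) * 2 * (1 / 4 ^+ k + 1 / 4 ^+ k).
  by rewrite /C2; field; rewrite expf_neq0.
apply: (@le_trans _ _ ((4 * C0 + 3) * 2 *
    (\int[leb]_(x in O) h k x + \int[leb]_(x in O) h l x))); last first.
  rewrite ler_pM2l; last by rewrite mulr_gt0// ltr_wpDl ?mulr_ge0.
  apply: lerD => //; apply: le_trans (phi_cv l) _.
  by rewrite ler_pM2l// lef_pV2 ?posrE ?exprn_gt0// ler_eXn2l// ltr1n.
have pt : \int[leb]_(x in O) (grad_sq q x + q x ^+ 2) <=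
    \int[leb]_(x in O) (2 * (h k x + h l x)).
  apply: le_Rintegral => //; first exact: integrable_realD.
    by apply: integrable_realZ => //; exact: integrable_realD.
  move=> x _; rewrite /h addrACA mulrDr [leLHS]addrC; apply: lerD.
    by rewrite /q; apply: diff_sqr_le.
  rewrite -big_split mulr_sumr; apply: ler_sum => i _.
  by rewrite dq; exact: diff_sqr_le.
rewrite (RintegralD mO igq iq) in pt.
rewrite (RintegralZl 2 mO (integrable_realD mO (ih k) (ih l))) in pt.
rewrite (RintegralD mO (ih k) (ih l)) in pt.
rewrite -mulrA; apply: (@le_trans _ _ ((4 * C0 + 3) *
  (\int[leb]_(x in O) grad_sq q x + \int[leb]_(x in O) (q x ^+ 2)))); last first.
  by rewrite ler_pM2l// ltr_wpDl ?mulr_ge0.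
have q1 : 0 <= \int[leb]_(x in O) grad_sq q x.
  by apply: Rintegral_ge0 => x _; exact: grad_sq_ge0.
have q2 : 0 <= \int[leb]_(x in O) (q x ^+ 2).
  by apply: Rintegral_ge0 => x _; exact: sqr_ge0.
have [c1 c2] := weight_constants C0_ge0.
by rewrite mulrDr; apply: lerD; apply: ler_wpM2r.
Qed.

(** Fatou as l tends to infinity in [weighted_difference]. In particular M w^2 is
    integrable. *)
Let weighted_limit k : leb.-integrable O (EFin \o (fun x => M x * (phi k x - w x) ^+ 2)) /\
  \int[leb]_(x in O) (M x * (phi k x - w x) ^+ 2) <= C2 / 4 ^+ k.
Proof.
apply: (Rintegral_bounded_cvg mO (f_ := fun l x => M x * (phi k x - phi (l + k)%N x) ^+ 2)).
- move=> l; rewrite (_ : (fun x => _) = fun x => A x * (phi k x - phi (l + k)%N x) ^+ 2 +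
    B x * (phi k x - phi (l + k)%N x) ^+ 2 +
    (4 * C0 + 1) * (phi k x - phi (l + k)%N x) ^+ 2); last first.
    by apply/funext => x; rewrite /M; ring.
  have qC : Ck_c 1 O (fun x => phi k x - phi (l + k)%N x).
    have [kC kk] := phi_C k; have [lC kl'] := phi_C (l + k)%N.
    split; first exact: of_class_CB.
    by apply: (compactly_supportedU _ kk kl') => x -> ->; rewrite subrr.
  apply: integrable_realD => //.
    by apply: integrable_realD => //; exact: integrable_potential.
  by apply: integrable_realZ => //; exact: integrable_sqrB.
- by move=> l x _; rewrite mulr_ge0 ?sqr_ge0// (le_trans _ (M_ge1 x)).
- apply: measurable_funM => //; apply: measurable_funX.
  exact: measurable_funB.
- apply: filterS phi_ae => x hx Ox; apply: cvgMr; rewrite expr2.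
  under eq_fun do rewrite expr2.
  have c1 : phi k x - phi (l + k)%N x @[l --> \oo] --> phi k x - w x.
    apply: cvgB; first exact: cvg_cst.
    by rewrite (cvg_shiftn k (fun l => phi l x)); exact: hx.
  exact: cvgM.
- by move=> l; apply: weighted_difference; exact: leq_addl.
Qed.

Let err k x := M x * (phi k x - w x) ^+ 2 + \sum_i (g i x - partial_deriv i (phi k) x) ^+ 2.

Let ierr k : leb.-integrable O (EFin \o err k).
Proof.
apply: integrable_realD => //; first by have [] := weighted_limit k.
exact: integrable_real_sum.
Qed.

Let err_ge0 k x : 0 <= err k x.
Proof.
apply: addr_ge0; last by apply: sumr_ge0 => i _; exact: sqr_ge0.
by rewrite mulr_ge0 ?sqr_ge0// (le_trans _ (M_ge1 x)).
Qed.

Lemma energy_domination : exists S : 'rV[R]_n -> R,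
  leb.-integrable O (EFin \o S) /\
  {ae leb, forall x, O x -> 0 <= S x /\ forall k, err k x <= S x / 2 ^+ k}.
Proof.
apply: (geometric_domination (C := C2 + 1) mO ierr) => // k.
rewrite /err RintegralD//; last 2 first.
- by have [] := weighted_limit k.
- exact: integrable_real_sum.
rewrite mulrDl; apply: lerD; first by have [] := weighted_limit k.
apply: le_trans (phi_cv k); apply: le_Rintegral => //.
  exact: integrable_real_sum.
by move=> x _; rewrite /h lerDr sqr_ge0.
Qed.

Let iMw : leb.-integrable O (EFin \o (fun x => M x * w x ^+ 2)).
Proof.
have [i0 _] := weighted_limit 0.
have iM0 : leb.-integrable O (EFin \o (fun x => M x * phi 0 x ^+ 2)).
  rewrite (_ : (fun x => _) = fun x => A x * phi 0 x ^+ 2 + B x * phi 0 x ^+ 2 +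
      (4 * C0 + 1) * phi 0 x ^+ 2); last by apply/funext => x; rewrite /M; ring.
  apply: integrable_realD => //; last exact: integrable_realZ.
  by apply: integrable_realD => //; exact: integrable_potential.
have is2 := integrable_realZ mO 2 (integrable_realD mO iM0 i0).
apply: (integrable_dominated mO _ is2).
  by apply: measurable_funM => //; exact: measurable_funX.
apply: aeW => x _; have M0 : 0 <= M x by rewrite (le_trans _ (M_ge1 x)).
rewrite ger0_norm; last by rewrite mulr_ge0 ?sqr_ge0.
rewrite -mulrDr [leRHS]mulrCA; apply: ler_wpM2l => //.
by have := diff_sqr_le (phi 0 x) 0 (w x); rewrite sub0r sqrrN subr0.
Qed.

Let p k := smooth_pos k.+1%:R^-1 \o phi k.

Let del_gt0 k : 0 < (k.+1%:R^-1 : R). Proof. by rewrite invr_gt0. Qed.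

Let p_Coo k : Coo_c O (p k). Proof. exact: smooth_pos_Coo_c. Qed.

Let p_C k : Ck_c 1 O (p k). Proof. exact/Coo_c_Ck_c/p_Coo. Qed.

Let mp k : measurable_fun O (p k).
Proof.
apply: measurable_funTS; apply: continuous_measurable_rv.
by have [h1 _] := p_C k; exact: of_class_C_continuous h1.
Qed.

(** The price of testing the equation, which involves g, with a function whose
    gradient is built from that of phi k. *)
Let defect k x := \sum_i `|partial_deriv i (phi k) x| *
  `|partial_deriv i (phi k) x - g i x|.

Let F k x := d x * p k x - A x * p k x ^+ 2 + defect k x.

Let wp x := Num.max 0 (w x).

Let mwp : measurable_fun O wp. Proof. exact: measurable_maxr. Qed.

Let abs_mul_le (a b : R) : a * b <= a ^+ 2 + b ^+ 2.
Proof. by have := sqr_ge0 (a - b); have := sqr_ge0 a; have := sqr_ge0 b; nra. Qed.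

Let defect_term_le (a b : R) : `|a| * `|a - b| <= 2 * b ^+ 2 + 3 * (b - a) ^+ 2.
Proof.
apply: le_trans (abs_mul_le _ _) _; rewrite !real_normK ?num_real//.
rewrite -subr_ge0 (_ : _ - _ = (a - 2 * b) ^+ 2); last by ring.
exact: sqr_ge0.
Qed.

(** The errors at a fixed point decay geometrically with constant S, by
    [energy_domination]. *)
Section pointwise.
Variables (S : R) (x : 'rV[R]_n).
Hypotheses (S0 : 0 <= S) (hS : forall k, err k x <= S / 2 ^+ k).
Hypothesis dMx : `|d x| <= M x * `|w x|.

Let M0 : 0 <= M x. Proof. exact: le_trans (M_ge1 x). Qed.

Let hS1 k : err k x <= S.
Proof.
apply: le_trans (hS k) _.
by rewrite ler_pdivrMr ?exprn_gt0// ler_peMr// exprn_ege1 ?ler1n.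
Qed.

Let hMp k : M x * (phi k x - w x) ^+ 2 <= S.
Proof.
apply: le_trans (hS1 k); rewrite /err lerDl.
by apply: sumr_ge0 => i _; exact: sqr_ge0.
Qed.

Let hgrad k : \sum_i (g i x - partial_deriv i (phi k) x) ^+ 2 <= S.
Proof. by apply: le_trans (hS1 k); rewrite /err lerDr mulr_ge0 ?sqr_ge0. Qed.

Let pl k : `|p k x| <= `|phi k x|. Proof. exact: smooth_pos_le. Qed.

Let Mphi_le k : M x * phi k x ^+ 2 <= 2 * (M x * w x ^+ 2) + 2 * S.
Proof.
apply: (@le_trans _ _ (M x * (2 * (w x ^+ 2 + (w x - phi k x) ^+ 2)))).
  apply: ler_wpM2l => //.
  by have := diff_sqr_le (w x) 0 (phi k x); rewrite sub0r sqrrN subr0.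
have := hMp k; rewrite -sqrrN opprB; set u := (w x - phi k x) ^+ 2; move: (w x ^+ 2) => z.
by move=> uS; rewrite [leLHS]mulrCA !mulrDr lerD2l ler_pM2l.
Qed.

(** The dominating function for F: it does not depend on k and is integrable. *)
Lemma p_energy_bound k : `|F k x| <=
  5 * (M x * w x ^+ 2) + 2 * (\sum_i g i x ^+ 2) + 7 * S.
Proof.
have b1 : `|d x * p k x| <= M x * w x ^+ 2 + M x * phi k x ^+ 2.
  rewrite normrM; apply: (@le_trans _ _ (M x * `|w x| * `|phi k x|)).
    by apply: ler_pM.
  rewrite -mulrA -mulrDr; apply: ler_wpM2l => //.
  by apply: le_trans (abs_mul_le _ _) _; rewrite !real_normK ?num_real.
have b2 : `|A x * p k x ^+ 2| <= M x * phi k x ^+ 2.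
  rewrite normrM; apply: ler_pM => //; rewrite ger0_norm ?sqr_ge0//.
  rewrite -[leLHS]real_normK ?num_real// -[leRHS]real_normK ?num_real//.
  by apply: lerXn2r; rewrite ?nnegrE.
have b3 : `|defect k x| <= 2 * (\sum_i g i x ^+ 2) + 3 * S.
  rewrite ger0_norm; last by apply: sumr_ge0 => i _; rewrite mulr_ge0.
  apply: (@le_trans _ _ (\sum_i (2 * g i x ^+ 2 + 3 * (g i x - partial_deriv i (phi k) x) ^+ 2))).
    by apply: ler_sum => i _; exact: defect_term_le.
  by rewrite big_split -!mulr_sumr lerD2l ler_pM2l.
have b4 := Mphi_le k.
move: b1 b2 b3 b4; rewrite /F.
move: (d x * p k x) (A x * p k x ^+ 2) (defect k x) (M x * w x ^+ 2)
  (M x * phi k x ^+ 2) (\sum_i g i x ^+ 2) => a1 a2 a3 a4 a5 a6 b1 b2 b3 b4.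
apply: le_trans (ler_normD _ _) _; have := ler_normB a1 a2.
move: S b1 b2 b3 b4 => S'; move: `|a1| `|a2| `|a3| `|a1 - a2| => *; lra.
Qed.

Let phi_pt : phi ^~ x @ \oo --> w x.
Proof.
apply: (@geometric_sqr_cvg R _ _ S) => k; apply: le_trans (hS k); rewrite /err.
apply: ler_wpDr; first by apply: sumr_ge0 => i _; exact: sqr_ge0.
by rewrite ler_peMl ?sqr_ge0.
Qed.

Let dphi_pt i : (fun k => partial_deriv i (phi k) x) @ \oo --> g i x.
Proof.
apply: (@geometric_sqr_cvg R _ _ S) => k; apply: le_trans (hS k); rewrite /err.
apply: ler_wpDl; first by rewrite mulr_ge0 ?sqr_ge0.
rewrite -sqrrN opprB (bigD1 i)//= lerDl; apply: sumr_ge0 => j _; exact: sqr_ge0.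
Qed.

Lemma p_cvg : p ^~ x @ \oo --> wp x.
Proof.
have c1 : Num.max 0 (phi k x) @[k --> \oo] --> wp x.
  by apply: (continuous_cvg _ _ phi_pt); apply: continuous_max; [exact: cvg_cst|exact: cvg_id].
have c2 : p k x - Num.max 0 (phi k x) @[k --> \oo] --> 0.
  apply: (@squeeze_cvgr _ _ _ _ (fun k => - k.+1%:R^-1) (fun k => k.+1%:R^-1)).
  - apply: nearW => k; rewrite -ler_norml; exact: smooth_pos_dist.
  - by rewrite -oppr0; apply: cvgN; exact: cvg_harmonic.
  - exact: cvg_harmonic.
rewrite -[wp x]add0r; apply: (@cvg_trans _
  ((fun k => (p k x - Num.max 0 (phi k x)) + Num.max 0 (phi k x)) @ \oo)).
  by apply: near_eq_cvg; apply: nearW => k; rewrite subrK.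
exact: cvgD.
Qed.

Lemma F_cvg : F ^~ x @ \oo --> d x * wp x - A x * wp x ^+ 2.
Proof.
rewrite -[X in _ --> X]addr0; apply: cvgD.
  apply: cvgB; first by apply: cvgMr; exact: p_cvg.
  by apply: cvgMr; rewrite expr2; under eq_fun do rewrite expr2; apply: cvgM; exact: p_cvg.
rewrite [X in _ --> X](_ : 0 = \sum_i `|g i x| * `|g i x - g i x|); last first.
  by rewrite big1// => i _; rewrite subrr normr0 mulr0.
apply: cvg_finite_sum => i; apply: cvgM; apply: cvg_norm => //.
by apply: cvgB => //; exact: cvg_cst.
Qed.

End pointwise.

Let mF k : measurable_fun O (F k).
Proof.
apply: measurable_funD.
  apply: measurable_funB; apply: measurable_funM => //; exact: measurable_funX.
apply: measurable_sum => i; apply: measurable_funM; apply: measurableT_comp => //.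
exact: measurable_funB.
Qed.

Let idefect k : leb.-integrable O (EFin \o defect k).
Proof.
apply: integrable_real_sum => // i; apply: integrable_sqrM => //.
- exact: measurableT_comp.
- by apply: measurableT_comp => //; exact: measurable_funB.
- by under eq_fun do rewrite real_normK ?num_real//.
- under eq_fun do rewrite real_normK ?num_real//.
  exact: integrable_sqrB.
Qed.

Let iAp k : leb.-integrable O (EFin \o (fun x => A x * p k x ^+ 2)).
Proof. exact: integrable_potential. Qed.

Let igp k : leb.-integrable O (EFin \o (fun x => \sum_i g i x * partial_deriv i (p k) x)).
Proof.
apply: integrable_real_sum => // i; apply: integrable_sqrM => //.
  apply: measurable_funTS; apply: continuous_measurable_rv.
  by have [[_ h1] _] := p_C k; exact: (h1 i).2.1.
exact: Ck_c_partial_integrable.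
Qed.

(** The chain rule gives grad p = t grad phi with 0 <= t <= 1, and t^2 <= t. *)
Let grad_p_le k x : grad_sq (p k) x <=
  \sum_i g i x * partial_deriv i (p k) x + defect k x.
Proof.
rewrite /grad_sq /defect -big_split; apply: ler_sum => i _ /=.
have [kC _] := phi_C k; rewrite partial_deriv_smooth_pos//.
have /andP[t0 t1] := smooth_pos'_bounds (phi k x) (del_gt0 k).
move: (smooth_pos' _ _) (partial_deriv i (phi k) x) (g i x) t0 t1 => t a b t0 t1.
apply: (@le_trans _ _ (b * (t * a) + t * (a * (a - b)))).
  rewrite -subr_ge0 (_ : _ - _ = t * (1 - t) * a ^+ 2); last by ring.
  by apply: mulr_ge0; [rewrite mulr_ge0 ?subr_ge0|exact: sqr_ge0].
rewrite lerD2l; apply: (@le_trans _ _ (t * (`|a| * `|a - b|))).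
  by apply: ler_wpM2l => //; rewrite -normrM ler_norm.
by rewrite ler_piMl.
Qed.

Let F_limit x := d x * wp x - A x * wp x ^+ 2.

Let F_integral_cvg :
  \int[leb]_(x in O) F k x @[k --> \oo] --> \int[leb]_(x in O) F_limit x.
Proof.
have [S [iS hS]] := energy_domination.
apply: (Rintegral_dominated_cvg mO (g := fun x => 5 * (M x * w x ^+ 2) +
  2 * (\sum_i g i x ^+ 2) + 7 * S x)) => //.
- apply: measurable_funB; apply: measurable_funM => //; exact: measurable_funX.
- apply: integrable_realD => //; last exact: integrable_realZ.
  apply: integrable_realD => //; first exact: integrable_realZ.
  by apply: integrable_realZ => //; exact: integrable_real_sum.
- by apply: filterS hS => x /[apply] -[_ h3]; exact: (F_cvg h3).
- apply: filterS2 hS dM => x h1 h2 Ox k; have [S0 h3] := h1 Ox.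
  exact: (p_energy_bound S0 h3 (h2 Ox) k).
Qed.

(** Convexity enters here: f(u) - f(v) <= f'(u) w makes the integrand nonpositive. *)
Let F_limit_le0 : \int[leb]_(x in O) F_limit x <= 0.
Proof.
have iFl : leb.-integrable O (EFin \o F_limit).
  have [S [iS hS]] := energy_domination.
  have mFl : measurable_fun O F_limit.
    by apply: measurable_funB; apply: measurable_funM => //; exact: measurable_funX.
  have i1 : leb.-integrable O (EFin \o (fun x => 2 * (M x * w x ^+ 2))) by exact: integrable_realZ.
  apply: (integrable_dominated mO mFl i1); apply: filterS dM => x /[apply] hd.
  have M0 : 0 <= M x by rewrite (le_trans _ (M_ge1 x)).
  have wl : `|wp x| <= `|w x|.
    rewrite /wp; case: (lerP 0 (w x)) => w0 //; first by rewrite normr0.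
  apply: le_trans (ler_normB _ _) _; rewrite mulr_natl mulr2n; apply: lerD.
    rewrite normrM -[w x ^+ 2]real_normK ?num_real// expr2 mulrA.
    by apply: ler_pM.
  rewrite normrM; apply: ler_pM => //.
  rewrite ger0_norm ?sqr_ge0// -[leLHS]real_normK ?num_real// -[leRHS]real_normK ?num_real//.
  by apply: lerXn2r; rewrite ?nnegrE.
apply: (@le_trans _ _ (\int[leb]_(x in O) (fun=> 0 : R) x)); last first.
  by rewrite Rintegral_cst// mul0r.
apply: le_Rintegral_ae => //; first exact: integrable_real0.
apply: filterS dA => x /[apply] hd; rewrite /F_limit /wp.
case: (lerP 0 (w x)) => w0; last by rewrite expr0n/= !mulr0 subrr.
have [w1|w1] := ltP 0 (w x).
  by rewrite subr_le0 expr2 mulrA ler_wpM2r// hd.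
have -> : w x = 0 by apply/eqP; rewrite eq_le w1 w0.
by rewrite expr0n/= !mulr0 subrr.
Qed.

(** The equation tested with p k gives Q(p k) <= int F k, and by dominated
    convergence int F k tends to the integral of d w^+ - A (w^+)^2, which is
    nonpositive. Taking b k to be the positive part of int F k makes it converge
    to 0 without knowing the sign of int F k. *)
Theorem positive_part_energy : exists (q : nat -> 'rV[R]_n -> R) (b : nat -> R),
  [/\ forall k, Ck_c 1 O (q k),
      forall k, \int[leb]_(x in O) grad_sq (q k) x -
        \int[leb]_(x in O) (A x * q k x ^+ 2) <= b k,
      forall k, 0 <= b k, b @ \oo --> 0 &
      {ae leb, forall x, O x -> q ^~ x @ \oo --> Num.max 0 (w x)}].
Proof.
have [S [iS hS]] := energy_domination.
exists p, (fun k => Num.max 0 (\int[leb]_(x in O) F k x)); split=> [//|k|k||].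
- rewrite le_max; apply/orP; right.
  have idp : leb.-integrable O (EFin \o (fun x => d x * p k x)).
    rewrite (_ : (fun x => _) = fun x => F k x + A x * p k x ^+ 2 - defect k x); last first.
      by apply/funext => x; rewrite /F; ring.
    apply: integrable_realB => //; apply: integrable_realD => //.
    have is5 : leb.-integrable O (EFin \o (fun x => 5 * (M x * w x ^+ 2) +
        2 * (\sum_i g i x ^+ 2) + 7 * S x)).
      apply: integrable_realD => //; last exact: integrable_realZ.
      apply: integrable_realD => //; first exact: integrable_realZ.
      by apply: integrable_realZ => //; exact: integrable_real_sum.
    apply: (integrable_dominated mO (mF k) is5).
    apply: filterS2 hS dM => x h1 h2 Ox; have [S0 h3] := h1 Ox.
    exact: (p_energy_bound S0 h3 (h2 Ox) k).
  rewrite /F RintegralD//; last exact: integrable_realB.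
  rewrite RintegralB// -weak_eq// addrAC lerB// -RintegralD//.
  apply: le_Rintegral => //; first exact: integrable_grad_sq.
  exact: integrable_realD.
- by rewrite le_max lexx.
- rewrite -[X in _ --> X](_ : Num.max 0 (\int[leb]_(x in O) F_limit x) = 0); last first.
    by apply/max_idPl; exact: F_limit_le0.
  apply: (continuous_cvg _ _ F_integral_cvg).
  by apply: continuous_max; [exact: cvg_cst|exact: cvg_id].
- by apply: filterS hS => x /[apply] -[_ h3]; exact: (p_cvg h3).
Qed.

End energy.

(** * A cutoff function equal to 1 on a ball *)

Section cutoff.
Context {R : realType} {n : nat}.

(** The simplest C^1 function vanishing on a half-line and positive on the other.
    Stability is tested with functions of class C^1, so nothing smoother is needed
    to build cutoffs. *)
Definition pos_sq (t : R) : R := Num.max 0 t ^+ 2.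

Lemma pos_sq_taylor (t h : R) :
  `|pos_sq (h + t) - pos_sq t - 2 * Num.max 0 t * h| <= h ^+ 2.
Proof.
rewrite /pos_sq ler_norml; case: (lerP 0 t) => t0; case: (lerP 0 (h + t)) => ht0;
  apply/andP; split; nra.
Qed.

Lemma is_derive_pos_sq (t : R) : is_derive t (1 : R) pos_sq (2 * Num.max 0 t).
Proof.
apply: cvg_is_derive; apply/cvgrPdist_le => e e0.
have hc : (h : R) @[h --> 0^'] --> (0 : R) by exact: nbhs_dnbhs.
have /cvgr0Pnorm_le/(_ e e0) hle := hc; near=> h.
have h0 : h != 0 by near: h; exact: nbhs_dnbhs_neq.
have -> : 2 * Num.max 0 t - h^-1 * (pos_sq (h *: 1 + t) - pos_sq t) =
    - (h^-1 * (pos_sq (h + t) - pos_sq t - 2 * Num.max 0 t * h)).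
  by rewrite [h *: 1]mulr1; field.
rewrite normrN normrM normfV ler_pdivrMl ?normr_gt0//.
apply: le_trans (pos_sq_taylor _ _) _.
rewrite -real_normK ?num_real// expr2 ler_wpM2l//.
Unshelve. all: by end_near. Qed.

Lemma of_class_C1_pos_sq (f : 'rV[R]_n -> R) : of_class_C 1 f ->
  of_class_C 1 (fun x => pos_sq (f x)).
Proof.
move=> fC; have cf := of_class_C_continuous fC.
have cmax : continuous (fun x => Num.max 0 (f x)).
  have cm : continuous (fun t : R => Num.max 0 t).
    by move=> t; apply: continuous_max; [exact: cvg_cst|exact: cvg_id].
  by move=> x; exact: (@continuous_comp _ _ _ f (fun t : R => Num.max 0 t) x (cf x) (cm _)).
apply: (@of_class_CS _ _ 0 _ (fun i x => 2 * Num.max 0 (f x) * partial_deriv i f x)).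
- by move=> x; exact (cvgM (cmax x) (cmax x)).
- move=> i x; exact (is_derive_chain (is_derive_pos_sq (f x)) (of_class_C_is_derive x i fC)).
- move=> i; apply: of_class_CM; last exact: (fC.2 i).2.
  by apply: of_class_CZ; split.
Qed.

Lemma norm_le_of_sqr (a b : R) : 0 <= b -> a ^+ 2 <= b ^+ 2 -> `|a| <= b.
Proof.
move=> b0 ab; rewrite -(@ler_pXn2r _ 2) ?nnegrE//.
by rewrite real_normK ?num_real.
Qed.

(** With y the squared Euclidean distance to a, the inner [pos_sq] vanishes for
    y >= s, and the outer one vanishes as soon as y <= s / 2. The distance is
    Euclidean, to have smoothness, while balls are sup-norm balls: hence the factor
    n + 1 in the radius. *)
Lemma ball_cutoff (O : set 'rV[R]_n) (a : 'rV[R]_n) : open O -> O a ->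
  exists r : R, exists phi : 'rV[R]_n -> R,
    [/\ 0 < r, r <= 1, ball a (2 * r) `<=` O, Ck_c 1 O phi &
        forall x, ball a (2 * r) x -> phi x = 1 /\ forall i, partial_deriv i phi x = 0].
Proof.
move=> oO Oa; have /nbhs_ballP[r0 /= r0_gt0 r0O] : nbhs a O by exact: open_nbhs_nbhs.
have [s s0 sE] : exists2 s, 0 < s & s = (r0 / 2) ^+ 2.
  by exists ((r0 / 2) ^+ 2); rewrite // exprn_gt0// divr_gt0.
pose y (x : 'rV[R]_n) : R := \sum_i (x ord0 i - a ord0 i) ^+ 2.
have yC : of_class_C 1 y.
  apply: of_class_C_sum => i; under eq_fun do rewrite expr2.
  have h : of_class_C 1 (fun x : 'rV[R]_n => x ord0 i - a ord0 i).
    by apply: of_class_CB; [exact: of_class_C_coord|exact: of_class_C_cst].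
  exact: of_class_CM.
have yx (x : 'rV[R]_n) i : (x ord0 i - a ord0 i) ^+ 2 <= y x.
  by rewrite /y (bigD1 i)//= lerDl; apply: sumr_ge0 => j _; exact: sqr_ge0.
have ysub : [set x | y x <= s] `<=` O.
  move=> x /= yxs; apply: r0O; apply/rv_ballP => // i.
  have : (x ord0 i - a ord0 i) ^+ 2 <= (r0 / 2) ^+ 2 by rewrite -sE; exact: le_trans yxs.
  have r2 : 0 <= r0 / 2 by rewrite divr_ge0// ltW.
  move=> /(norm_le_of_sqr r2); rewrite distrC => h.
  apply: le_lt_trans h _; rewrite ltr_pdivrMr// mulr_natr mulr2n ltrDl//.
pose phi x := 1 - pos_sq (1 - 4 / s ^+ 2 * pos_sq (s - y x)).
have phiC : of_class_C 1 phi.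
  apply: of_class_CB; first exact: of_class_C_cst.
  apply: of_class_C1_pos_sq; apply: of_class_CB; first exact: of_class_C_cst.
  apply: of_class_CZ; apply: of_class_C1_pos_sq.
  by apply: of_class_CB; first exact: of_class_C_cst.
have phi1 x : y x <= s / 2 -> phi x = 1.
  move=> yxs; rewrite /phi {1}/pos_sq max_l ?expr0n ?subr0//.
  have s2 : 0 < s ^+ 2 by rewrite exprn_gt0.
  have ps : pos_sq (s - y x) = (s - y x) ^+ 2 by rewrite /pos_sq max_r//; lra.
  rewrite subr_le0 ps mulrAC (ler_pdivlMr _ _ s2) mul1r.
  rewrite -subr_ge0 (_ : _ - _ = (s - 2 * y x) * (3 * s - 2 * y x)); last by ring.
  by apply: mulr_ge0; lra.
have phi0 x : s < y x -> phi x = 0.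
  move=> yxs; rewrite /phi [pos_sq (s - _)]/pos_sq max_l ?expr0n/= ?mulr0 ?subr0; last first.
    by rewrite subr_le0 ltW.
  by rewrite /pos_sq max_r// expr1n subrr.
have sup : closure [set x | phi x != 0] `<=` [set x | y x <= s].
  apply: closure_sub_closed.
    by move=> x /= px; rewrite leNgt; apply: contraNN px => /phi0 ->.
  rewrite (_ : [set x | _] = y @^-1` [set t | t <= s])//.
  apply: closed_comp => [x _|]; first exact: of_class_C_continuous yC _.
  exact: closed_le.
have kphi : compactly_supported_in O phi.
  split; last exact: subset_trans sup ysub.
  apply: bounded_closed_compact; last exact: closed_closure.
  exists (`|a| + r0); split; first exact: num_real.
  move=> m hm x /sup /= yxs.
  apply: le_trans (ltW hm).
  have : ball a r0 x.
    apply/rv_ballP => // i.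
    have : (x ord0 i - a ord0 i) ^+ 2 <= (r0 / 2) ^+ 2 by rewrite -sE; exact: le_trans yxs.
    have r2 : 0 <= r0 / 2 by rewrite divr_ge0// ltW.
    move=> /(norm_le_of_sqr r2); rewrite distrC => h.
    apply: le_lt_trans h _; rewrite ltr_pdivrMr// mulr_natr mulr2n ltrDl//.
  rewrite mx_norm_ball /ball_ /= => h; rewrite -(subrK a x).
  by apply: le_trans (ler_normD _ _) _; rewrite addrC lerD2l distrC ltW.
pose r := Num.min 1 (s / (8 * n.+1%:R)).
have r_gt0 : 0 < r by rewrite lt_min ltr01 divr_gt0// mulr_gt0.
have r1 : r <= 1 by rewrite ge_min lexx.
have rs : r <= s / (8 * n.+1%:R) by rewrite ge_min lexx orbT.
have r2_gt0 : 0 < 2 * r by rewrite mulr_gt0.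
have yball x : ball a (2 * r) x -> y x < s / 2.
  move=> /(rv_ballP _ _ r2_gt0) hx.
  apply: (@le_lt_trans _ _ (\sum_(i < n) 4 * r)).
    apply: ler_sum => i _; have := ltW (hx i); rewrite distrC => hi.
    apply: (@le_trans _ _ ((2 * r) ^+ 2)); last by rewrite exprMn; nra.
    rewrite -[leLHS]real_normK ?num_real//; apply: lerXn2r; rewrite ?nnegrE//.
    exact: ltW.
  rewrite sumr_const card_ord -[X in X < _]mulr_natr.
  apply: (@le_lt_trans _ _ (4 * (s / (8 * n.+1%:R)) * n%:R)).
    by rewrite ler_wpM2r// ler_pM2l.
  rewrite (_ : _ * _ = s / 2 * (n%:R / n.+1%:R)); last first.
    have : (n.+1%:R : R) != 0 by rewrite pnatr_eq0.
    by move: (n.+1%:R : R) => m m0; field.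
  by rewrite gtr_pMr ?divr_gt0// ltr_pdivrMr// mul1r ltr_nat.
exists r, phi; split=> //.
  by move=> x /yball yx2; apply: ysub => /=; lra.
move=> x xB; split; first by apply/phi1/ltW/yball.
move=> i; rewrite /partial_deriv (@near_eq_derive _ _ _ phi (cst 1)) ?derive_cst//.
have : nbhs x (ball a (2 * r)) by apply: open_nbhs_nbhs; split=> //; exact: ball_open.
by apply: filterS => z /yball/ltW/phi1.
Qed.

End cutoff.

(** * Oscillation of logarithms under translations *)

Lemma increment_le_integral (R : realType) (F f G : R -> R) :
  (forall t : R, is_derive t (1 : R) F (f t)) -> continuous f -> continuous G ->
  (forall t, `|f t| <= G t) ->
  (`|F 1 - F 0|%:E <= \int[lebesgue_measure]_(t in `[0%R, 1%R]) (G t)%:E)%E.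
Proof.
move=> dF cf cG fG.
have cF : continuous F by apply: derivable_line_continuous => t; case: (dF t).
rewrite -abse_EFin.
have <- : (\int[lebesgue_measure]_(t in `[0%R, 1%R]) (f t)%:E = (F 1 - F 0)%:E)%E.
  rewrite EFinB; apply: continuous_FTC2 => //.
  - exact: continuous_subspaceT.
  - split=> [t _||]; first by case: (dF t).
    + exact/cvg_at_right_filter/cF.
    + exact/cvg_at_left_filter/cF.
  - by move=> t _; rewrite derive1E; case: (dF t).
have mf : measurable_fun setT f by exact: continuous_measurable_fun.
have mG : measurable_fun setT G by exact: continuous_measurable_fun.
apply: le_trans (le_abse_integral _ _ _) _ => //.
  by apply/measurable_EFinP; exact: measurable_funTS.
apply: ge0_le_integral => //.
- by apply/measurable_EFinP; apply: measurableT_comp => //; exact: measurable_funTS.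
- by apply/measurable_EFinP; exact: measurable_funTS.
- by move=> t _; rewrite abse_EFin lee_fin.
Qed.

Section log_increment.
Context {R : realType} {n : nat}.
Local Notation leb := (@lebesgue_rv R n).
Variables (q : 'rV[R]_n -> R) (e : R).
Hypotheses (qC : of_class_C 1 q) (e0 : 0 < e).

Let arg_gt0 x : 0 < q x ^+ 2 + e ^+ 2.
Proof. by rewrite ltr_wpDl ?sqr_ge0 ?exprn_gt0. Qed.

Definition log_sq (x : 'rV[R]_n) : R := ln (q x ^+ 2 + e ^+ 2).

(** A common bound for the derivatives of [log_sq] in all directions of sup-norm
    at most 1: a directional derivative is a sum of terms 2 q a / (q^2 + e^2) with a
    a partial derivative of q, and each is at most 1 + a^2 / (q^2 + e^2). *)
Definition log_slope (x : 'rV[R]_n) : R :=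
  n%:R + grad_sq q x / (q x ^+ 2 + e ^+ 2).

Let inv_continuous : continuous (fun x => (q x ^+ 2 + e ^+ 2)^-1).
Proof.
have aC : of_class_C 1 (fun x => q x * q x + e ^+ 2).
  by apply: of_class_CD; [exact: of_class_CM|exact: of_class_C_cst].
move=> x; have a0 : q x * q x + e ^+ 2 != 0 by rewrite gt_eqF// -expr2.
have ca := of_class_C_continuous aC; exact (cvgV a0 (ca x)).
Qed.

Lemma measurable_log_sq : measurable_fun setT log_sq.
Proof.
apply: (measurableT_comp (@measurable_ln R)); apply: continuous_measurable_rv => x.
have aC : of_class_C 1 (fun x => q x * q x + e ^+ 2).
  by apply: of_class_CD; [exact: of_class_CM|exact: of_class_C_cst].
by have ca := of_class_C_continuous aC; exact (ca x).
Qed.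

Lemma log_slope_continuous : continuous log_slope.
Proof.
suff: of_class_C 0 log_slope by case.
apply: of_class_CD; first exact: of_class_C_cst.
apply: of_class_CM; last by split=> //; exact: inv_continuous.
apply: of_class_C_sum => i; under eq_fun do rewrite expr2.
by apply: of_class_CM; exact: (qC.2 i).2.
Qed.

Lemma log_slope_ge0 x : 0 <= log_slope x.
Proof. by rewrite addr_ge0// divr_ge0 ?grad_sq_ge0// ltW. Qed.

Let log_deriv (h x : 'rV[R]_n) : R :=
  2 * q x / (q x ^+ 2 + e ^+ 2) * \sum_i h ord0 i * partial_deriv i q x.

Let log_sq_derive (h x : 'rV[R]_n) : is_derive x h log_sq (log_deriv h x).
Proof.
have dq := derive_C1 h x qC.
have dqq := @is_deriveM _ _ q q x h _ _ dq dq.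
have da := @is_deriveD _ _ _ _ _ x h _ _ dqq (is_derive_cst (e ^+ 2) x h).
have E1 : q * q + cst (e ^+ 2) = (fun x => q x ^+ 2 + e ^+ 2).
  by apply/funext => y; rewrite expr2.
rewrite E1 in da.
have dl := @is_derive_chain _ _ (@ln R) (fun x => q x ^+ 2 + e ^+ 2) _ _ _ _
  (is_derive1_ln (arg_gt0 x)) da.
have [dl1 dl2] := dl; apply: DeriveDef; first exact: dl1.
rewrite (dl2 : 'D_h log_sq x = _).
have sc (a b : R) : a *: b = a * b by [].
rewrite addr0 !sc /log_deriv; move: (\sum_i _) => s; field.
by rewrite gt_eqF// -expr2.
Qed.

Let log_deriv_le (h x : 'rV[R]_n) : (forall i, `|h ord0 i| <= 1) ->
  `|log_deriv h x| <= log_slope x.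
Proof.
move=> h1; rewrite /log_deriv mulr_sumr; apply: le_trans (ler_norm_sum _ _ _) _.
have nE : (n%:R : R) = \sum_(i < n) 1 by rewrite sumr_const card_ord.
rewrite /log_slope /grad_sq mulr_suml nE -big_split/=.
apply: ler_sum => i _; set a := partial_deriv i q x; set b := q x.
have s0 := arg_gt0 x; rewrite -/b in s0.
rewrite mulrA !normrM (gtr0_norm (_ : 0 < (b ^+ 2 + e ^+ 2)^-1)) ?invr_gt0//.
rewrite (gtr0_norm (_ : 0 < 2))//.
apply: (@le_trans _ _ (2 * `|b| * `|a| / (b ^+ 2 + e ^+ 2))).
  rewrite [leLHS](_ : _ = `|h ord0 i| * (2 * `|b| * `|a| / (b ^+ 2 + e ^+ 2))); last by ring.
  by rewrite ler_piMl// divr_ge0 ?mulr_ge0// ltW.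
rewrite [leRHS](_ : _ = (b ^+ 2 + e ^+ 2 + a ^+ 2) / (b ^+ 2 + e ^+ 2)); last first.
  by field; rewrite gt_eqF.
rewrite ler_pM2r ?invr_gt0//.
rewrite -[b ^+ 2]real_normK ?num_real// -[a ^+ 2]real_normK ?num_real//.
have := sqr_ge0 (`|b| - `|a|); have := sqr_ge0 e.
by move: (`|a|) (`|b|) => u v e2 uv; nra.
Qed.

Let log_deriv_continuous h : continuous (log_deriv h).
Proof.
suff: of_class_C 0 (log_deriv h) by case.
apply: of_class_CM.
  apply: of_class_CM; last by split=> //; exact: inv_continuous.
  by apply: of_class_CZ; exact: of_class_C_le qC.
apply: of_class_C_sum => i; apply: of_class_CZ; exact: (qC.2 i).2.
Qed.

Lemma log_increment_le (h x : 'rV[R]_n) : (forall i, `|h ord0 i| <= 1) ->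
  (`|log_sq (h + x) - log_sq x|%:E <=
   \int[lebesgue_measure]_(t in `[0%R, 1%R]) (log_slope (t *: h + x))%:E)%E.
Proof.
move=> h1.
have cl : continuous (fun t : R => t *: h + x).
  by move=> t; apply: cvgD; [apply: cvgZl|exact: cvg_cst].
have := @increment_le_integral R (fun t => log_sq (t *: h + x))
  (fun t => log_deriv h (t *: h + x)) (fun t => log_slope (t *: h + x)).
rewrite scale1r scale0r add0r; apply.
- by move=> t; apply/is_derive_lineP; exact: log_sq_derive.
- move=> t; apply: (@continuous_comp _ _ _ (fun t : R => t *: h + x) (log_deriv h)).
    exact: cl.
  exact: log_deriv_continuous.
- move=> t; apply: (@continuous_comp _ _ _ (fun t : R => t *: h + x) log_slope).
    exact: cl.
  exact: log_slope_continuous.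
- by move=> t; exact: log_deriv_le.
Qed.

End log_increment.

Section oscillation.
Context {R : realType} {n : nat}.
Local Notation leb := (@lebesgue_rv R n).

Lemma preserving_translation (h : 'rV[R]_n) :
  forall A, measurable A -> leb ((fun x => x + h) @^-1` A) = leb A.
Proof. by move=> A mA; exact: lebesgue_rv_translation. Qed.

Lemma ge0_integral_translation (h : 'rV[R]_n) (f : 'rV[R]_n -> \bar R) :
  measurable_fun setT f -> (\int[leb]_x f (x + h)%R = \int[leb]_x f x)%E.
Proof.
move=> mf; apply: (integral_preserving (measurable_rv_addr h) (preserving_translation h)) => //.
Qed.

(** The increment along h is at most the integral of the slope over the segment
    from x to x + h; after exchanging integrals, each point of the segment contributes
    a translate of the ball of radius r, contained in the ball of radius 2 r. *)
Lemma log_increment_integral (q : 'rV[R]_n -> R) (e r : R) (a h : 'rV[R]_n) :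
  of_class_C 1 q -> 0 < e -> 0 < r -> r <= 1 -> ball 0 r h ->
  (\int[leb]_(x in ball a r) `|log_sq q e (h + x)%R - log_sq q e x|%:E <=
   \int[leb]_(x in ball a (2 * r)) (log_slope q e x)%:E)%E.
Proof.
move=> qC e0 r0 r1 hr; set G := log_slope q e.
have hi i : `|h ord0 i| < r by move/(rv_ballP _ _ r0)/(_ i): hr; rewrite mxE sub0r normrN.
have mL := measurable_log_sq e qC.
have cG := log_slope_continuous qC e0; have G0 x : 0 <= G x by exact: log_slope_ge0.
have mG : measurable_fun setT G by exact: continuous_measurable_rv.
pose D := ball a (2 * r); have mD : measurable D by exact: measurable_rv_ball.
pose I01 : set R := `[0, 1]%classic; have mI : measurable I01 by exact: measurable_itv.
pose GD := (EFin \o G) \_ D.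
have mGD : measurable_fun setT GD.
  by apply/(measurable_restrictT _ mD)/measurable_funTS/measurable_EFinP.
have GD0 x : (0 <= GD x)%E by rewrite /GD patchE; case: ifP => // _; rewrite lee_fin.
pose K (p : 'rV[R]_n * measurableTypeR R) := (GD (p.1 + p.2 *: h)%R * (\1_I01 p.2)%:E)%E.
have mK : measurable_fun setT K.
  apply: emeasurable_funM.
    apply: (measurableT_comp mGD); apply: measurable_rvP => i.
    rewrite (_ : _ \o _ = fun p : 'rV[R]_n * measurableTypeR R =>
        (rv_coord i \o fst) p + p.2 * h ord0 i); last first.
      by apply/funext => p; rewrite /rv_coord /= !mxE.
    apply: measurable_funD.
      by apply: measurableT_comp; [exact: measurable_rv_coord|exact: measurable_fst].
    by apply: measurable_funM => //; exact: measurable_snd.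
  by apply/measurable_EFinP; apply: measurableT_comp => //; exact: measurable_snd.
have K0 p : (0 <= K p)%E by rewrite mule_ge0// lee_fin.
have ballD x t : ball a r x -> I01 t -> D (x + t *: h).
  rewrite /I01 /= in_itv/= => /(rv_ballP _ _ r0) hx /andP[t0 t1].
  apply/rv_ballP; first by rewrite mulr_gt0.
  move=> i; rewrite !mxE opprD addrA mulrDl mul1r.
  apply: le_lt_trans (ler_normB _ _) _; rewrite ltr_leD//.
  by rewrite normrM (ger0_norm t0) -[r]mul1r ler_pM// ltW.
apply: (@le_trans _ _ (\int[leb]_x \int[lebesgue_measure]_t K (x, t))%E).
  apply: (@le_trans _ _ (\int[leb]_(x in ball a r) \int[lebesgue_measure]_t K (x, t))%E).
    apply: ge0_le_integral => //.
    - exact: measurable_rv_ball.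
    - apply/measurable_EFinP; apply: measurableT_comp => //; apply: measurable_funTS.
      apply: measurable_funB => //.
      rewrite (_ : (fun x => _) = log_sq q e \o (fun x => x + h)); last first.
        by apply/funext => x; rewrite /= addrC.
      by apply: measurableT_comp => //; exact: measurable_rv_addr.
    - apply: measurable_funTS; exact: (measurable_fun_fubini_tonelli_F K).
    - move=> x xB; have := log_increment_le qC e0 x (fun i => le_trans (ltW (hi i)) r1).
      move=> /le_trans; apply; rewrite [leLHS]integral_mkcond.
      apply: ge0_le_integral => //.
      + by move=> t _; rewrite patchE; case: ifP => // _; rewrite lee_fin.
      + apply/(measurable_restrictT _ mI)/measurable_funTS/measurable_EFinP.
        apply: (@continuous_measurable_fun R (fun t => log_slope q e (t *: h + x))) => t.
        apply: (@continuous_comp _ _ _ (fun t : R => t *: h + x) (log_slope q e)).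
          by apply: cvgD; [apply: cvgZl|exact: cvg_cst].
        exact: cG.
      + exact: measurableT_comp (pair1_measurable x).
      + move=> t _; rewrite patchE /K /= indicE; case: ifPn => [tI|_]; last by rewrite mule0.
        rewrite mule1 /GD patchE mem_set ?[X in _ <= X]/=; last exact/ballD/set_mem.
        by rewrite addrC.
  apply: ge0_subset_integral => //.
  - exact: measurable_rv_ball.
  - exact: (measurable_fun_fubini_tonelli_F K).
  - by move=> x _; apply: integral_ge0.
rewrite (fubini_tonelli K)//.
have KE t : (\int[leb]_x K (x, t) = (\int[leb]_x GD x) * (\1_I01 t)%:E)%E.
  rewrite /K /= ge0_integralZr//; first by rewrite ge0_integral_translation.
    exact: measurableT_comp mGD (measurable_rv_addr (t *: h)).
rewrite (eq_integral _ _ (fun t _ => KE t)).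
rewrite ge0_integralZl//; last 2 first.
- by apply/measurable_EFinP.
- exact: integral_ge0.
have I1 : (\int[@lebesgue_measure R]_t (\1_I01 t)%:E = 1)%E.
  rewrite integral_indic//= setIT /I01 lebesgue_measure_itv/= lte_fin ltr01.
  by rewrite -EFinB subr0.
by rewrite I1 mule1 [leRHS]integral_mkcond.
Qed.

End oscillation.

(** * Sign dichotomy on connected domains *)

Lemma ln_distance_cvgy (R : realType) (u v : nat -> R) (l : R) :
  (forall k, 0 < u k) -> (forall k, 0 < v k) -> 0 < l ->
  u @ \oo --> 0 -> v @ \oo --> l ->
  (`|ln (v k) - ln (u k)|%:E)%E @[k --> \oo] --> +oo%E.
Proof.
move=> u0 v0 l0 ucv vcv; apply/cvgeryP/cvgryPge => a.
have l2 : 0 < l / 2 by rewrite divr_gt0.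
have ea : 0 < expR (ln (l / 2) - a) by exact: expR_gt0.
have uN : \forall k \near \oo, u k <= expR (ln (l / 2) - a).
  have /cvgr0Pnorm_le/(_ _ ea) := ucv; apply: filterS => k.
  by rewrite ger0_norm// ltW.
have vN : \forall k \near \oo, l / 2 <= v k.
  have /cvgrPdist_le/(_ _ l2) := vcv; apply: filterS => k.
  by rewrite ler_norml => /andP[_ h]; lra.
apply: filterS2 uN vN => k uk vk.
have h1 : ln (u k) <= ln (l / 2) - a.
  by rewrite -[leRHS]expRK ler_ln ?posrE.
have h2 : ln (l / 2) <= ln (v k) by rewrite ler_ln ?posrE.
by apply: le_trans (ler_norm _); lra.
Qed.

Lemma divide_energy (R : realFieldType) (e2 L X Y Q : R) :
  0 < e2 -> e2 * L <= X + Y -> Y = e2 * Q -> X <= e2 -> L <= 1 + Q.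
Proof.
move=> e0 h YQ Xe; rewrite -(ler_pM2l e0) mulrDr mulr1 -YQ.
by apply: le_trans h _; rewrite lerD2r.
Qed.

Section sign_dichotomy.
Context {R : realType} {n : nat}.
Local Notation leb := (@lebesgue_rv R n).
Variables (O : set 'rV[R]_n) (oO : open O) (w A : 'rV[R]_n -> R).
Variables (q : nat -> 'rV[R]_n -> R) (b : nat -> R).
Hypothesis mw : measurable_fun O w.
Hypothesis LA : L1_loc O A.
Hypothesis SA : stable_potential O A.
Hypothesis qC : forall k, Ck_c 1 O (q k).
Hypothesis q_energy : forall k, \int[leb]_(x in O) grad_sq (q k) x -
  \int[leb]_(x in O) (A x * q k x ^+ 2) <= b k.
Hypothesis b_ge0 : forall k, 0 <= b k.
Hypothesis b_cvg : b @ \oo --> 0.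
Hypothesis q_cvg : {ae leb, forall x, O x -> q ^~ x @ \oo --> Num.max 0 (w x)}.

Let mO : measurable O := measurable_rv_open oO.
Let Z := O `&` [set x | w x <= 0].
Let P := O `&` [set x | 0 < w x].

Let mZ : measurable Z. Proof. exact: measurable_nonpositive. Qed.

Let mP : measurable P. Proof. exact: measurable_positive. Qed.

(** The square of e k dominates b k, so that dividing the energy inequality by it
    leaves a bounded quantity; the term 1 / (k + 1) keeps e k positive. *)
Let e k : R := Num.sqrt (b k + k.+1%:R^-1).

Let arg_gt0 k : 0 < b k + k.+1%:R^-1.
Proof. by rewrite ltr_wpDl// invr_gt0. Qed.

Let e_gt0 k : 0 < e k. Proof. by rewrite sqrtr_gt0. Qed.

Let e_sq k : e k ^+ 2 = b k + k.+1%:R^-1.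
Proof. by rewrite sqr_sqrtr// ltW. Qed.

Let e_sq_cvg : e k ^+ 2 @[k --> \oo] --> 0.
Proof.
rewrite (_ : (fun k => _) = fun k => b k + k.+1%:R^-1); last first.
  by apply/funext => k; exact: e_sq.
by rewrite -[X in _ --> X]addr0; apply: cvgD => //; exact: cvg_harmonic.
Qed.

Section local.
Variables (a : 'rV[R]_n) (r : R) (phi : 'rV[R]_n -> R).
Hypotheses (r0 : 0 < r) (r1 : r <= 1) (rO : ball a (2 * r) `<=` O).
Hypothesis phiC : Ck_c 1 O phi.
Hypothesis phi1 : forall x, ball a (2 * r) x ->
  phi x = 1 /\ forall i, partial_deriv i phi x = 0.

Let Qphi := \int[leb]_(x in O) grad_sq phi x - \int[leb]_(x in O) (A x * phi x ^+ 2).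

Let partialZ c i x : partial_deriv i (fun x => c * phi x) x = c * partial_deriv i phi x.
Proof.
have [phiC1 _] := phiC.
by have [_ E] := @is_deriveZ _ _ _ phi c x _ _ (of_class_C_is_derive x i phiC1); exact: E.
Qed.

Let D := ball a (2 * r).

Let mD : measurable D. Proof. exact: measurable_rv_ball. Qed.

Let slope_bound k :
  (\int[leb]_(x in D) (log_slope (q k) (e k) x)%:E <=
   (n%:R * fine (leb D) + (1 + Qphi))%:E)%E.
Proof.
have [phiC1 kphi] := phiC; have [qkC kq] := qC k.
have cC : Ck_c 1 O (fun x => e k * phi x).
  by split; [exact: of_class_CZ|exact: compactly_supportedM].
have gradE x : grad_sq (fun x => e k * phi x) x = e k ^+ 2 * grad_sq phi x.
  by rewrite /grad_sq mulr_sumr; apply: eq_bigr => i _; rewrite partialZ exprMn.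
have main := stable_log_gradient oO LA SA (qC k) cC mD rO (e_gt0 k).
have /main {main} main : forall x, D x -> e k * phi x = e k /\
    forall i, partial_deriv i (fun x => e k * phi x) x = 0.
  move=> x Dx; have [p1 p2] := phi1 Dx; split; first by rewrite p1 mulr1.
  by move=> i; rewrite partialZ p2 mulr0.
have E2 : \int[leb]_(x in O) grad_sq (fun x => e k * phi x) x -
    \int[leb]_(x in O) (A x * (e k * phi x) ^+ 2) = e k ^+ 2 * Qphi.
  rewrite /Qphi mulrBr -!RintegralZl//; last 2 first.
  - exact: integrable_potential.
  - exact: integrable_grad_sq.
  congr (_ - _); apply: eq_Rintegral => x _ //.
  by rewrite exprMn mulrCA.
have il : leb.-integrable D (EFin \o (fun x => grad_sq (q k) x / (q k x ^+ 2 + e k ^+ 2))).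
  have igq := integrable_grad_sq oO (qC k).
  have igqD : leb.-integrable D (EFin \o grad_sq (q k)) by exact: integrableS igq.
  apply: (integrable_dominated mD _ (integrable_realZ mD (e k ^- 2) igqD)).
    have ms := continuous_measurable_rv (log_slope_continuous qkC (e_gt0 k)).
    rewrite (_ : (fun x => _) = fun x => log_slope (q k) (e k) x - n%:R); last first.
      by apply/funext => x; rewrite /log_slope (addrC n%:R) addrK.
    by apply: measurable_funB => //; exact: measurable_funTS.
  apply: aeW => x _; have s0 : 0 < q k x ^+ 2 + e k ^+ 2.
    by rewrite ltr_wpDl ?sqr_ge0 ?exprn_gt0.
  rewrite ger0_norm ?divr_ge0 ?grad_sq_ge0// ?(ltW s0)// mulrC.
  apply: ler_wpM2r; first exact: grad_sq_ge0.
  by rewrite lef_pV2 ?posrE ?exprn_gt0// lerDr sqr_ge0.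
have lD : \int[leb]_(x in D) (grad_sq (q k) x / (q k x ^+ 2 + e k ^+ 2)) <= 1 + Qphi.
  have e2 : 0 < e k ^+ 2 by rewrite exprn_gt0.
  have be : b k <= e k ^+ 2 by rewrite e_sq lerDl invr_ge0.
  exact: divide_energy e2 main E2 (le_trans (q_energy k) be).
have ic : leb.-integrable D (EFin \o (fun=> n%:R : R)).
  apply/integrableP; split; first exact: measurable_cst.
  rewrite integral_cst//= lte_mul_pinfty// lebesgue_rv_ball ?ltry//.
  by rewrite mulr_gt0.
rewrite EFin_Rintegral//; last exact: integrable_realD.
by rewrite lee_fin /log_slope RintegralD// Rintegral_cst// lerD2l.
Qed.

Let S h := [set x | ball a r x /\ Z x /\ P (x + h)].

Let mS h : measurable (S h).
Proof.
rewrite (_ : S h = ball a r `&` (Z `&` (fun x => x + h) @^-1` P))//.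
apply: measurableI; first exact: measurable_rv_ball.
apply: measurableI => //.
by rewrite -[X in measurable X]setTI; exact: measurable_rv_addr.
Qed.

(** Along h the increments of the logarithms are bounded in L^1 by [slope_bound],
    but where w changes from nonpositive to positive they tend to infinity: q k
    tends to 0 at x and to a positive limit at x + h. *)
Lemma sign_change_null (h : 'rV[R]_n) : ball 0 r h ->
  leb (S h) = 0%E.
Proof.
move=> hr; have mB : measurable (ball a r) by exact: measurable_rv_ball.
apply: (@bounded_integral_cvgy _ _ _ leb _ mB
  (fun k x => `|log_sq (q k) (e k) (h + x) - log_sq (q k) (e k) x|%:E) (S h)
  (n%:R * fine (leb D) + (1 + Qphi))) => //.
- by move=> x [].
- move=> k; have mL : measurable_fun setT (log_sq (q k) (e k)).
    by apply: measurable_log_sq; case: (qC k).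
  apply/measurable_EFinP; apply: measurableT_comp => //; apply: measurable_funTS.
  apply: measurable_funB => //.
  rewrite (_ : (fun x => _) = log_sq (q k) (e k) \o (fun x => x + h)); last first.
    by apply/funext => x; rewrite /= addrC.
  by apply: measurableT_comp => //; exact: measurable_rv_addr.
- by move=> k; apply: le_trans (slope_bound k); apply: log_increment_integral => //; case: (qC k).
- have q_cvg_h : {ae leb, forall x, O (x + h) -> q ^~ (x + h) @ \oo --> Num.max 0 (w (x + h))}.
    exact: (ae_preserving (measurable_rv_addr h) (preserving_translation h) q_cvg).
  apply: filterS2 q_cvg q_cvg_h => x c1 c2 [xB [[Ox wx] [Oxh wxh]]].
  have {}c1 := c1 Ox; have {}c2 := c2 Oxh; rewrite /= in wx wxh.
  rewrite (max_l wx) in c1; rewrite (max_r (ltW wxh)) in c2.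
  rewrite [h + x]addrC.
  apply: (@ln_distance_cvgy R (fun k => q k x ^+ 2 + e k ^+ 2)
    (fun k => q k (x + h) ^+ 2 + e k ^+ 2) (w (x + h) ^+ 2)).
  + by move=> k; rewrite ltr_wpDl ?sqr_ge0 ?exprn_gt0.
  + by move=> k; rewrite ltr_wpDl ?sqr_ge0 ?exprn_gt0.
  + by rewrite exprn_gt0.
  + rewrite -[X in _ --> X]addr0; apply: cvgD => //.
    by rewrite -[X in _ --> X](mulr0 0); under eq_fun do rewrite expr2; exact: cvgM.
  + rewrite -[X in _ --> X]addr0; apply: cvgD => //.
    by rewrite expr2; under eq_fun do rewrite expr2; exact: cvgM.
Qed.

(** Integrating [sign_change_null] over h and exchanging integrals gives the
    product of the measures of the two sets. The radius r / 2 makes every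
    difference of two points of the ball an admissible translation. *)
Lemma local_sign_dichotomy :
  leb (Z `&` ball a (r / 2)) = 0%E \/ leb (P `&` ball a (r / 2)) = 0%E.
Proof.
pose B := ball a (r / 2); have mB : measurable B by exact: measurable_rv_ball.
pose ZB := Z `&` B; pose PB := P `&` B.
have mZB : measurable ZB by exact: measurableI.
have mPB : measurable PB by exact: measurableI.
pose E := [set p : 'rV[R]_n * 'rV[R]_n | ZB p.1 /\ PB (p.1 + p.2)].
have mE : measurable E.
  rewrite (_ : E = (fst @^-1` ZB) `&` ((fun p => p.1 + p.2) @^-1` PB))//.
  apply: measurableI; rewrite -[X in measurable X]setTI.
    exact: measurable_fst.
  suff madd : measurable_fun setT (fun p : 'rV[R]_n * 'rV[R]_n => p.1 + p.2) by exact: madd.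
  apply: measurable_rvP => i; rewrite (_ : _ \o _ = fun p =>
      (rv_coord i \o fst) p + (rv_coord i \o snd) p); last first.
    by apply/funext => p; rewrite /rv_coord /= !mxE.
  by apply: measurable_funD; apply: measurableT_comp => //; exact: measurable_rv_coord.
have E1 : (\int[leb]_x leb (xsection E x) = leb ZB * leb PB)%E.
  rewrite (eq_integral (fun x => (\1_ZB x)%:E * leb PB)%E); last first.
    move=> x _; rewrite indicE; have [/set_mem Zx|/negP Zx] := boolP (x \in ZB).
      rewrite mul1e -(lebesgue_rv_translation x mPB).
      congr lebesgue_rv; apply/seteqP; split=> y; rewrite /xsection/= !inE/=.
        by case=> _ /=; rewrite addrC.
      by rewrite addrC => ?; split.
    rewrite mul0e (_ : xsection _ _ = set0) ?measure0//; apply/seteqP.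
    by split=> y //; rewrite /xsection/= inE/= => -[Zx']; case: Zx; rewrite inE.
  rewrite ge0_integralZr//; last first.
    by apply/measurable_EFinP; exact: measurable_indic.
  by rewrite integral_indic// setIT.
have E2 : (\int[leb]_y leb (ysection E y) = 0)%E.
  apply: integral0_eq => h _; have [hr|hr] := pselect (ball 0 r h); last first.
    rewrite (_ : ysection _ _ = set0) ?measure0//; apply/seteqP; split=> x //.
    rewrite /ysection/= inE/= => -[[_ /= Bx] [_ /= Bxh]]; case: hr.
    have : ball x (r / 2 + r / 2) (x + h) by exact: ball_triangle (ball_sym Bx) Bxh.
    rewrite -splitr => /(rv_ballP _ _ r0) hr; apply/(rv_ballP _ _ r0) => i.
    by have := hr i; rewrite !mxE opprD addrA subrr.
  apply/eqP; rewrite eq_le measure_ge0 andbT -(sign_change_null hr).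
  apply: le_measure; rewrite ?inE.
  - exact: measurable_ysection.
  - exact: mS.
  - move=> x; rewrite /ysection/= inE/= => -[[Zx /= Bx] [Px _]]; split=> //.
    by apply: le_ball Bx; rewrite ler_pdivrMr// ler_peMr ?ler1n// ltW.
have : (leb ZB * leb PB = 0)%E by rewrite -E1 (tonelli_set leb leb mE).
by move=> /eqP; rewrite mule_eq0 => /orP[] /eqP; [left|right].
Qed.

End local.

Let locally_null (Q : set 'rV[R]_n) := [set x | exists r, [/\ 0 < r, ball x r `<=` O &
  leb (Q `&` ball x r) = 0%E]].

Let locally_null_open Q : measurable Q -> open (locally_null Q).
Proof.
move=> mQ; rewrite openE => x [r [r0 rO Qr]].
apply/nbhs_ballP; exists (r / 2); first by rewrite /= divr_gt0.
move=> y xy; exists (r / 2); have sub : ball y (r / 2) `<=` ball x r.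
  by move=> z yz; rewrite (splitr r); exact: ball_triangle xy yz.
split; [by rewrite divr_gt0|exact: subset_trans rO|].
apply/eqP; rewrite eq_le measure_ge0 andbT -Qr; apply: le_measure; rewrite ?inE.
- by apply: measurableI => //; exact: measurable_rv_ball.
- by apply: measurableI => //; exact: measurable_rv_ball.
- exact: setIS.
Qed.

Let locally_null_cover Q : measurable Q -> Q `<=` O -> O `<=` locally_null Q -> leb Q = 0%E.
Proof.
move=> mQ QO OQ; apply: lebesgue_rv_locally_null => // x /QO/OQ[r [r0 _ Qr]].
by exists r.
Qed.

(** The points around which w has a given sign almost everywhere form an open
    set; the two open sets obtained for the two signs are disjoint and cover the
    connected set O. *)
Theorem sign_dichotomy : connected O -> leb Z = 0%E \/ leb P = 0%E.
Proof.
move=> cO; have cover x : O x -> locally_null Z x \/ locally_null P x.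
  move=> Ox; have [r [phi [r0 r1 rO phiC phi1]]] := ball_cutoff oO Ox.
  have r2 : 0 < r / 2 by rewrite divr_gt0.
  have sub : ball x (r / 2) `<=` O.
    by apply: subset_trans rO; apply: le_ball; lra.
  have [h|h] := local_sign_dichotomy r0 r1 rO phiC phi1; [left|right];
    by exists (r / 2).
have disj x : locally_null Z x -> locally_null P x -> False.
  move=> [r [r0 rO Zr]] [s [s0 sO Ps]].
  pose t := Num.min r s; have t0 : 0 < t by rewrite lt_min r0.
  have : (leb (ball x t) <= leb (Z `&` ball x r) + leb (P `&` ball x s))%E.
    apply: (@le_trans _ _ (leb ((Z `&` ball x r) `|` (P `&` ball x s)))).
      apply: le_measure; rewrite ?inE; first exact: measurable_rv_ball.
        by apply: measurableU; apply: measurableI => //; exact: measurable_rv_ball.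
      move=> y ty; have yr : ball x r y by apply: le_ball ty; rewrite ge_min lexx.
      have ys : ball x s y by apply: le_ball ty; rewrite ge_min lexx orbT.
      by case: (leP (w y) 0) => wy; [left|right]; split=> //; split=> //; exact: rO.
    by apply: measureU2; apply: measurableI => //; exact: measurable_rv_ball.
  rewrite Zr Ps addr0 lebesgue_rv_ball// lee_fin leNgt exprn_gt0//.
  by rewrite mulrn_wgt0.
have gO Q : locally_null Q `<=` O.
  by move=> x [r [r0 rO _]]; apply: rO; exact: ballxx.
have [[x0 gx0]|nZ] := pselect (locally_null Z !=set0).
- left; apply: locally_null_cover => //; first by move=> x [].
  have -> : locally_null Z = O; last by [].
  apply: cO; first by exists x0.
  - exists (locally_null Z); first exact: locally_null_open.
    by apply/esym/setIidPr; exact: gO.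
  - exists (~` locally_null P); first exact/open_closedC/locally_null_open.
    apply/seteqP; split=> x.
      by move=> gx; split; [exact: gO gx|move=> /(disj x gx)].
    by move=> [/cover[]].
- right; apply: locally_null_cover => //; first by move=> x [].
  by move=> x /cover[gx|//]; case: nZ; exists x.
Qed.

End sign_dichotomy.

(** * Tangent inequalities for convex functions *)

Section convexity.
Context {R : realType}.
Variables (f f' : R -> R) (fC1 : C1_nonneg f f').
Hypothesis f_convex : convex_function (`[0, +oo[%classic : set R) f.

(** The difference quotients of f at t along points z k of the segment from t to s,
    multiplied by s - t, are at most f s - f t, and they converge to f' t. Only points of
    the half-line are used, so that t = 0 is allowed. *)
Lemma convex_tangent (t s : R) : 0 <= t -> 0 <= s -> f' t * (s - t) <= f s - f t.
Proof.
move=> t0 s0; have [->|st] := eqVneq s t; first by rewrite !subrr mulr0.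
pose z (k : nat) : R := t + k.+2%:R^-1 * (s - t).
have lam0 k : 0 < (k.+2%:R^-1 : R) by rewrite invr_gt0.
have lam1 k : (k.+2%:R^-1 : R) <= 1 by rewrite invf_le1// ler1n.
have zt k : z k - t = k.+2%:R^-1 * (s - t) by rewrite /z addrC addKr.
have z0 k : 0 <= z k.
  have -> : z k = (1 - k.+2%:R^-1) * t + k.+2%:R^-1 * s by rewrite /z; ring.
  by rewrite addr_ge0// mulr_ge0 ?subr_ge0// ltW.
have zcvg : z @ \oo --> within `[0, +oo[%classic t^'.
  have zt0 : z @ \oo --> t.
    rewrite -[X in _ --> X]addr0; apply: cvgD; first exact: cvg_cst.
    rewrite -[X in _ --> X](mul0r (s - t)); apply: cvgMl.
    rewrite (cvg_shiftS (fun k => k.+1%:R^-1 : R)); exact: cvg_harmonic.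
  have zne k : z k != t.
    rewrite -subr_eq0 zt; apply: mulf_neq0; last by rewrite subr_eq0.
    by rewrite gt_eqF.
  move=> U /= nU; have {}nU : \forall x \near t, x != t -> `[0, +oo[%classic x -> U x by [].
  have zU : \forall k \near \oo, z k != t -> `[0, +oo[%classic (z k) -> U (z k).
    exact: (zt0 _ nU).
  suff : \forall k \near \oo, U (z k) by [].
  apply: filterS zU => k h.
  by apply: (h (zne k)); rewrite /= in_itv/= andbT.
have qcvg : (f (z k) - f t) / (z k - t) @[k --> \oo] --> f' t.
  exact: cvg_comp zcvg (fC1.1 t t0).
have q_le k : (f (z k) - f t) / (z k - t) * (s - t) <= f s - f t.
  have -> : (f (z k) - f t) / (z k - t) * (s - t) = (f (z k) - f t) / k.+2%:R^-1.
    rewrite zt; move: (k.+2%:R^-1) (lam0 k) => l l0; field.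
    by rewrite subr_eq0 st gt_eqF.
  rewrite ler_pdivrMr//.
  have := f_convex (Itv01 (ltW (lam0 k)) (lam1 k)) (x := s) (y := t).
  rewrite !inE /= !in_itv /= !andbT => /(_ s0 t0).
  have -> : conv (Itv01 (ltW (lam0 k)) (lam1 k)) (s : convex_lmodType R^o) t = z k.
    change (k.+2%:R^-1 * s + (1 - k.+2%:R^-1) * t = z k).
    by rewrite /z; move: (k.+2%:R^-1) => l; ring.
  change (f (z k) <= k.+2%:R^-1 * f s + (1 - k.+2%:R^-1) * f t ->
    f (z k) - f t <= (f s - f t) * k.+2%:R^-1).
  set l := k.+2%:R^-1 => h.
  have -> : (f s - f t) * l = l * f s + (1 - l) * f t - f t by ring.
  by rewrite lerB.
have lcvg : (f (z k) - f t) / (z k - t) * (s - t) @[k --> \oo] --> f' t * (s - t).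
  exact: cvgMl.
rewrite -(cvg_lim _ lcvg)//; apply: limr_le; first exact: cvgP lcvg.
exact: nearW.
Qed.
(** Adding the two tangent inequalities between 0 and t. *)
Lemma convex_derivative_ge (t : R) : 0 <= t -> f' 0 <= f' t.
Proof.
rewrite le_eqVlt => /predU1P[<-//|t0].
have h1 := convex_tangent (lexx 0) (ltW t0).
have h2 := convex_tangent (ltW t0) (lexx 0).
rewrite -(ler_pM2r t0); move: h1 h2; rewrite subr0 sub0r mulrN => h1 h2.
by apply: le_trans h1 _; rewrite -lerN2 opprB.
Qed.

End convexity.

Section convexity_bounds.
Context {R : realType}.
Variables (f f' : R -> R) (fC1 : C1_nonneg f f').
Hypothesis f_convex : convex_function (`[0, +oo[%classic : set R) f.

Lemma convex_increment_le (s t : R) : 0 <= s -> 0 <= t -> f s - f t <= f' s * (s - t).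
Proof.
move=> s0 t0; have := convex_tangent fC1 f_convex s0 t0.
by rewrite -lerN2 -mulrN !opprB.
Qed.

(** The increment lies between the two tangent increments; the constant makes the
    factor at least the absolute values of both slopes. *)
Lemma convex_increment_norm (s t : R) : 0 <= s -> 0 <= t ->
  `|f s - f t| <= (f' s + f' t + (4 * `|f' 0| + 1)) * `|s - t|.
Proof.
move=> s0 t0; have hs := convex_increment_le s0 t0.
have ht := convex_tangent fC1 f_convex t0 s0.
have ds := convex_derivative_ge fC1 f_convex s0.
have dt := convex_derivative_ge fC1 f_convex t0.
have c0 : - `|f' 0| <= f' 0 by rewrite lerNl -normrN ler_norm.
move: `|f' 0| c0 (normr_ge0 (f' 0)) => C mC C0.
move: (f s - f t) (f' s) (f' t) (s - t) (f' 0) hs ht ds dt mC => d A B w m hs ht ds dt mC.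
rewrite ler_norml; case: (ger0P w) => w0; rewrite ?mulrN ?opprK; apply/andP; split.
- apply: le_trans ht; rewrite -mulNr ler_wpM2r//; lra.
- apply: (le_trans hs); rewrite ler_wpM2r//; lra.
- apply: le_trans ht; rewrite ler_wnM2r//; lra.
- apply: (le_trans hs); rewrite -mulNr ler_wnM2r//; lra.
Qed.

End convexity_bounds.

(** * Orthogonal transformations acting on functions *)

Section square_integrable.
Context {R : realType} {n : nat}.
Local Notation leb := (@lebesgue_rv R n).
Variables (O : set 'rV[R]_n) (mO : measurable O).
Implicit Types f g : 'rV[R]_n -> R.

Lemma L2_sub f g : L2 O f -> L2 O g -> L2 O (fun x => f x - g x).
Proof.
move=> [mf if_] [mg ig]; split; first exact: measurable_funB.
exact: (integrable_sqrB mO mf mg if_ ig).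
Qed.

Lemma L2_scale (c : R) f : L2 O f -> L2 O (fun x => c * f x).
Proof.
move=> [mf if_]; split; first exact: measurable_funM.
have := integrable_realZ mO (c ^+ 2) if_; apply: eq_integrable => // x _ /=.
by rewrite exprMn.
Qed.

Lemma L2_zero : L2 O (fun=> 0 : R).
Proof.
split; first exact: measurable_cst.
rewrite (_ : (fun x => _) = EFin \o (fun=> 0 : R)); first exact: integrable_real0.
by apply/funext => x; rewrite /= expr0n.
Qed.

Lemma L2_sum (I : Type) (s : seq I) (f : I -> 'rV[R]_n -> R) :
  (forall i, L2 O (f i)) -> L2 O (fun x => \sum_(i <- s) f i x).
Proof.
move=> hf; elim: s => [|i s IH].
  by under eq_fun do rewrite big_nil; exact: L2_zero.
under eq_fun do rewrite big_cons.
rewrite (_ : (fun x => _) = fun x => f i x - (-1) * \sum_(j <- s) f j x).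
  by apply: L2_sub => //; exact: L2_scale.
by apply/funext => x; rewrite mulN1r opprK.
Qed.

End square_integrable.

(** Both T and its inverse T' are needed: solutions are composed with T, and test
    functions, by change of variables, with T'. *)
Section rotation_invariance.
Context {R : realType} {N : nat}.
Local Notation leb := (@lebesgue_rv R N).
Variables (rho : 'M[R]_N) (rho_orth : orthogonal_mx rho).
Variables (O : set 'rV[R]_N) (oO : open O).
Hypothesis rhoO : [set mx_act rho x | x in O] = O.

Let mO : measurable O := measurable_rv_open oO.
Local Notation T := (mx_act rho).
Local Notation T' := (mx_act rho^T).

Let rho'_orth : orthogonal_mx rho^T.
Proof. by rewrite /orthogonal_mx trmxK; exact: orthogonal_mx_tr. Qed.

Let TO : T @^-1` O = O.
Proof.
rewrite -[X in _ @^-1` X]rhoO; apply/seteqP; split=> x; last by exists x.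
by move=> [y Oy /(can_inj (mx_actK rho_orth)) <-].
Qed.

Let T'O : T' @^-1` O = O.
Proof.
apply/seteqP; split=> x /=.
  by rewrite -[X in X _ -> _]TO /= mx_actKV.
by move=> Ox; rewrite -[X in X _]TO /= mx_actKV.
Qed.

Let mT := measurable_mx_act rho.
Let mT' := measurable_mx_act rho^T.
Let lT : forall A, measurable A -> leb (T @^-1` A) = leb A.
Proof. by move=> A mA; exact: lebesgue_rv_rotation. Qed.
Let lT' : forall A, measurable A -> leb (T' @^-1` A) = leb A.
Proof. by move=> A mA; exact: lebesgue_rv_rotation. Qed.

Lemma Rintegral_mx_act (f : 'rV[R]_N -> R) : measurable_fun O f ->
  \int[leb]_(x in O) f (T x) = \int[leb]_(x in O) f x.
Proof. by move=> mf; have := Rintegral_preserving mT lT mO mf; rewrite TO. Qed.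

Lemma Rintegral_mx_actV (f : 'rV[R]_N -> R) : measurable_fun O f ->
  \int[leb]_(x in O) f (T' x) = \int[leb]_(x in O) f x.
Proof. by move=> mf; have := Rintegral_preserving mT' lT' mO mf; rewrite T'O. Qed.

Lemma measurable_fun_mx_act (f : 'rV[R]_N -> R) : measurable_fun O f ->
  measurable_fun O (f \o T).
Proof. by move=> mf; have := measurable_fun_preserving mT mO mf; rewrite TO. Qed.

Lemma integrable_mx_act (f : 'rV[R]_N -> R) : leb.-integrable O (EFin \o f) ->
  leb.-integrable O (EFin \o (f \o T)).
Proof. by move=> if_; have := integrable_preserving mT lT mO if_; rewrite TO. Qed.

Lemma L2_mx_act (f : 'rV[R]_N -> R) : L2 O f -> L2 O (f \o T).
Proof.
move=> [mf if_]; split; first exact: measurable_fun_mx_act.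
exact: (integrable_mx_act (f := fun x => f x ^+ 2)).
Qed.

Lemma L1_loc_mx_act (f : 'rV[R]_N -> R) : L1_loc O f -> L1_loc O (f \o T).
Proof.
move=> [mf if_]; split; first exact: measurable_fun_mx_act.
move=> K cK KO; pose TK := T @` K.
have cTK : compact TK.
  by apply: continuous_compact cK; apply: continuous_subspaceT => x; exact: continuous_mx_act.
have mTK := compact_measurable_rv cTK.
have TKO : TK `<=` O by move=> _ [x Kx <-]; rewrite -rhoO; exists x => //; exact: KO.
have := integrable_preserving mT lT mTK (if_ _ cTK TKO).
rewrite (_ : T @^-1` TK = K)//; apply/seteqP; split=> x; last by exists x.
by move=> [y Ky /(can_inj (mx_actK rho_orth)) <-].
Qed.

Lemma Ck_c_mx_actV k (f : 'rV[R]_N -> R) : Ck_c k O f -> Ck_c k O (f \o T').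
Proof.
move=> [fC kf]; split; first exact: of_class_C_mx_act.
exact: compactly_supported_mx_act.
Qed.

Lemma Coo_c_mx_actV (f : 'rV[R]_N -> R) : Coo_c O f -> Coo_c O (f \o T').
Proof.
move=> [fC kf]; split=> [k|]; first exact: of_class_C_mx_act.
exact: compactly_supported_mx_act.
Qed.

Lemma Coo_c_mx_act (f : 'rV[R]_N -> R) : Coo_c O f -> Coo_c O (f \o T).
Proof.
move=> [fC kf]; split=> [k|]; first exact: of_class_C_mx_act.
exact: compactly_supported_mx_act.
Qed.

Lemma sum_sqr_mx_act (v : 'I_N -> R) :
  \sum_i (\sum_j rho j i * v j) ^+ 2 = \sum_j v j ^+ 2.
Proof.
have := mx_act_sumsq rho'_orth (\row_j v j).
under [X in _ = X -> _]eq_bigr do rewrite mxE.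
move=> <-; apply: eq_bigr => i _; rewrite mx_actE; congr (_ ^+ 2).
by apply: eq_bigr => j _; rewrite !mxE mulrC.
Qed.

Lemma sum_sqr_mx_actV (v : 'I_N -> R) :
  \sum_i (\sum_j rho i j * v j) ^+ 2 = \sum_j v j ^+ 2.
Proof.
have := mx_act_sumsq rho_orth (\row_j v j).
under [X in _ = X -> _]eq_bigr do rewrite mxE.
move=> <-; apply: eq_bigr => i _; rewrite mx_actE; congr (_ ^+ 2).
by apply: eq_bigr => j _; rewrite !mxE mulrC.
Qed.

Lemma grad_sq_mx_actV (f : 'rV[R]_N -> R) x : of_class_C 1 f ->
  grad_sq (f \o T') x = grad_sq f (T' x).
Proof.
move=> fC; rewrite /grad_sq -[RHS]sum_sqr_mx_actV; apply: eq_bigr => i _.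
rewrite partial_deriv_mx_act//; congr (_ ^+ 2).
by apply: eq_bigr => j _; rewrite mxE.
Qed.

(** A test function phi for A o T is the test function phi o T' for A. *)
Lemma stable_potential_mx_act (A : 'rV[R]_N -> R) : L1_loc O A ->
  stable_potential O A -> stable_potential O (A \o T).
Proof.
move=> LA SA phi kphi; have k' := Ck_c_mx_actV kphi; have := SA _ k'.
have [phiC _] := kphi.
have mg : measurable_fun O (grad_sq phi) := integrable_measurable_real (integrable_grad_sq oO kphi).
have Eg : \int[leb]_(x in O) grad_sq (phi \o T') x = \int[leb]_(x in O) grad_sq phi x.
  apply: etrans (Rintegral_mx_actV mg).
  by apply: eq_Rintegral => x _; exact: grad_sq_mx_actV.
have mA : measurable_fun O (fun x => A x * (phi \o T') x ^+ 2).
  exact: integrable_measurable_real (integrable_potential oO LA k').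
have EA : \int[leb]_(x in O) (A (T x) * phi x ^+ 2) =
    \int[leb]_(x in O) (A x * (phi \o T') x ^+ 2).
  apply: etrans (Rintegral_mx_act mA).
  by apply: eq_Rintegral => x _; rewrite /= mx_actK.
move=> h; apply: le_trans (_ : _ <= \int[leb]_(x in O) (A x * (phi \o T') x ^+ 2)) _.
  by rewrite le_eqVlt EA eqxx.
apply: (le_trans h); rewrite le_eqVlt; apply/orP; left; exact/eqP.
Qed.

Lemma ae_mx_act (P : 'rV[R]_N -> Prop) : {ae leb, forall x, O x -> P x} ->
  {ae leb, forall x, O x -> P (T x)}.
Proof.
move=> h; have := ae_preserving mT lT h; apply: filterS => x + Ox; apply.
by move: Ox; rewrite -[X in X _ -> _]TO.
Qed.

End rotation_invariance.

(** * The difference of a solution and its transform *)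

Section test_functions.
Context {R : realType} {n : nat}.
Local Notation leb := (@lebesgue_rv R n).
Implicit Types (O : set 'rV[R]_n) (f chi psi : 'rV[R]_n -> R).

Lemma Coo_c_partial O psi i : Coo_c O psi -> Coo_c O (partial_deriv i psi).
Proof.
move=> [pC kp]; split; last exact: compactly_supported_partial.
by move=> k; have [_ /(_ i)[]] := pC k.+1.
Qed.

Lemma compactly_supported_L2 O chi : open O -> continuous chi -> compactly_supported_in O chi ->
  L2 O chi.
Proof.
move=> oO cg kg; split; first exact: measurable_funTS (continuous_measurable_rv cg).
apply: (compactly_supported_integrable (f := fun x => chi x ^+ 2) oO).
  by move=> x; exact: (continuousM (cg x) (cg x)).
by apply: (compactly_supportedU _ kg kg) => x -> _; rewrite expr0n.
Qed.

Lemma L2_test_integrable O f psi : open O -> L2 O f -> continuous psi ->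
  compactly_supported_in O psi -> leb.-integrable O (EFin \o (fun x => f x * psi x)).
Proof.
move=> oO [mf if_] cp kp; have [mp ip] := compactly_supported_L2 oO cp kp.
exact: (integrable_sqrM (measurable_rv_open oO)).
Qed.

End test_functions.

Section difference_equation.
Context {R : realType} {N : nat}.
Local Notation leb := (@lebesgue_rv R N).
Variables (rho : 'M[R]_N) (rho_orth : orthogonal_mx rho).
Variables (O : set 'rV[R]_N) (oO : open O).
Hypothesis rhoO : [set mx_act rho x | x in O] = O.
Variables (u a : 'rV[R]_N -> R) (c : R) (G : 'I_N -> 'rV[R]_N -> R).
Hypothesis uG : H1_grad O (fun x => u x - c) G.
Hypothesis La : L1_loc O a.
Hypothesis u_eq : forall psi, Coo_c O psi ->
  - (\int[leb]_(x in O) (u x * laplacian psi x)) = \int[leb]_(x in O) (a x * psi x).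

Local Notation T := (mx_act rho).
Local Notation T' := (mx_act rho^T).

Let mO : measurable O := measurable_rv_open oO.

Let cont psi i : Coo_c O psi -> continuous (partial_deriv i psi).
Proof. by move=> /Coo_c_partial -/(_ i)[pC _]; exact: (pC 0).1. Qed.

Let iGp psi i : Coo_c O psi ->
  leb.-integrable O (EFin \o (fun x => G i x * partial_deriv i psi x)).
Proof.
move=> pC; have [_ /(_ i)[LG _]] := uG.
apply: (L2_test_integrable oO LG (cont pC)).
by have [] := Coo_c_partial i pC.
Qed.

Let laplacian_integrable psi : Coo_c O psi -> leb.-integrable O (EFin \o laplacian psi).
Proof.
move=> pC; apply: (integrable_real_sum mO) => i.
have [pC2 kp2] := Coo_c_partial i (Coo_c_partial i pC).
exact: (compactly_supported_integrable oO (pC2 0%N).1 kp2).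
Qed.

(** The equation only involves u and second derivatives of test functions; the
    weak gradient is brought in by integrating by parts once. The constant c survives
    as a multiple of the integral of the Laplacian, which disappears in the
    difference. *)
Lemma gradient_test psi : Coo_c O psi ->
  \int[leb]_(x in O) (\sum_i G i x * partial_deriv i psi x) =
  \int[leb]_(x in O) (a x * psi x) + c * \int[leb]_(x in O) laplacian psi x.
Proof.
move=> pC; have [Lu wG] := uG.
have i2 i : leb.-integrable O
    (EFin \o (fun x => (u x - c) * partial_deriv i (partial_deriv i psi) x)).
  have [pC2 kp2] := Coo_c_partial i (Coo_c_partial i pC).
  exact: (L2_test_integrable oO Lu (pC2 0%N).1 kp2).
have il := laplacian_integrable pC.
have iL : leb.-integrable O (EFin \o (fun x => (u x - c) * laplacian psi x)).
  have := integrable_real_sum mO (index_enum 'I_N) i2.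
  apply: eq_integrable => // x _ /=.
  by rewrite /laplacian mulr_sumr.
have icl := integrable_realZ mO c il.
rewrite (Rintegral_sum mO _ (fun i => iGp i pC)).
transitivity (- \int[leb]_(x in O) ((u x - c) * laplacian psi x)).
  transitivity (- \sum_i \int[leb]_(x in O) ((u x - c) * partial_deriv i (partial_deriv i psi) x)).
    rewrite -sumrN; apply: eq_bigr => i _.
    have [_ wi] := wG i.
    by rewrite (wi _ (Coo_c_partial i pC)) opprK.
  congr (- _); rewrite -(Rintegral_sum mO _ i2).
  by apply: eq_Rintegral => x _; rewrite /laplacian mulr_sumr.
have E : \int[leb]_(x in O) (u x * laplacian psi x) =
    \int[leb]_(x in O) ((u x - c) * laplacian psi x) + c * \int[leb]_(x in O) laplacian psi x.
  rewrite -(RintegralZl c mO il) -(RintegralD mO iL icl).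
  by apply: eq_Rintegral => x _ /=; ring.
by rewrite -(u_eq pC) E opprD addrNK.
Qed.

(** The term with T is the gradient term of G tested with psi o T', so both terms
    are computed by [gradient_test]. *)
Lemma difference_equation psi : Coo_c O psi ->
  \int[leb]_(x in O) (\sum_i (G i x - \sum_j rho j i * G j (T x)) * partial_deriv i psi x) =
  \int[leb]_(x in O) ((a x - a (T x)) * psi x).
Proof.
move=> pC; have pC' := Coo_c_mx_actV rho_orth rhoO pC.
have [p0 kp] := pC; have p1 := p0 1%N; have p2 := p0 2%N.
have cp := (p0 0%N).1.
have iS : leb.-integrable O (EFin \o (fun x => \sum_i G i x * partial_deriv i psi x)).
  exact: (integrable_real_sum mO _ (fun i => iGp i pC)).
pose S' y := \sum_j G j y * partial_deriv j (psi \o T') y.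
have iS' : leb.-integrable O (EFin \o S').
  exact: (integrable_real_sum mO _ (fun i => iGp i pC')).
have S'E x : S' (T x) = \sum_i (\sum_j rho j i * G j (T x)) * partial_deriv i psi x.
  rewrite /S'.
  under eq_bigr => j _.
    rewrite partial_deriv_mx_act// mx_actK// mulr_sumr.
    under eq_bigr => i _ do rewrite mxE mulrA [G j _ * _]mulrC.
    over.
  by rewrite exchange_big; apply: eq_bigr => i _; rewrite mulr_suml.
have iS'T := integrable_mx_act rho_orth oO rhoO iS'.
have E1 : \int[leb]_(x in O) S' (T x) = \int[leb]_(x in O) S' x.
  exact: (Rintegral_mx_act rho_orth oO rhoO (integrable_measurable_real iS')).
have il := laplacian_integrable pC.
have rho'_orth : orthogonal_mx rho^T by rewrite /orthogonal_mx trmxK; exact: orthogonal_mx_tr.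
have E2 : \int[leb]_(x in O) laplacian (psi \o T') x = \int[leb]_(x in O) laplacian psi x.
  apply: etrans (Rintegral_mx_actV rho_orth oO rhoO (integrable_measurable_real il)).
  by apply: eq_Rintegral => x _; exact: laplacian_mx_act.
have ia : leb.-integrable O (EFin \o (fun x => a x * psi x)).
  exact: (L1_loc_integrableM oO La cp kp).
have ia' : leb.-integrable O (EFin \o (fun x => a x * (psi \o T') x)).
  have [C' kp'] := pC'; exact: (L1_loc_integrableM oO La (C' 0%N).1 kp').
have ia'T := integrable_mx_act rho_orth oO rhoO ia'.
have E3 : \int[leb]_(x in O) (a (T x) * psi x) = \int[leb]_(x in O) (a x * (psi \o T') x).
  apply: etrans (Rintegral_mx_act rho_orth oO rhoO (integrable_measurable_real ia')).
  by apply: eq_Rintegral => x _; rewrite /= mx_actK.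
transitivity (\int[leb]_(x in O) (\sum_i G i x * partial_deriv i psi x) -
  \int[leb]_(x in O) S' (T x)).
  rewrite -(RintegralB mO iS iS'T); apply: eq_Rintegral => x _.
  by rewrite /= S'E -sumrB; apply: eq_bigr => i _; rewrite mulrBl.
have H2 := etrans (gradient_test pC')
  (congr1 (fun t => \int[leb]_(x in O) (a x * (psi \o T') x) + c * t) E2).
apply: etrans (congr2 (fun s t => s - t) (gradient_test pC) (etrans E1 H2)) _.
have cancel_r (s t r : R) : s + r - (t + r) = s - t by ring.
apply: etrans (cancel_r _ _ _) _.
apply: etrans (congr1 (fun t => \int[leb]_(x in O) (a x * psi x) - t) (esym E3)) _.
have iaT : leb.-integrable O (EFin \o (fun x => a (T x) * psi x)).
  suff -> : EFin \o (fun x => a (T x) * psi x) =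
      EFin \o ((fun x => a x * (psi \o T') x) \o T) by exact: ia'T.
  by apply/funext => x; rewrite /= (mx_actK rho_orth x).
apply: etrans (esym (RintegralB mO ia iaT)) _.
by apply: eq_Rintegral => x _; rewrite mulrBl.
Qed.

End difference_equation.

Section difference_approximation.
Context {R : realType} {N : nat}.
Local Notation leb := (@lebesgue_rv R N).
Variables (rho : 'M[R]_N) (rho_orth : orthogonal_mx rho).
Variables (O : set 'rV[R]_N) (oO : open O).
Hypothesis rhoO : [set mx_act rho x | x in O] = O.
Local Notation T := (mx_act rho).

Let mO : measurable O := measurable_rv_open oO.

Definition H1_error (U : 'rV[R]_N -> R) (G : 'I_N -> 'rV[R]_N -> R) chi x :=
  (U x - chi x) ^+ 2 + \sum_i (G i x - partial_deriv i chi x) ^+ 2.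

(** Orthogonality is used in the form that the vector with entries
    sum_j rho j i v_j has the same Euclidean norm as v. *)
Lemma difference_H1_error (U : 'rV[R]_N -> R) (G : 'I_N -> 'rV[R]_N -> R) chi x :
  of_class_C 1 chi ->
  H1_error (fun x => U x - U (T x)) (fun i x => G i x - \sum_j rho j i * G j (T x))
    (fun x => chi x - chi (T x)) x <= 2 * (H1_error U G chi x + H1_error U G chi (T x)).
Proof.
move=> cC; rewrite /H1_error.
have -> : U x - U (T x) - (chi x - chi (T x)) = (U x - chi x) - (U (T x) - chi (T x)) by ring.
have cTC : of_class_C 1 (chi \o T) := of_class_C_mx_act rho cC.
have dE i : partial_deriv i (fun x => chi x - chi (T x)) x =
    partial_deriv i chi x - \sum_j rho j i * partial_deriv j chi (T x).
  have d1 := of_class_C_is_derive x i cC; have d2 := of_class_C_is_derive x i cTC.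
  have [_ E] := is_deriveB d1 d2; apply: etrans E _; congr (_ - _).
  by rewrite partial_deriv_mx_act.
have le2 (a b : R) : (a - b) ^+ 2 <= 2 * a ^+ 2 + 2 * b ^+ 2.
  by have := diff_sqr_le 0 a b; rewrite !sub0r !sqrrN mulrDr.
have -> : \sum_i (G i x - \sum_j rho j i * G j (T x) -
      partial_deriv i (fun x => chi x - chi (T x)) x) ^+ 2 =
    \sum_i ((G i x - partial_deriv i chi x) -
      \sum_j rho j i * (G j (T x) - partial_deriv j chi (T x))) ^+ 2.
  apply: eq_bigr => i _; rewrite dE; congr (_ ^+ 2).
  have -> : \sum_j rho j i * (G j (T x) - partial_deriv j chi (T x)) =
      \sum_j rho j i * G j (T x) - \sum_j rho j i * partial_deriv j chi (T x).
    by rewrite -sumrB; apply: eq_bigr => j _; rewrite mulrBr.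
  by ring.
apply: (@le_trans _ _ (2 * (U x - chi x) ^+ 2 + 2 * (U (T x) - chi (T x)) ^+ 2 +
   \sum_i (2 * (G i x - partial_deriv i chi x) ^+ 2 +
     2 * (\sum_j rho j i * (G j (T x) - partial_deriv j chi (T x))) ^+ 2))).
  by apply: lerD; [exact: le2|apply: ler_sum => i _; exact: le2].
rewrite big_split/= -!mulr_sumr (sum_sqr_mx_act rho_orth) le_eqVlt; apply/orP; left.
by apply/eqP; ring.
Qed.

Section error_integral.
Variables (U chi : 'rV[R]_N -> R) (G : 'I_N -> 'rV[R]_N -> R).
Hypotheses (LU : L2 O U) (LG : forall i, L2 O (G i)) (cC : Coo_c O chi).

Let LUc : L2 O (fun x => U x - chi x).
Proof.
have [sC ks] := cC.
exact: (L2_sub mO LU (compactly_supported_L2 oO (sC 0%N).1 ks)).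
Qed.

Let LGc i : L2 O (fun x => G i x - partial_deriv i chi x).
Proof.
have [sC ks] := Coo_c_partial i cC.
exact: (L2_sub mO (LG i) (compactly_supported_L2 oO (sC 0%N).1 ks)).
Qed.

Let iG : leb.-integrable O
  (EFin \o (fun x => \sum_i (G i x - partial_deriv i chi x) ^+ 2)).
Proof. exact: (integrable_real_sum mO _ (fun i => (LGc i).2)). Qed.

Lemma H1_error_integrable : leb.-integrable O (EFin \o H1_error U G chi).
Proof. exact: (integrable_realD mO LUc.2 iG). Qed.

Lemma H1_error_Rintegral : \int[leb]_(x in O) H1_error U G chi x =
  \int[leb]_(x in O) ((U x - chi x) ^+ 2)
  + \sum_i \int[leb]_(x in O) ((G i x - partial_deriv i chi x) ^+ 2).
Proof.
exact: (etrans (RintegralD mO LUc.2 iG) (congr1 (fun t => _ + t)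
  (Rintegral_sum mO _ (fun i => (LGc i).2)))).
Qed.

End error_integral.

Lemma difference_L2 (U : 'rV[R]_N -> R) : L2 O U -> L2 O (fun x => U x - U (T x)).
Proof. by move=> LU; exact: (L2_sub mO LU (L2_mx_act rho_orth oO rhoO LU)). Qed.

Lemma difference_grad_L2 (G : 'I_N -> 'rV[R]_N -> R) : (forall i, L2 O (G i)) ->
  forall i, L2 O (fun x => G i x - \sum_j rho j i * G j (T x)).
Proof.
move=> LG i; apply: (L2_sub mO (LG i)); apply: (L2_sum mO) => j.
exact: (L2_scale mO _ (L2_mx_act rho_orth oO rhoO (LG j))).
Qed.

(** The differences chi - chi o T of approximations of U approximate U - U o T; the
    bound 4^-(k+1) on the error of chi absorbs the factor 4 = 2 (1 + 1) lost in
    [difference_H1_error]. *)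
Lemma difference_approximation (U : 'rV[R]_N -> R) (G : 'I_N -> 'rV[R]_N -> R) :
  L2 O U -> (forall i, L2 O (G i)) ->
  (forall e : R, 0 < e -> exists2 phi, Coo_c O phi &
      (\int[leb]_(x in O) ((U x - phi x) ^+ 2))
       + (\sum_(i < N)
           \int[leb]_(x in O) ((G i x - partial_deriv i phi x) ^+ 2)) < e) ->
  exists phi : nat -> 'rV[R]_N -> R, (forall k, Coo_c O (phi k)) /\
    forall k, \int[leb]_(x in O) H1_error (fun x => U x - U (T x))
      (fun i x => G i x - \sum_j rho j i * G j (T x)) (phi k) x <= 1 / 4 ^+ k.
Proof.
move=> LU LG approx; have eq_ler (s t : R) : s = t -> s <= t by move=> ->.
have arith (s t : R) : s < 1 / 4 * t -> 2 * (s + s) <= 1 * t by move=> *; lra.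
have ek_gt0 k : 0 < 1 / 4 ^+ k.+1 :> R by rewrite divr_gt0// exprn_gt0.
have /choice[chi chiP] : forall k, exists chi, Coo_c O chi /\
    \int[leb]_(x in O) H1_error U G chi x < 1 / 4 ^+ k.+1.
  move=> k; have [chi cC clt] := approx _ (ek_gt0 k); exists chi; split=> //.
  exact (le_lt_trans (eq_ler _ _ (H1_error_Rintegral LU LG cC)) clt).
have phiC k : Coo_c O (fun x => chi k x - chi k (T x)).
  have [cC _] := chiP k.
  have [tC kt] := Coo_c_mx_act rho_orth rhoO cC; have [sC ks] := cC.
  split=> [l|]; first exact: (of_class_CB (sC l) (tC l)).
  by apply: (compactly_supportedU _ ks kt) => x /= -> ->; rewrite subrr.
exists (fun k x => chi k x - chi k (T x)); split=> // k; have [cC clt] := chiP k.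
have iE := H1_error_integrable LU LG cC.
have iET := integrable_mx_act rho_orth oO rhoO iE.
have ET := Rintegral_mx_act rho_orth oO rhoO (integrable_measurable_real iE).
have iET1 := integrable_realD mO iE iET.
have iET2 := integrable_realZ mO 2 iET1.
have iD := H1_error_integrable (difference_L2 LU) (difference_grad_L2 LG) (phiC k).
apply: (le_trans (le_Rintegral mO iD iET2 (fun x _ => difference_H1_error U G x (cC.1 1%N)))).
apply: (le_trans (eq_ler _ _ (etrans (RintegralZl 2 mO iET1)
  (congr1 (fun t => 2 * t) (etrans (RintegralD mO iE iET) (congr1 (fun t => _ + t) ET)))))).
move: clt; rewrite exprS invfM mulrA.
exact: arith.
Qed.

End difference_approximation.

(** * Symmetry of stable solutions *)

Theorem proposition12 (R : realType) (N : nat) (N_ge1 : (1 <= N)%N)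
  (f f' : R -> R) (fC1 : C1_nonneg f f')
  (f_convex : convex_function (`[0, +oo[%classic : set R) f)
  (rho : 'M[R]_N) (rho_orth : orthogonal_mx rho)
  (Omega : set 'rV[R]_N) (Omega_dom : bounded_domain Omega)
  (Omega_inv : [set mx_act rho x | x in Omega] = Omega)
  (c : R) (c_ge0 : 0 <= c)
  (u : 'rV[R]_N -> R) (uH1 : H1 Omega u)
  (u_bdry : H1_0 Omega (fun x => u x - c))
  (u_stable : stable_solution Omega f f' u)
  (rho_fix : exists2 x, Omega x & mx_act rho x = x) :
  {ae @lebesgue_rv R N, forall x, Omega x -> u x = u (mx_act rho x)}.
Proof.
have [oO cO _ bO] := Omega_dom.
have mO := measurable_rv_open oO.
have [[_ u_ge0 La u_eq] LA SA] := u_stable.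
have [G uG approx] := u_bdry.
have [LU LG'] := uG.
have LG i : L2 Omega (G i) := (LG' i).1.
set a := comp_nonneg f u in La u_eq.
set A := comp_nonneg f' u in LA SA.
pose T := mx_act rho.
pose U x := u x - c.
pose w x := U x - U (T x).
pose g i x := G i x - \sum_j rho j i * G j (T x).
pose d x := a x - a (T x).
have [phi [phiC phi_cv]] := difference_approximation rho_orth oO Omega_inv LU LG approx.
have Lw : L2 Omega w := difference_L2 rho_orth oO Omega_inv LU.
have Lg : forall i, L2 Omega (g i) := difference_grad_L2 rho_orth oO Omega_inv LG.
have LB := L1_loc_mx_act rho_orth oO Omega_inv LA.
have SB := stable_potential_mx_act rho_orth oO Omega_inv LA SA.
have A_ge x : - `|f' 0| <= A x.
  apply: (@le_trans _ _ (f' 0)); first by rewrite lerNl -normrN ler_norm.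
  by apply: (convex_derivative_ge fC1 f_convex); rewrite le_max lexx.
have md : measurable_fun Omega d.
  exact: (measurable_funB La.1 (L1_loc_mx_act rho_orth oO Omega_inv La).1).
have uT_ge0 := ae_mx_act rho_orth Omega_inv u_ge0.
(* The nonlinearity is evaluated at max 0 u, which is u almost everywhere. *)
have wE x : 0 <= u x -> 0 <= u (T x) -> w x = Num.max 0 (u x) - Num.max 0 (u (T x)).
  by move=> u0 uT0; rewrite !max_r// /w /U; ring.
have dM : {ae @lebesgue_rv R N, forall x, Omega x ->
    `|d x| <= (A x + A (T x) + (4 * `|f' 0| + 1)) * `|w x| }.
  apply: filterS2 u_ge0 uT_ge0 => x u0 uT0 Ox; rewrite (wE _ (u0 Ox) (uT0 Ox)).
  by apply: (convex_increment_norm fC1 f_convex); rewrite le_max lexx.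
have dA : {ae @lebesgue_rv R N, forall x, Omega x -> 0 < w x -> d x <= A x * w x}.
  apply: filterS2 u_ge0 uT_ge0 => x u0 uT0 Ox _; rewrite (wE _ (u0 Ox) (uT0 Ox)).
  by apply: (convex_increment_le fC1 f_convex); rewrite le_max lexx.
have weak_eq := difference_equation rho_orth oO Omega_inv uG La u_eq.
have [q [b [qC qE b0 bcvg qcvg]]] := positive_part_energy oO (normr_ge0 (f' 0)) Lw.1 Lw.2
  (fun i => (Lg i).1) (fun i => (Lg i).2) phiC phi_cv LA LB SA SB A_ge (fun x => A_ge (T x))
  md dM dA weak_eq.
have signs := sign_dichotomy oO Lw.1 LA SA qC qE b0 bcvg qcvg cO.
have finO := lebesgue_rv_bounded mO bO.
have iw := finite_measure_integrable_sqr mO finO Lw.1 Lw.2.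
have iU := finite_measure_integrable_sqr mO finO LU.1 LU.2.
have iUT := integrable_mx_act rho_orth oO Omega_inv iU.
have w_mean : \int[@lebesgue_rv R N]_(x in Omega) w x = 0.
  apply: etrans (RintegralB mO iU iUT) _; apply/eqP; rewrite subr_eq0; apply/eqP.
  exact: (esym (Rintegral_mx_act rho_orth oO Omega_inv LU.1)).
have w0 : {ae @lebesgue_rv R N, forall x, Omega x -> w x = 0}.
  case: signs => null.
  - apply: (nonneg_zero_mean mO iw) => //.
    have mZ := measurable_nonpositive mO Lw.1.
    by apply: filterS (null_inter_ae null mZ) => x h Ox;
      move: (h Ox) => /negP; rewrite -ltNge => /ltW.
  - have mP := measurable_positive mO Lw.1.
    have inw := integrable_realZ mO (-1) iw.
    have nw_mean : \int[@lebesgue_rv R N]_(x in Omega) (-1 * w x) = 0.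
      by apply: etrans (RintegralZl (-1) mO iw) _; rewrite w_mean mulr0.
    have nw_ge0 : {ae @lebesgue_rv R N, forall x, Omega x -> 0 <= -1 * w x}.
      apply: filterS (null_inter_ae null mP) => x h Ox; move: (h Ox) => /negP.
      by rewrite -leNgt mulN1r oppr_ge0.
    apply: filterS (nonneg_zero_mean mO inw nw_ge0 nw_mean) => x h Ox.
    by apply/eqP; rewrite -oppr_eq0 -mulN1r h.
apply: filterS w0 => x h Ox; move: (h Ox); rewrite /w /U => /eqP.
by rewrite subr_eq0 => /eqP /addIr.
Qed.
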